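(* Let $T\in\mathcal{C}^{r+1}(\mathbb{T}^d,\mathbb{T}^d)$, $r>1$, $d>1$, be an Anosov map, let $p\in\mathbb{Z}^+$, $q>0$ satisfy $p+q<r$, let $\{q_\epsilon\}_{\epsilon\in(0,\epsilon_1)}\subseteq\mathcal{C}^\infty(\mathbb{T}^d,\mathbb{R})$ satisfy (S1) and (S2), and let $\mathcal{L}_{\epsilon,n}$ be the operators defined in the context. Let $\epsilon_2\in(0,\epsilon_1)$ be such that $\{\mathcal{L}_\epsilon\}_{\epsilon\in[0,\epsilon_2)}$ satisfies (KL) on $B^{p,q}_{\mathbb{C}}$ with $|\cdot|=\|\cdot\|_{p-1,q+1}$ (such $\epsilon_2$ exists). Then there exist $\epsilon_3\in(0,\epsilon_2)$ and a map $N:[0,\epsilon_3)\to\mathbb{N}\cup\{\infty\}$ with $N^{-1}(\infty)=\{0\}$ such that for any map $n:[0,\epsilon_3)\to\mathbb{N}\cup\{\infty\}$ with $n\ge N$ the family of operators $\{\mathcal{L}_{\epsilon,n(\epsilon)}\}_{\epsilon\in[0,\epsilon_3)}$ satisfies (KL) on $B^{p,q}_{\mathbb{C}}$ with $|\cdot|=\|\cdot\|_{p-1,q+1}$.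
   Context: Setting and spaces. $X=\mathbb{T}^d=\mathbb{R}^d/\mathbb{Z}^d$; $\mathrm{Leb}$ is normalised Haar measure. $T$ is an Anosov map (diffeomorphism) with stable/unstable bundles $E^s,E^u$ of dimensions $d_s,d_u$. $X$ carries a $\mathcal{C}^\infty$ adapted Riemannian metric: there are $\nu_s<1<\nu_u$ with $\|D_xT|_{E^s(x)}\|<\nu_s$ and $\|D_xT^{-1}|_{E^u(x)}\|<\nu_u^{-1}$ for all $x$. $\Omega$ is the Riemannian measure. The transfer operator $\mathcal{L}$ is given by $\int(\mathcal{L}h)u\,d\Omega=\int h\,(u\circ T)\,d\Omega$ for $h,u\in\mathcal{C}^r$. Admissible leaves $\Sigma$ (Gouëzel–Liverani): fix a small $\kappa>0$ and let $\mathcal{C}(x)=\{u+v:u\in E^s(x),v\perp E^s(x),\|v\|\le\kappa\|u\|\}$, with $\kappa$ so small that $D_xT^{-1}$ maps $\mathcal{C}(x)\setminus\{0\}$ into the interior of $\mathcal{C}(T^{-1}x)$ and expands vectors of $\mathcal{C}(x)$ by at least $\nu_s^{-1}$. Fix finitely many $\mathcal{C}^\infty$ charts $\psi_i:(-r_i,r_i)^d\to X$ such that $D_0\psi_i$ is an isometry; $D_0\psi_i(\mathbb{R}^{d_s}\times\{0\})=E^s(\psi_i(0))$; the $\mathcal{C}^{r+1}$ norms of $\psi_i,\psi_i^{-1}$ are at most $1+\kappa$; there is $c_i\in(\kappa,2\kappa)$ such that $\mathcal{C}_i=\{u+v:u\in\mathbb{R}^{d_s}\times\{0\},v\in\{0\}\times\mathbb{R}^{d_u},\|v\|\le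 c_i\|u\|\}$ satisfies $\mathcal{C}(\psi_i(x))\subseteq(D_x\psi_i)\mathcal{C}_i$ and $(D_{\psi_i(x)}T^{-1})(D_x\psi_i)\mathcal{C}_i\subseteq\mathcal{C}(T^{-1}\psi_i(x))$ for all $x$; and the sets $\psi_i((-r_i/2,r_i/2)^d)$ cover $X$. Let $G_i(K)$ be the set of graphs of $\mathcal{C}^{r+1}$ maps $\chi:U\subseteq(-r_i,r_i)^{d_s}\to(-r_i,r_i)^{d_u}$ with $\|\chi\|_{\mathcal{C}^{r+1}}\le K$ and $\|D\chi\|\le c_i$. Fix $K$ large enough that for some $K'<K$ one has $\psi_j^{-1}(T^{-1}(\psi_i(W)))\in G_j(K')$ for all $W\in G_i(K)$ and all $i,j$; fix $A>1$ large enough that $\nu_s(1+\kappa)^2\sqrt{1+4\kappa^2}<(A-1)/A$, and $\delta>0$ small with $A\delta<\min_i r_i/6$. An admissible leaf is a set $W=\psi_i\circ(\mathrm{Id},\chi)(\overline{B(x,\delta)})$ where $\overline{B(x,A\delta)}\subset(-2r_i/3,2r_i/3)^{d_s}$ and $\chi:\overline{B(x,A\delta)}\to(-2r_i/3,2r_i/3)^{d_u}$ has graph in $G_i(K)$. $\Sigma$ is the set of admissible leaves. For $W\in\Sigma$ let $\mathcal{V}^r(W)$ be the $\mathcal{C}^r$ vector fields defined on a neighbourhood of $W$, and $\mathcal{C}^q_0(W,\mathbb{R})$ the functions in $\mathcal{C}^q(W,\mathbb{R})$ vanishing on a neighbourhood of $\partial W$. For $h\in\mathcal{C}^r(X,\mathbb{R})$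 put $\|h\|^-_{p,q}=\sup_{W\in\Sigma}\sup_{v_1,\dots,v_p\in\mathcal{V}^r(W),|v_i|_{\mathcal{C}^r}\le1}\sup_{\varphi\in\mathcal{C}^q_0(W,\mathbb{R}),|\varphi|_{\mathcal{C}^q}\le1}\int_W(v_1\cdots v_ph)\varphi$ (integral against the induced Riemannian volume on $W$; no vector fields if $p=0$), and $\|h\|_{p,q}=\sup_{0\le k\le p}\|h\|^-_{k,q+k}$. $B^{p,q}$ is the completion of $\mathcal{C}^r(X,\mathbb{R})$ under $\|\cdot\|_{p,q}$; $B^{p,q}_{\mathbb{C}}$ is its complexification with norm $\|h_r+ih_i\|_{p,q}=\max\{\|h_r\|_{p,q},\|h_i\|_{p,q}\}$. $\mathcal{L}$ extends to a bounded operator on it. Kernels and operators. (S1) $q_\epsilon\ge0$ and $\int q_\epsilon\,d\mathrm{Leb}=1$. (S2) $\operatorname{supp}q_\epsilon\subseteq B_\epsilon(0)$. $Q_\epsilon f=f*q_\epsilon$ (convolution with respect to $\mathrm{Leb}$), which extends to a bounded operator from $B^{p,q}_{\mathbb{C}}$ to $\mathcal{C}^\infty(\mathbb{T}^d,\mathbb{C})$. $\mathcal{L}_0=\mathcal{L}$, $\mathcal{L}_\epsilon=Q_\epsilon\mathcal{L}$ for $\epsilon\in(0,\epsilon_1)$. $(\Pi_nf)(x)=\sum_{k\in\mathbb{Z}^d,\|k\|_\infty\le n}\hat f(k)e^{2\pi ix\cdot k}$, $\hat f(k)=\int f(x)e^{-2\pi ix\cdot k}d\mathrm{Leb}(x)$.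 $\mathcal{L}_{\epsilon,n}=\Pi_n\mathcal{L}_\epsilon$ for $\epsilon\in(0,\epsilon_1)$ and finite $n$, and $\mathcal{L}_{\epsilon,\infty}=\mathcal{L}_\epsilon$. (KL) for a family $\{A_\epsilon\}_{\epsilon\in I}\subseteq L(E)$, $0\in I\subseteq[0,\infty)$, $(E,\|\cdot\|)$ Banach with second norm $|\cdot|$, $|||A|||=\sup_{\|f\|=1}|Af|$: (KL1) there is a monotone upper-semicontinuous $\tau:[0,\infty)\to[0,\infty)$ with $\tau(\epsilon)>0$ for $\epsilon>0$, $|||A_\epsilon-A_0|||\le\tau(\epsilon)$ and $\tau(\epsilon)\to0$ as $\epsilon\to0$; (KL2) there are $C_1,K_1>0$ with $|A_\epsilon^n|\le C_1K_1^n$ for all $\epsilon\in I$, $n\in\mathbb{N}$; (KL3) there are $C_2,C_3,K_2>0$, $\alpha\in(0,1)$ with $\|A_\epsilon^nf\|\le C_2\alpha^n\|f\|+C_3K_2^n|f|$ for all $\epsilon\in I$, $f\in E$, $n\in\mathbb{N}$. *)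

(* Defs.v *)
From HB Require Import structures.
From mathcomp Require Import all_boot all_order all_algebra.
From mathcomp Require Import complex.
From mathcomp Require Import all_classical all_reals all_analysis.

Set Implicit Arguments.
Unset Strict Implicit.
Unset Printing Implicit Defensive.

Import Order.TTheory GRing.Theory Num.Theory.
Import numFieldNormedType.Exports.

Local Open Scope classical_set_scope.
Local Open Scope ring_scope.

(* The torus R^n / Z^n is handled through its universal cover 'rV[R]_n:
   functions, tensors and bundles on the torus are Z^n-periodic, a map of the
   torus is given by a lift, and a subset of the torus contained in a chart is
   given by its image under the lifted chart. *)

Section Calculus.
Context {R : realType}.

(* iterD [:: v1; ...; vk] f x = D^k f(x)(v1, ..., vk) *)
Definition iterD (V W : normedModType R) (vs : seq V) (f : V -> W) : V -> W :=
  foldr (fun v g x => 'D_v g x) f vs.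

(* f is of class C^s on the open set O.  For s = k + a with k a natural number
   and 0 < a < 1 the derivatives of order k are locally a-Hoelder; for s = k
   this is the usual class C^k. *)
Definition Cs_on (V W : normedModType R) (s : R) (O : set V) (f : V -> W) :=
  [/\ forall (vs : seq V) x, O x -> (size vs <= Num.truncn s)%N ->
        {for x, continuous (iterD vs f)},
      forall (vs : seq V) v x, O x -> (size vs < Num.truncn s)%N ->
        derivable (iterD vs f) x v
    & (Num.truncn s)%:R < s ->
      forall (vs : seq V) x, O x -> size vs = Num.truncn s ->
        exists H : R, \forall y \near x & z \near x,
          `|iterD vs f y - iterD vs f z|
             <= H * `|y - z| `^ (s - (Num.truncn s)%:R)].

Definition Cinf_on (V W : normedModType R) (O : set V) (f : V -> W) :=
  forall k : nat, Cs_on k%:R O f.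

(* On U the derivatives of f of orders m, ..., floor s are bounded by K, and
   so is the Hoelder constant of the last one when s is not an integer.  Vectors
   of V based at x are measured with N x, values of f at x with M x. *)
Definition Cs_norm_le_from (V W : normedModType R) (m : nat)
    (N : V -> V -> R) (M : V -> W -> R) (s : R) (U : set V) (f : V -> W)
    (K : R) :=
  (forall (vs : seq V) x, U x -> (m <= size vs <= Num.truncn s)%N ->
     (forall v, v \in vs -> N x v <= 1) -> M x (iterD vs f x) <= K) /\
  ((Num.truncn s)%:R < s ->
   forall (vs : seq V) x y, U x -> U y -> size vs = Num.truncn s ->
     (forall v, v \in vs -> N x v <= 1) ->
     M x (iterD vs f y - iterD vs f x)
       <= K * N x (y - x) `^ (s - (Num.truncn s)%:R)).

Definition enorm n (v : 'rV[R]_n) : R := Num.sqrt (\sum_i v 0 i ^+ 2).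

(* The C^s norm of f on U is at most K.  On the torus this is used in the flat
   coordinates; other choices only change the norms below up to equivalence. *)
Definition Cs_norm_le n m (s : R) (U : set 'rV[R]_n)
    (f : 'rV[R]_n -> 'rV[R]_m) (K : R) :=
  Cs_norm_le_from 0 (fun=> @enorm n) (fun=> @enorm m) s U f K.

Definition Cs_norm_leR n (s : R) (U : set 'rV[R]_n) (f : 'rV[R]_n -> R)
    (K : R) :=
  Cs_norm_le_from 0 (fun=> @enorm n) (fun=> (fun t : R => `|t|)) s U f K.

(* iterated Lebesgue integral over D^n; it is only applied to continuous
   integrands, with D = [0, 1] or with compact support *)
Fixpoint iterint (D : set R) n : ('rV[R]_n -> R) -> R :=
  match n with
  | 0 => fun f => f 0
  | n'.+1 => fun f => \int[lebesgue_measure]_(t in D)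
      iterint D (fun y : 'rV[R]_n' => f (row_mx (t%:M : 'rV[R]_1) y))
  end.

Definition cube n (rho : R) : set 'rV[R]_n :=
  [set x | forall j, `|x 0 j| < rho].

Definition ceball n (x : 'rV[R]_n) (rho : R) : set 'rV[R]_n :=
  [set y | enorm (y - x) <= rho].

End Calculus.

Section Torus.
Context {R : realType} (n : nat).

Definition Zlat : set 'rV[R]_n := [set k | forall j, k 0 j \is a Num.int].

Definition periodic (Y : Type) (f : 'rV[R]_n -> Y) :=
  forall x k, Zlat k -> f (x + k) = f x.

(* F is a lift of a map of the torus *)
Definition torus_lift (F : 'rV[R]_n -> 'rV[R]_n) :=
  forall x k, Zlat k -> Zlat (F (x + k) - F x).

Definition CsX (s : R) (f : 'rV[R]_n -> R) := periodic f /\ Cs_on s setT f.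

Definition CinfX (f : 'rV[R]_n -> R) := periodic f /\ Cinf_on setT f.

Definition intLeb (f : 'rV[R]_n -> R) : R := iterint `[0, 1] f.

Definition convX (f k : 'rV[R]_n -> R) : 'rV[R]_n -> R :=
  fun x => intLeb (fun y => f y * k (x - y)).

Definition expi2pi (t : R) : R[i] := (cos (2 * pi * t) +i* sin (2 * pi * t))%C.

Definition edot (x y : 'rV[R]_n) : R := (x *m y^T) 0 0.

Definition fourier_coef (f : 'rV[R]_n -> R[i]) (k : 'rV[R]_n) : R[i] :=
  (intLeb (fun x => complex.Re (f x * expi2pi (- edot x k))) +i*
   intLeb (fun x => complex.Im (f x * expi2pi (- edot x k))))%C.

(* the frequencies k in Z^n with |k|_oo <= m, enumerated by
   {0, ..., 2m}^n via k = a - (m, ..., m) *)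
Definition freq (m : nat) (a : {ffun 'I_n -> 'I_(2 * m).+1}) : 'rV[R]_n :=
  \row_j ((a j)%:R - m%:R).

Definition fourier_proj (m : nat) (f : 'rV[R]_n -> R[i]) : 'rV[R]_n -> R[i] :=
  fun x => \sum_(a : {ffun 'I_n -> 'I_(2 * m).+1})
    fourier_coef f (freq a) * expi2pi (edot x (freq a)).

(* B_eps(0) is the open ball; q is periodic, so its support
   is the preimage in R^n of the support in the torus *)
Definition kernelS (eps : R) (q : 'rV[R]_n -> R) :=
  [/\ forall x, 0 <= q x,
      intLeb q = 1
    & closure [set x | q x != 0]
        `<=` [set x | exists2 k, Zlat k & enorm (x - k) < eps]].

End Torus.

Section Metric.
Context {R : realType} (n : nat).

Definition gdot (G : 'M[R]_n) (u v : 'rV[R]_n) : R := (u *m G *m v^T) 0 0.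

Definition gnorm (G : 'M[R]_n) (v : 'rV[R]_n) : R := Num.sqrt (gdot G v v).

Definition riemannian_metric (g : 'rV[R]_n -> 'M[R]_n) :=
  [/\ periodic g, Cinf_on setT g, forall x, (g x)^T = g x
    & forall x v, v != 0 -> 0 < gdot (g x) v v].

(* integration against the Riemannian measure *)
Definition intOmega (g : 'rV[R]_n -> 'M[R]_n) (f : 'rV[R]_n -> R) : R :=
  intLeb (fun x => f x * Num.sqrt (\det (g x))).

End Metric.

Section Dynamics.
Context {R : realType} (ds du : nat).

(* a lift of T, its inverse, the adapted metric, the stable and unstable
   bundles and the constants nu_s, nu_u *)
Record dynamics := Dynamics {
  dT : 'rV[R]_(ds + du) -> 'rV[R]_(ds + du);
  dTinv : 'rV[R]_(ds + du) -> 'rV[R]_(ds + du);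
  dg : 'rV[R]_(ds + du) -> 'M[R]_(ds + du);
  dEs : 'rV[R]_(ds + du) -> {vspace 'rV[R]_(ds + du)};
  dEu : 'rV[R]_(ds + du) -> {vspace 'rV[R]_(ds + du)};
  nus : R;
  nuu : R }.

Definition gn (D : dynamics) (x v : 'rV[R]_(ds + du)) : R := gnorm (dg D x) v.

Definition anosov (r : R) (D : dynamics) :=
  [/\ [/\ torus_lift (dT D), torus_lift (dTinv D),
          cancel (dT D) (dTinv D) & cancel (dTinv D) (dT D)],
      Cs_on (r + 1) setT (dT D) /\ Cs_on 1 setT (dTinv D),
      [/\ periodic (dEs D), periodic (dEu D),
          forall x, \dim (dEs D x) = ds, forall x, \dim (dEu D x) = du
        & forall x, (dEs D x + dEu D x = fullv)%VS],
      (forall x v, v \in dEs D x -> 'D_v (dT D) x \in dEs D (dT D x)) /\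
      (forall x v, v \in dEu D x -> 'D_v (dT D) x \in dEu D (dT D x))
    & [/\ riemannian_metric (dg D), 0 < nus D < 1, 1 < nuu D,
          forall x v, v \in dEs D x -> v != 0 ->
            gn D (dT D x) ('D_v (dT D) x) < nus D * gn D x v
        & forall x v, v \in dEu D x -> v != 0 ->
            gn D (dTinv D x) ('D_v (dTinv D) x) < (nuu D)^-1 * gn D x v]].

(* L is the transfer operator of T on C^r functions *)
Definition transfer_operator (r : R) (D : dynamics)
    (L : ('rV[R]_(ds + du) -> R) -> 'rV[R]_(ds + du) -> R) :=
  forall h, CsX r h -> CsX r (L h) /\
    forall u, CsX r u ->
      intOmega (dg D) (fun x => L h x * u x) =
      intOmega (dg D) (fun x => h x * u (dT D x)).

Definition cone (D : dynamics) (kappa : R) (x : 'rV[R]_(ds + du)) :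
    set 'rV[R]_(ds + du) :=
  [set w | exists u v, [/\ w = u + v, u \in dEs D x,
     forall u', u' \in dEs D x -> gdot (dg D x) v u' = 0
   & gn D x v <= kappa * gn D x u]].

(* the cone C_i, for c = c_i *)
Definition std_cone (c : R) : set 'rV[R]_(ds + du) :=
  [set w | enorm (rsubmx w) <= c * enorm (lsubmx w)].

(* the constants and (lifted) charts entering the definition of admissible
   leaves; psiinv i inverts psi i on its image *)
Record leaf_data := LeafData {
  kappa : R;
  nchart : nat;
  psi : 'I_nchart -> 'rV[R]_(ds + du) -> 'rV[R]_(ds + du);
  psiinv : 'I_nchart -> 'rV[R]_(ds + du) -> 'rV[R]_(ds + du);
  rad : 'I_nchart -> R;
  cc : 'I_nchart -> R;
  KK : R;
  AA : R;
  delta : R }.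

Definition cone_condition (D : dynamics) (kap : R) :=
  0 < kap /\
  forall x v, cone D kap x v ->
    (v != 0 -> interior (cone D kap (dTinv D x)) ('D_v (dTinv D) x)) /\
    (nus D)^-1 * gn D x v <= gn D (dTinv D x) ('D_v (dTinv D) x).

(* Derivatives of charts are taken in the flat coordinates of the torus and
   tangent vectors of the torus are measured with the metric.  The order 0 part
   of the C^{r+1} norm of a torus valued map is void. *)
Definition chart_condition (r : R) (D : dynamics) (P : leaf_data)
    (i : 'I_(nchart P)) :=
  let dom : set 'rV[R]_(ds + du) := cube (rad i) in
  let f := psi i in
  let img := f @` dom in
  [/\ [/\ 0 < rad i, Cinf_on dom f, open img, Cinf_on img (psiinv i)
        & forall x, dom x -> psiinv i (f x) = x] /\
      (forall x y, dom x -> dom y -> Zlat (f x - f y) -> x = y),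
      (forall v, gn D (f 0) ('D_v f 0) = enorm v) /\
      (forall w, w \in dEs D (f 0) <->
         exists u : 'rV[R]_ds, w = 'D_(row_mx u 0) f 0),
      Cs_norm_le_from 1 (fun=> @enorm _ _) (fun x => gn D (f x))
        (r + 1) dom f (1 + kappa P) /\
      Cs_norm_le_from 0 (gn D) (fun=> @enorm _ _)
        (r + 1) img (psiinv i) (1 + kappa P),
      kappa P < cc i < 2 * kappa P
    & forall x, dom x ->
        cone D (kappa P) (f x)
          `<=` [set 'D_v f x | v in std_cone (cc i)] /\
        [set 'D_('D_v f x) (dTinv D) (f x) | v in std_cone (cc i)]
          `<=` cone D (kappa P) (dTinv D (f x))].

(* The graph of chi over U belongs to G_i(K).  The bound |D chi| <= c_i comes
   with its integrated form, which it implies when U is convex, in particular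
   for leaves; on a disconnected U the pointwise bound alone would not even
   ensure that the preimages considered below are graphs. *)
Definition graph_bound (r : R) (P : leaf_data) (i : 'I_(nchart P)) (K : R)
    (U : set 'rV[R]_ds) (chi : 'rV[R]_ds -> 'rV[R]_du) :=
  [/\ U `<=` cube (rad i),
      forall y, U y -> cube (rad i) (chi y),
      exists O, [/\ open O, U `<=` O & Cs_on (r + 1) O chi],
      Cs_norm_le (r + 1) U chi K
    & (forall y v, U y -> enorm ('D_v chi y) <= cc i * enorm v) /\
      (forall y z, U y -> U z -> enorm (chi y - chi z) <= cc i * enorm (y - z))].

Definition graph_set (r : R) (P : leaf_data) (i : 'I_(nchart P)) (K : R) :
    set (set 'rV[R]_(ds + du)) :=
  [set W | exists U chi, graph_bound r i K U chi /\
     W = [set row_mx y (chi y) | y in U]].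

Definition leaf_setting (r : R) (D : dynamics) (P : leaf_data) :=
  [/\ cone_condition D (kappa P),
      forall i : 'I_(nchart P), chart_condition r D i,
      forall x, exists (i : 'I_(nchart P)) y,
        cube (rad i / 2) y /\ Zlat (psi i y - x),
      exists2 K', K' < KK P &
        forall (i j : 'I_(nchart P)) W, graph_set r i (KK P) W ->
          graph_set r j K'
            [set y | cube (rad j) y /\
               exists2 w, W w & Zlat (psi j y - dTinv D (psi i w))]
    & [/\ 1 < AA P,
          nus D * (1 + kappa P) ^+ 2 * Num.sqrt (1 + 4 * kappa P ^+ 2)
            < (AA P - 1) / AA P,
          0 < delta P
        & forall i : 'I_(nchart P), AA P * delta P < rad i / 6]].

(* An admissible leaf is given by its chart i, its centre x and chi; the leaf
   itself is the image of the closed ball of radius delta under leaf_param. *)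
Definition admissible (r : R) (P : leaf_data) (i : 'I_(nchart P))
    (x : 'rV[R]_ds) (chi : 'rV[R]_ds -> 'rV[R]_du) :=
  let U := ceball x (AA P * delta P) in
  [/\ U `<=` cube (2 * rad i / 3),
      forall y, U y -> cube (2 * rad i / 3) (chi y)
    & graph_bound r i (KK P) U chi].

Definition leaf_param (P : leaf_data) (i : 'I_(nchart P))
    (chi : 'rV[R]_ds -> 'rV[R]_du) (y : 'rV[R]_ds) : 'rV[R]_(ds + du) :=
  psi i (row_mx y (chi y)).

Definition leaf (P : leaf_data) (i : 'I_(nchart P)) (x : 'rV[R]_ds)
    (chi : 'rV[R]_ds -> 'rV[R]_du) : set 'rV[R]_(ds + du) :=
  leaf_param i chi @` ceball x (delta P).

(* density of the induced Riemannian volume in the coordinate y *)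
Definition leaf_density (D : dynamics) (P : leaf_data) (i : 'I_(nchart P))
    (chi : 'rV[R]_ds -> 'rV[R]_du) (y : 'rV[R]_ds) : R :=
  let f := leaf_param i chi in
  Num.sqrt (\det (\matrix_(a, b) gdot (dg D (f y))
    ('D_(delta_mx 0 a) f y) ('D_(delta_mx 0 b) f y))).

(* phi is a function on the leaf written in the coordinate y; functions
   vanishing near the boundary are extended by 0 to the whole space *)
Definition leaf_int (D : dynamics) (P : leaf_data) (i : 'I_(nchart P))
    (chi : 'rV[R]_ds -> 'rV[R]_du)
    (F : 'rV[R]_(ds + du) -> R) (phi : 'rV[R]_ds -> R) : R :=
  iterint setT
    (fun y => F (leaf_param i chi y) * phi y * leaf_density D i chi y).

Definition test_function (q : R) (P : leaf_data) (x : 'rV[R]_ds)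
    (phi : 'rV[R]_ds -> R) :=
  [/\ Cs_on q setT phi, Cs_norm_leR q setT phi 1
    & exists2 eta, eta < delta P & forall y, eta <= enorm (y - x) -> phi y = 0].

Definition unit_field (r : R) (W : set 'rV[R]_(ds + du))
    (v : 'rV[R]_(ds + du) -> 'rV[R]_(ds + du)) :=
  exists O, [/\ open O, W `<=` O, Cs_on r O v & Cs_norm_le r O v 1].

Definition fields_apply k
    (v : 'I_k -> 'rV[R]_(ds + du) -> 'rV[R]_(ds + du))
    (h : 'rV[R]_(ds + du) -> R) : 'rV[R]_(ds + du) -> R :=
  foldr (fun w f x => 'D_(w x) f x) h [seq v a | a <- enum 'I_k].

(* the set is bounded when h is of class C^r and k <= r *)
Definition norm_minus (r : R) (D : dynamics) (P : leaf_data) (k : nat) (q : R)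
    (h : 'rV[R]_(ds + du) -> R) : R :=
  sup [set t | exists (i : 'I_(nchart P)) x chi
      (v : 'I_k -> 'rV[R]_(ds + du) -> 'rV[R]_(ds + du)) phi,
    [/\ admissible r i x chi,
        forall a, unit_field r (leaf i x chi) (v a),
        test_function q P x phi
      & t = leaf_int D i chi (fields_apply v h) phi]].

Definition pqnorm (r : R) (D : dynamics) (P : leaf_data) (p : nat) (q : R)
    (h : 'rV[R]_(ds + du) -> R) : R :=
  \big[Num.max/0]_(k < p.+1) norm_minus r D P k (q + k%:R) h.

End Dynamics.

Section Extensions.
Context {R : realType} (n : nat) (r : R).

(* (B, iota) is the completion of C^r(X, R) for the norm nrm; iota is only
   meaningful on C^r functions *)
Definition is_completion (nrm : ('rV[R]_n -> R) -> R)
    (B : completeNormedModType R) (iota : ('rV[R]_n -> R) -> B) :=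
  [/\ forall (a : R) f g, CsX r f -> CsX r g ->
        iota (fun x => a * f x + g x) = a *: iota f + iota g,
      forall h, CsX r h -> `|iota h| = nrm h
    & closure (iota @` [set h | CsX r h]) = setT].

(* A is the bounded extension to the completions of the operator A0 *)
Definition bounded_extension (B B' : completeNormedModType R)
    (iota : ('rV[R]_n -> R) -> B) (iota' : ('rV[R]_n -> R) -> B')
    (A0 : ('rV[R]_n -> R) -> 'rV[R]_n -> R) (A : {linear B -> B'}) :=
  continuous A /\ forall h, CsX r h -> A (iota h) = iota' (A0 h).

(* Q is the bounded extension of convolution with q, as an operator from B to
   C^oo(X, R) *)
Definition smoothing_extension (B : completeNormedModType R)
    (iota : ('rV[R]_n -> R) -> B) (q : 'rV[R]_n -> R)
    (Q : B -> 'rV[R]_n -> R) :=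
  [/\ forall b, CinfX (Q b),
      forall (a : R) b c x, Q (a *: b + c) x = a * Q b x + Q c x,
      forall k : nat, exists C : R, forall b,
        Cs_norm_leR k%:R setT (Q b) (C * `|b|)
    & forall h, CsX r h -> Q (iota h) = convX h q].

End Extensions.

(* complexification: (b, c) stands for b + i c *)
Definition cplx {R : realType} (B : lmodType R) : Type := (B * B)%type.

Section Complexification.
Context {R : realType} (B : lmodType R).

HB.instance Definition _ := GRing.Zmodule.copy (cplx B) (B * B)%type.

Definition cplx_scale (z : R[i]) (b : cplx B) : cplx B :=
  (complex.Re z *: b.1 - complex.Im z *: b.2,
   complex.Re z *: b.2 + complex.Im z *: b.1).

Fact cplx_scaleA z w b :
  cplx_scale z (cplx_scale w b) = cplx_scale (z * w) b.
Proof.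
case: z w b => [a b] [c d] [x y]; rewrite /cplx_scale /=.
congr (_, _); rewrite !scalerDr ?scalerN !scalerDl ?scaleNr !scalerA.
  by rewrite !opprD [X in _ + X = _]addrC addrACA.
by rewrite [X in _ + X = _]addrC addrACA.
Qed.

Fact cplx_scale1 : left_id 1 cplx_scale.
Proof. by case=> x y; rewrite /cplx_scale /= !scale1r !scale0r subr0 addr0. Qed.

Fact cplx_scaleDr : right_distributive cplx_scale +%R.
Proof.
move=> [a b] [x y] [x' y']; rewrite /cplx_scale /=.
by congr (_, _); rewrite /= !scalerDr ?opprD addrACA.
Qed.

Fact cplx_scaleDl b : {morph cplx_scale^~ b : z w / z + w}.
Proof.
case: b => [x y] [a b] [c d]; rewrite /cplx_scale /=.
by congr (_, _); rewrite /= !scalerDl ?opprD addrACA.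
Qed.

HB.instance Definition _ := GRing.Zmodule_isLmodule.Build R[i] (cplx B)
  cplx_scaleA cplx_scale1 cplx_scaleDr cplx_scaleDl.

End Complexification.

Section ComplexOperators.
Context {R : realType} (n : nat) (B : completeNormedModType R)
  (iota : ('rV[R]_n -> R) -> B).

Definition cplx_norm (N : B -> R) (b : cplx B) : R := Num.max (N b.1) (N b.2).

Definition iotaC (f : 'rV[R]_n -> R[i]) : cplx B :=
  (iota (fun x => complex.Re (f x)), iota (fun x => complex.Im (f x))).

Definition opC (A : B -> B) (b : cplx B) : cplx B := (A b.1, A b.2).

Definition smoothC (Q : B -> 'rV[R]_n -> R) (b : cplx B) : 'rV[R]_n -> R[i] :=
  fun x => (Q b.1 x +i* Q b.2 x)%C.

(* L_eps, with L_0 = L *)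
Definition Leps (L : B -> B) (Q : R -> B -> 'rV[R]_n -> R) (eps : R) :
    cplx B -> cplx B :=
  fun b => if eps == 0 then opC L b else iotaC (smoothC (Q eps) (opC L b)).

(* L_{eps, m}, where None is the index oo; only used with m = None if eps = 0 *)
Definition Lepsn (L : B -> B) (Q : R -> B -> 'rV[R]_n -> R) (eps : R)
    (m : option nat) : cplx B -> cplx B :=
  match m with
  | None => Leps L Q eps
  | Some k => fun b => iotaC (fourier_proj k (smoothC (Q eps) (opC L b)))
  end.

End ComplexOperators.

(* the order of N u {oo}, with None for oo *)
Definition le_oo (a b : option nat) : bool :=
  match a, b with
  | _, None => true
  | None, Some _ => false
  | Some k, Some l => (k <= l)%N
  end.

Section KellerLiverani.
Context {R : realType} (E : lmodType R[i]).

(* E carries the norm N, for which it is complete, and the second norm w.  The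
   norm N is only required to be homogeneous over R, as is the case for the
   maximum norm on a complexification. *)
Definition KL1 (N w : E -> R) (I : set R) (A : R -> E -> E) :=
  exists tau : R -> R,
    [/\ forall x, 0 <= x -> 0 <= tau x,
        (forall x y, 0 <= x -> x <= y -> tau x <= tau y) /\
        (forall x a, 0 <= x -> tau x < a ->
           \forall y \near x, 0 <= y -> tau y < a),
        forall x, 0 < x -> 0 < tau x,
        forall eps, I eps -> forall f, N f = 1 ->
          w (A eps f - A 0 f) <= tau eps
      & tau x @[x --> 0^'+] --> (0 : R)].

Definition KL2 (w : E -> R) (I : set R) (A : R -> E -> E) :=
  exists C1 K1 : R, [/\ 0 < C1, 0 < K1 &
    forall eps m f, I eps -> w (iter m (A eps) f) <= C1 * K1 ^+ m * w f].

Definition KL3 (N w : E -> R) (I : set R) (A : R -> E -> E) :=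
  exists C2 C3 K2 alpha : R,
    [/\ 0 < C2, 0 < C3, 0 < K2, 0 < alpha < 1 &
      forall eps m f, I eps ->
        N (iter m (A eps) f) <= C2 * alpha ^+ m * N f + C3 * K2 ^+ m * w f].

Definition bounded_operator (N : E -> R) (A : E -> E) :=
  (forall (z : R[i]) f g, A (z *: f + g) = z *: A f + A g) /\
  exists C : R, forall f, N (A f) <= C * N f.

Definition KL (N w : E -> R) (I : set R) (A : R -> E -> E) :=
  [/\ forall eps, I eps -> bounded_operator N (A eps),
      KL1 N w I A, KL2 w I A & KL3 N w I A].

End KellerLiverani.

(* Main.v *)
Require Import Defs.
From HB Require Import structures.
From mathcomp Require Import all_boot all_order all_algebra.
From mathcomp Require Import perm complex.
From mathcomp Require Import ring lra.
From mathcomp Require Import all_classical all_reals all_analysis.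
From mathcomp Require Import measurable_realfun.

Set Implicit Arguments.
Unset Strict Implicit.
Unset Printing Implicit Defensive.

Import Order.TTheory GRing.Theory Num.Theory.
Import numFieldNormedType.Exports.

(** Convolution with [q_eps] sends the weak completion [B'] continuously into
    every [C^k], and Fourier sums of smooth functions converge in every [C^k].
    Hence the error committed by truncating the Fourier series of [Q_eps (L b)]
    is small in the strong norm, by comparison with the weak norm of [b]:
    [| iota (dproj n (Q_eps (L b))) - iota (Q_eps (L b)) | <= eps * | j b |] for
    [n] at least some [N eps].  Perturbations which are that small from the weak
    to the strong norm preserve the Keller-Liverani conditions
    ([KL_perturb]): the contribution of the perturbation to an iterate is
    controlled by the weak norm, and so it only changes the weak term of the
    Lasota-Yorke inequality.

    The truncation error is estimated in three steps.  First, the strong norm of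
    a smooth function is at most a constant times the supremum of its partial
    derivatives of order at most [p] ([pqnorm_bound]): the charts, the slopes of
    the leaves, the vector fields and the test functions are all uniformly
    bounded.  Secondly, the Fourier projection of a real function [f] is the
    convolution [dproj n f] with a product of Dirichlet kernels
    ([fourier_projE]); integration by parts makes it commute with derivatives
    ([iterD_dproj]), so only the uniform norm of [g - dproj n g] matters, for [g]
    a derivative of [f].  Thirdly, this norm is at most a constant times a bound
    on finitely many derivatives of [g], divided by [n + 1] ([dproj_err_rate]).
    In dimension one the coefficients of a smooth function decay at any
    polynomial rate ([coef_le]), so its Fourier sums converge at any polynomial
    rate ([ferr_cauchy]); that they converge to the function follows from
    Fejer's theorem on their averages ([sum_ferr_le], [ferr_le]).  The
    coordinates are then treated one after the other ([dproj_err]).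

    Finally [Q_eps b] depends only on the image of [b] in [B'] because this
    holds for smooth functions, which are dense ([smoothing_factor]); this is
    what turns a bound by the norm of [B'] into a bound by the weak norm. *)

Local Open Scope classical_set_scope.
Local Open Scope ring_scope.

Local Notation iterD := Defs.iterD.
Local Notation periodic := Defs.periodic.
Local Notation rad := Defs.rad.
Local Notation gnorm := Defs.gnorm.

(** * Calculus in several variables *)

Section Calculus.
Context {R : realType}.

Lemma is_derive_path (V W : normedModType R) (f : V -> W) (x v : V) (t : R) df :
  is_derive (x + t *: v) v f df ->
  is_derive t 1 (fun s : R => f (x + s *: v)) df.
Proof.
move=> [dv <-].
have E : (fun h : R => h^-1 *: (f (h *: v + (x + t *: v)) - f (x + t *: v))) =
   (fun h : R => h^-1 *: ((fun s : R => f (x + s *: v)) (h *: 1 + t) -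
      (fun s : R => f (x + s *: v)) t)).
  apply/funext => h /=; congr (_ *: (f _ - _)).
  by rewrite [h *: 1]mulr1 scalerDl addrA [h *: v + x]addrC -addrA.
apply: DeriveDef; first by rewrite /derivable -E.
by rewrite /derive -E.
Qed.

Lemma MVT_le (f df : R -> R) (a b K : R) :
  (forall t, a <= t <= b -> is_derive t 1 f (df t)) ->
  (forall t, a <= t <= b -> `|df t| <= K) -> a <= b ->
  `|f b - f a| <= K * (b - a).
Proof.
move=> fd fK ab.
have fd' t : t \in `]a, b[%R -> is_derive t 1 f (df t).
  by move=> /itvP tab; apply: fd; rewrite !tab.
have fc : {within `[a, b], continuous f}.
  apply: derivable_within_continuous => t /itvP tab.
  by have [] : is_derive t 1 f (df t) by apply: fd; rewrite !tab.
have [c /itvP cab ->] := MVT_segment ab fd' fc.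
rewrite normrM [`|b - a|]ger0_norm ?subr_ge0//.
by rewrite ler_wpM2r ?subr_ge0 ?fK ?cab.
Qed.

Lemma MVT_path (V : normedModType R) (f : V -> R) (x v : V) (K : R) :
  (forall t : R, 0 <= t <= 1 -> derivable f (x + t *: v) v /\
     `|'D_v f (x + t *: v)| <= K) ->
  `|f (x + v) - f x| <= K.
Proof.
move=> fK.
have := @MVT_le (fun t => f (x + t *: v)) (fun t => 'D_v f (x + t *: v)) 0 1 K.
rewrite scale0r scale1r addr0 subr0 mulr1; apply => //.
- by move=> t /fK[d _]; apply: is_derive_path; exact: derivableP.
- by move=> t /fK[].
Qed.

Lemma derive_scale (V W : normedModType R) (f : V -> W) (x v : V) (c : R) :
  derivable f x v -> is_derive x (c *: v) f (c *: 'D_v f x).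
Proof.
move=> /derivableP fv.
have [->|c0] := eqVneq c 0.
  by rewrite !scale0r; exact: is_derive0.
have : is_derive (x + (0 : R) *: v) v f ('D_v f x) by rewrite scale0r addr0.
move/is_derive_path => H.
have H2 : is_derive (0 : R) c (fun s : R => f (x + s *: v)) (c *: 'D_v f x).
  have [/derivable1_diffP d e] := H.
  apply: DeriveDef; first exact: diff_derivable.
  by rewrite deriveE // -e deriveE// -linearZ /= [c *: 1]mulr1.
have [d e] := H2.
have E : (fun h : R => h^-1 *: (f (h *: (c *: v) + x) - f x)) =
  (fun h : R => h^-1 *: ((fun s : R => f (x + s *: v)) (h *: c + 0) -
      (fun s : R => f (x + s *: v)) 0)).
  apply/funext => h /=; congr (_ *: (f _ - f _)).
    by rewrite addr0 scalerA addrC.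
  by rewrite scale0r addr0.
apply: DeriveDef; first by rewrite /derivable E.
by rewrite /derive E.
Qed.

Section Coordinates.
Context {n : nat}.
Implicit Types (f : 'rV[R]_n -> R) (x y z : 'rV[R]_n).

Definition vec (i : 'I_n) : 'rV[R]_n := delta_mx 0 i.

Lemma vecE i k : vec i 0 k = (k == i)%:R.
Proof. by rewrite mxE eqxx. Qed.

Lemma norm_coord x i : `|x 0 i| <= `|x|.
Proof.
rewrite [leRHS]/Num.Def.normr/= mx_normrE.
exact: (le_bigmax _ (fun ij => `|x ij.1 ij.2|) (0, i)).
Qed.

Lemma norm_coord_le x K : 0 <= K -> (forall i, `|x 0 i| <= K) -> `|x| <= K.
Proof.
move=> K0 xK; rewrite [leLHS]/Num.Def.normr/= mx_normrE bigmax_le// => -[i j] _.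
by rewrite (ord1 i).
Qed.

(** Points of a box are joined by a path following the coordinate directions,
    which stays in the box; this is why bounds on the partial derivatives are
    enough. *)
Lemma coord_MVT f (c : 'rV[R]_n) (rho K : R) : 0 <= K ->
  (forall x i, `|x - c| < rho -> derivable f x (vec i) /\ `|'D_(vec i) f x| <= K) ->
  forall y z, `|y - c| < rho -> `|z - c| < rho ->
  `|f y - f z| <= n%:R * K * `|y - z|.
Proof.
move=> K0 fK y z yc zc.
(* [w k] has the first [k] coordinates of [y] and the other ones of [z] *)
pose w (k : nat) : 'rV[R]_n := \row_i (if (i < k)%N then y 0 i else z 0 i).
have step (k : 'I_n) : `|f (w k.+1) - f (w k)| <= K * `|y - z|.
  have -> : w k.+1 = w k + (y 0 k - z 0 k) *: vec k.
    apply/rowP => i; rewrite !mxE /= ltnS leq_eqVlt.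
    have [->|ik] := eqVneq i k; first by rewrite eqxx ltnn mulr1 addrC subrK.
    by rewrite (_ : (i == k :> nat) = false) ?mulr0 ?addr0//; exact: negbTE.
  apply: MVT_path => t /andP[t0 t1].
  set x := _ + _.
  have xc : `|x - c| < rho.
    have rho0 : 0 < rho by exact: le_lt_trans yc.
    rewrite [ltLHS]/Num.Def.normr/= mx_normrE; apply: bigmax_lt => //= -[i0 i] _.
    rewrite (ord1 i0) /x !mxE /=.
    have yi : `|y 0 i - c 0 i| < rho.
      by have := norm_coord (y - c) i; rewrite !mxE => /le_lt_trans; apply.
    have zi : `|z 0 i - c 0 i| < rho.
      by have := norm_coord (z - c) i; rewrite !mxE => /le_lt_trans; apply.
    have [ik|ik] := eqVneq i k; last by rewrite !mulr0 addr0; case: ifP.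
    rewrite {}ik in yi zi *; rewrite ltnn mulr1.
    have -> : z 0 k + t * (y 0 k - z 0 k) - c 0 k =
       t * (y 0 k - c 0 k) + (1 - t) * (z 0 k - c 0 k) by ring.
    apply: (@le_lt_trans _ _ (Num.max `|y 0 k - c 0 k| `|z 0 k - c 0 k|)).
      rewrite (le_trans (ler_normD _ _))// !normrM (ger0_norm t0).
      rewrite [`|1 - t|]ger0_norm ?subr_ge0//.
      set m := Num.max _ _.
      have ym : `|y 0 k - c 0 k| <= m by rewrite le_max lexx.
      have zm : `|z 0 k - c 0 k| <= m by rewrite le_max lexx orbT.
      nra.
    by rewrite gt_max yi zi.
  have [d dK] := fK x k xc.
  have [d' e'] := derive_scale (y 0 k - z 0 k) d.
  split=> //; rewrite e' [`|_ *: _|]normrM mulrC ler_pM//.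
  by have := norm_coord (y - z) k; rewrite !mxE.
have -> : f y - f z = \sum_(k < n) (f (w k.+1) - f (w k)).
  rewrite -(big_mkord xpredT (fun k => f (w k.+1) - f (w k))) telescope_sumr//.
  congr (f _ - f _); apply/rowP => i; rewrite !mxE; first by rewrite ltn_ord.
  by rewrite ltn0.
apply: (le_trans (ler_norm_sum _ _ _)).
apply: (@le_trans _ _ (\sum_(k < n) K * `|y - z|)); first exact: ler_sum.
by rewrite sumr_const card_ord -[leLHS]mulr_natl mulrA.
Qed.

(** Once the candidate for the differential is subtracted, the partial
    derivatives are small near [x], so that [coord_MVT] bounds the remainder by
    a small multiple of the distance to [x]. *)
Lemma C1_differentiable f x :
  (\forall y \near x, forall i, derivable f y (vec i)) ->
  (forall i, {for x, continuous ('D_(vec i) f)}) ->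
  differentiable f x /\
  forall v, 'D_v f x = \sum_i v 0 i * 'D_(vec i) f x.
Proof.
move=> fd fc.
pose l (v : 'rV[R]_n) := \sum_i v 0 i * 'D_(vec i) f x.
have ll : linear l.
  move=> a u v; rewrite /l scaler_sumr -big_split/=.
  by apply: eq_bigr => i _; rewrite !mxE mulrDl -mulrA.
pose Ll := HB.pack_for {linear 'rV[R]_n -> R} l
  (GRing.isLinear.Build R 'rV[R]_n R *:%R l ll).
have lvec i : l (vec i) = 'D_(vec i) f x.
  rewrite /l (bigD1 i)//= vecE eqxx mul1r big1 ?addr0// => k ki.
  by rewrite vecE (negbTE ki) mul0r.
have lb v : `|l v| <= (\sum_i `|'D_(vec i) f x|) * `|v|.
  rewrite (le_trans (ler_norm_sum _ _ _))// mulr_suml ler_sum// => i _.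
  by rewrite normrM mulrC ler_wpM2l// norm_coord.
have lc : continuous l.
  apply: (@linear_bounded_continuous R _ _ Ll).1.
  apply/linear_boundedP; exists (\sum_i `|'D_(vec i) f x|).
  split=> [|M KM v]; first exact: num_real.
  by apply: (le_trans (lb v)); apply: ler_wpM2r => //; exact: ltW.
have small e : 0 < e -> \forall y \near x, `|f y - f x - l (y - x)| <= e * `|y - x|.
  move=> e0.
  pose g y := f y - l y.
  pose e1 := e / n.+1%:R.
  have e10 : 0 < e1 by rewrite divr_gt0.
  have gsmall : \forall y \near x, forall i, derivable g y (vec i) /\
     `|'D_(vec i) g y| <= e1.
    have H : \forall y \near x, forall i, `|'D_(vec i) f x - 'D_(vec i) f y| <= e1.
      apply: (@filter_forall _ _ _ (nbhs x)) => i.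
      by have /cvgrPdist_le/(_ e1 e10) := fc i.
    near=> y => i.
    have ld : is_derive y (vec i) l (l (vec i)).
      apply: DeriveDef; first by apply: diff_derivable; exact: (@linear_differentiable _ _ _ Ll).
      rewrite deriveE; last exact: (@linear_differentiable _ _ _ Ll).
      by rewrite (@diff_lin _ _ _ Ll).
    have fdi : derivable f y (vec i) by move: i {ld}; near: y.
    split; first by apply: derivableB.
    have -> : g = f - l by [].
    rewrite deriveB // derive_val lvec distrC.
    by move: i {ld fdi}; near: y.
  have /nbhs_ballP[rho /= rho0 Hr] := gsmall.
  near=> y.
  have := @coord_MVT g x rho e1 (ltW e10).
  have H : forall x0 i, `|x0 - x| < rho -> derivable g x0 (vec i) /\ `|'D_(vec i) g x0| <= e1.
    move=> z i zx; apply: Hr.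
    by rewrite -ball_normE /= distrC.
  have yx : `|y - x| < rho.
    have : ball x rho y by near: y; exact: nbhsx_ballx.
    by rewrite -ball_normE /= distrC.
  have xx : `|x - x| < rho by rewrite subrr normr0.
  move=> /(_ H y x yx xx).
  have -> : g y - g x = f y - f x - l (y - x).
    have -> : l (y - x) = l y - l x by exact: (@linearB _ _ _ _ Ll).
    by rewrite /g; ring.
  move=> /le_trans; apply; apply: ler_wpM2r => //.
  rewrite /e1 mulrCA ger_pMr//.
  by rewrite ler_pdivrMr// mul1r ler_nat.
have fdiff : differentiable f x /\ 'd f x = Ll :> ('rV[R]_n -> R).
  have E : f \o shift x = cst (f x) + Ll +o_ (0 : 'rV[R]_n) id.
    apply/eqaddoP => e e0.
    have := small e e0; rewrite (near_shift 0) => H.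
    near=> h.
    have : ((fun y => `|f y - f x - l (y - x)| <= e * `|y - x|) \o shift (x - 0)) h by near: h.
    rewrite /= subr0 addrK; congr (`|_| <= _).
    by rewrite !fctE opprD addrA.
  have ED : 'd f x = Ll :> ('rV[R]_n -> R) by exact: diff_unique.
  split=> //; apply/diff_locallyP; rewrite ED; split=> //.
split; first by case: fdiff.
by move=> v; rewrite deriveE ?(fdiff.2)//; case: fdiff.
Unshelve. all: by end_near. Qed.

End Coordinates.
End Calculus.

(** * Iterated integrals *)

Section Integration.
Context {R : realType}.
Notation mu := (@lebesgue_measure R).
Import HBNNSimple.

(** No measurability is assumed: the positive and the negative part of [g] are
    dominated by the same multiple of an indicator, and the integral of a
    nonnegative function is a supremum, hence monotone. *)
Lemma Rintegral_bound (D A : set R) (g : R -> R) (M a : R) :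
  measurable A -> mu A = a%:E -> 0 <= M ->
  (forall t, D t -> `|g t| <= M * \1_A t) ->
  `|\int[mu]_(t in D) g t| <= M * a.
Proof.
move=> mA muA M0 gM.
have a0 : 0 <= a by rewrite -lee_fin -muA.
have sub (h : R -> \bar R) : (forall t, 0 <= h t)%E ->
    (forall t, D t -> h t <= (M * \1_A t)%:E)%E ->
    (0 <= \int[mu]_(t in D) h t <= (M * a)%:E)%E.
  move=> h0 hM; apply/andP; split; first by apply: integral_ge0.
  rewrite integral_mkcond ge0_integralTE; last first.
    by move=> t; rewrite patchE; case: ifP.
  apply: ge_ereal_sup => _ [s /= hs <-].
  have -> : ((M * a)%:E = \int[mu]_t (M * \1_A t)%:E)%E.
    under eq_integral do rewrite EFinM.
    rewrite ge0_integralZl//; last by apply/measurable_EFinP; exact: measurable_indic.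
    by rewrite integral_indic// setIT EFinM -muA.
  rewrite -integralT_nnsfun; apply: ge0_le_integral => //.
  - by move=> t _; rewrite lee_fin.
  - by apply/measurable_EFinP.
  - by apply/measurable_EFinP; apply: measurable_funM => //; exact: measurable_indic.
  - move=> t _; apply: (le_trans (hs t)); rewrite patchE; case: ifPn => [|_].
      by rewrite inE; exact: hM.
    by rewrite lee_fin mulr_ge0.
have pb t : D t -> ((EFin \o g)^\+ t <= (M * \1_A t)%:E)%E.
  move=> Dt; rewrite funeposE /= -EFin_max lee_fin ge_max mulr_ge0// andbT.
  by apply: le_trans (gM t Dt); exact: ler_norm.
have nb t : D t -> ((EFin \o g)^\- t <= (M * \1_A t)%:E)%E.
  move=> Dt; rewrite funenegE /= -EFin_max lee_fin ge_max mulr_ge0// andbT.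
  by apply: le_trans (gM t Dt); rewrite lerNl lerNnormlW.
have /andP[p0 pM] := sub _ (funepos_ge0 _) pb.
have /andP[n0 nM] := sub _ (funeneg_ge0 _) nb.
rewrite /Rintegral integralE.
move: p0 pM n0 nM.
case: (integral _ _ _) => [p||]//; case: (integral _ _ _) => [m||]// p0 pM m0 mM.
rewrite -EFinB /= ler_norml; rewrite !lee_fin in p0 pM m0 mM.
by apply/andP; split; lra.
Qed.

Lemma lebesgue_itvcc (a b : R) : a <= b -> mu `[a, b] = (b - a)%:E.
Proof.
move=> ab; rewrite lebesgue_measure_itv /= lte_fin; case: ifPn => //.
rewrite -leNgt => ba; have -> : a = b by apply/eqP; rewrite eq_le ab ba.
by rewrite subrr.
Qed.

Lemma iterint_bound (D A : set R) n (f : 'rV[R]_n -> R) (M a : R) :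
  measurable A -> mu A = a%:E -> 0 <= M ->
  (forall x : 'rV[R]_n, (forall j, D (x 0 j)) -> `|f x| <= M * \prod_j \1_A (x 0 j)) ->
  `|iterint D f| <= M * a ^+ n.
Proof.
move=> mA muA; have a0 : 0 <= a by rewrite -lee_fin -muA.
elim: n f M => [|n IH] f M M0 fM /=.
  rewrite expr0 mulr1; apply: le_trans (fM 0 _) _; first by case.
  by rewrite big_ord0 mulr1.
rewrite exprSr mulrA; apply: (Rintegral_bound mA muA) => [|t Dt].
  by rewrite mulr_ge0 ?exprn_ge0.
rewrite mulrAC; apply: IH; first by rewrite mulr_ge0.
move=> y Dy.
have xE0 : (row_mx t%:M y : 'rV[R]_(1 + n)) 0 (lshift n ord0) = t.
  by rewrite row_mxEl mxE.
have xE1 j : (row_mx t%:M y : 'rV[R]_(1 + n)) 0 (rshift 1 j) = y 0 j.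
  by rewrite row_mxEr.
have := fM (row_mx t%:M y).
rewrite (_ : \prod_j _ = \1_A t * \prod_j \1_A (y 0 j)).
  rewrite mulrA; apply=> j; case: (@split_ordP 1 n j) => k ->.
    by rewrite (ord1 k) xE0.
  by rewrite xE1.
rewrite big_ord_recl; congr (_ * _).
  by rewrite -[in RHS]xE0; congr (\1_A (fun_of_matrix _ 0 _)); exact: val_inj.
apply: eq_bigr => k _; rewrite -[in RHS]xE1.
by congr (\1_A (fun_of_matrix _ 0 _)); exact: val_inj.
Qed.

(** This class is stable under products, restriction to a slice and integration
    in some of the coordinates, so that every iterated integral of its members
    is an integral of continuous functions. *)
Definition lipb (V : normedModType R) (f : V -> R) :=
  exists2 C : R, 0 <= C &
   (forall x, `|f x| <= C) /\ (forall x y, `|f x - f y| <= C * `|x - y|).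

Definition slice n (f : 'rV[R]_n.+1 -> R) (t : R) : 'rV[R]_n -> R :=
  fun y => f (row_mx (t%:M : 'rV[R]_1) y).

Lemma row_mx_norm n (t s : R) (y z : 'rV[R]_n) :
  `|(row_mx (t%:M : 'rV[R]_1) y : 'rV[R]_(1 + n)) - row_mx (s%:M : 'rV[R]_1) z|
    <= Num.max `|t - s| `|y - z|.
Proof.
apply: norm_coord_le => [|i]; first by rewrite le_max normr_ge0.
rewrite mxE [X in _ + X]mxE; case: (split_ordP i) => k ->; last first.
  rewrite !row_mxEr le_max.
  by have := norm_coord (y - z) k; rewrite !mxE => ->; rewrite orbT.
by rewrite !row_mxEl !mxE (ord1 k) eqxx !mulr1n le_max lexx.
Qed.

Lemma lipb_slice n (f : 'rV[R]_n.+1 -> R) t : lipb f -> lipb (slice f t).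
Proof.
move=> [C C0 [fC fL]]; exists C => //; split=> [y|y z]; first exact: fC.
apply: (le_trans (fL _ _)); apply: ler_wpM2l => //.
apply: le_trans (row_mx_norm t t y z) _.
by rewrite subrr normr0 ge_max normr_ge0 lexx.
Qed.

Lemma intLeb_le n (f : 'rV[R]_n -> R) M : 0 <= M -> (forall x, `|f x| <= M) ->
  `|intLeb f| <= M.
Proof.
move=> M0 fM.
have := @iterint_bound `[0, 1] `[0, 1] n f M 1.
rewrite expr1n mulr1; apply=> //.
  by rewrite lebesgue_itvcc ?ler01// subr0.
move=> x xD; rewrite big1 ?mulr1// => j _.
by rewrite indicE mem_set.
Qed.

Lemma lip_integrable (g : R -> R) C : (forall t s, `|g t - g s| <= C * `|t - s|) ->
  mu.-integrable `[0, 1] (EFin \o g).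
Proof.
move=> gL; apply: continuous_compact_integrable; first exact: segment_compact.
apply: continuous_subspaceT => x; apply/cvgrPdist_le => /= e e0.
near=> y; apply: (le_trans (gL _ _)).
apply: (@le_trans _ _ ((`|C| + 1) * `|x - y|)).
  by apply: ler_wpM2r => //; rewrite (le_trans (ler_norm _))// lerDl.
rewrite -ler_pdivlMl ?ltr_wpDl//; near: y.
by apply: cvgr_dist_le => //; rewrite mulr_gt0// invr_gt0 ltr_wpDl.
Unshelve. all: by end_near. Qed.

Lemma intLebE n (f : 'rV[R]_n.+1 -> R) :
  intLeb f = \int[mu]_(t in `[0, 1]) intLeb (slice f t).
Proof. by []. Qed.

Lemma intLeb_linear n (f g : 'rV[R]_n -> R) :
  lipb f -> lipb g -> (forall a, intLeb (fun x => a * f x + g x) = a * intLeb f + intLeb g).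
Proof.
elim: n f g => [|n IH] f g lf lg a; first by [].
have lipI (h : 'rV[R]_n.+1 -> R) : lipb h -> exists2 C : R, 0 <= C &
    forall t s, `|intLeb (slice h t) - intLeb (slice h s)| <= C * `|t - s|.
  move=> lh; have [C C0 [hC hL]] := lh; exists C => // t s.
  have := IH (slice h s) (slice h t) (lipb_slice s lh) (lipb_slice t lh) (-1).
  rewrite mulN1r [_ + _]addrC => <-; apply: intLeb_le => [|y].
    by rewrite mulr_ge0.
  rewrite mulN1r addrC; apply: (le_trans (hL _ _)); apply: ler_wpM2l => //.
  apply: (le_trans (row_mx_norm _ _ _ _)).
  by rewrite subrr normr0 ge_max normr_ge0 lexx.
have [C C0 Cf] := lipI f lf; have [C' C'0 Cg] := lipI g lg.
rewrite !intLebE.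
under eq_Rintegral.
  move=> t _; rewrite (_ : slice _ t = fun y => a * slice f t y + slice g t y)//.
  rewrite IH; [|exact: lipb_slice|exact: lipb_slice]; over.
rewrite RintegralD//=; last 2 first.
- apply: (@lip_integrable _ (`|a| * C)) => t s.
  by rewrite -mulrBr normrM -mulrA ler_wpM2l.
- exact: lip_integrable Cg.
by rewrite RintegralZl//=; exact: lip_integrable Cf.
Qed.

Lemma lipb_cst (V : normedModType R) (c : R) : lipb (fun _ : V => c).
Proof.
by exists `|c| => //; split=> // x y; rewrite subrr normr0 mulr_ge0.
Qed.

Lemma lipbD (V : normedModType R) (f g : V -> R) : lipb f -> lipb g -> lipb (fun x => f x + g x).
Proof.
move=> [C C0 [fC fL]] [D D0 [gC gL]]; exists (C + D); first exact: addr_ge0.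
split=> [x|x y]; first by rewrite (le_trans (ler_normD _ _))// lerD.
have -> : f x + g x - (f y + g y) = (f x - f y) + (g x - g y) by ring.
by rewrite (le_trans (ler_normD _ _))// [leRHS]mulrDl lerD.
Qed.

Lemma lipbM (V : normedModType R) (f g : V -> R) : lipb f -> lipb g -> lipb (fun x => f x * g x).
Proof.
move=> [C C0 [fC fL]] [D D0 [gC gL]]; exists (C * D + C * D); first by rewrite addr_ge0// mulr_ge0.
split=> [x|x y].
  by rewrite normrM (@le_trans _ _ (C * D)) ?ler_pM// lerDl mulr_ge0.
have -> : f x * g x - f y * g y = (f x - f y) * g x + f y * (g x - g y) by ring.
rewrite (le_trans (ler_normD _ _))// [leRHS]mulrDl !normrM lerD//.
  by rewrite mulrAC ler_pM.
by rewrite -mulrA ler_pM.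
Qed.

Lemma lipbZ (V : normedModType R) (a : R) (f : V -> R) : lipb f -> lipb (fun x => a * f x).
Proof. by move=> lf; apply: lipbM => //; exact: lipb_cst. Qed.

Lemma lipbB (V : normedModType R) (f g : V -> R) : lipb f -> lipb g -> lipb (fun x => f x - g x).
Proof.
move=> lf lg; rewrite (_ : (fun x => _) = fun x => f x + -1 * g x).
  by apply: lipbD => //; exact: lipbZ.
by apply/funext => x; rewrite mulN1r.
Qed.

Lemma lipb_sum (V : normedModType R) (I : Type) (s : seq I) (P : pred I) (f : I -> V -> R) :
  (forall i, lipb (f i)) -> lipb (fun x => \sum_(i <- s | P i) f i x).
Proof.
move=> lf; elim: s => [|i s IH].
  rewrite (_ : (fun x => _) = fun=> 0); first exact: lipb_cst.
  by apply/funext => x; rewrite big_nil.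
case Pi : (P i); last first.
  rewrite (_ : (fun x => _) = fun x => \sum_(i <- s | P i) f i x)//.
  by apply/funext => x; rewrite big_cons Pi.
rewrite (_ : (fun x => _) = fun x => f i x + \sum_(i <- s | P i) f i x).
  exact: lipbD.
by apply/funext => x; rewrite big_cons Pi.
Qed.

Lemma intLeb_cst n (c : R) : intLeb (fun _ : 'rV[R]_n => c) = c.
Proof.
elim: n => [//|n IH]; rewrite intLebE.
under eq_Rintegral do rewrite /slice IH.
by rewrite Rintegral_cst//= lebesgue_itvcc ?ler01// subr0 mulr1.
Qed.

Lemma intLebD n (f g : 'rV[R]_n -> R) : lipb f -> lipb g ->
  intLeb (fun x => f x + g x) = intLeb f + intLeb g.
Proof.
move=> lf lg; have := intLeb_linear lf lg 1; rewrite mul1r => <-.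
by congr intLeb; apply/funext => x; rewrite mul1r.
Qed.

Lemma intLebZ n a (f : 'rV[R]_n -> R) : lipb f ->
  intLeb (fun x => a * f x) = a * intLeb f.
Proof.
move=> lf; have := intLeb_linear lf (lipb_cst _ 0) a; rewrite intLeb_cst addr0 => <-.
by congr intLeb; apply/funext => x; rewrite addr0.
Qed.

Lemma intLebB n (f g : 'rV[R]_n -> R) : lipb f -> lipb g ->
  intLeb (fun x => f x - g x) = intLeb f - intLeb g.
Proof.
move=> lf lg; have := intLeb_linear lg lf (-1); rewrite mulN1r addrC => <-.
by congr intLeb; apply/funext => x; rewrite mulN1r addrC.
Qed.

Lemma intLeb_sum n (I : Type) (s : seq I) (f : I -> 'rV[R]_n -> R) :
  (forall i, lipb (f i)) ->
  intLeb (fun x => \sum_(i <- s) f i x) = \sum_(i <- s) intLeb (f i).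
Proof.
move=> lf; elim: s => [|i s IH].
  rewrite big_nil -[RHS](intLeb_cst n 0); congr intLeb.
  by apply/funext => x; rewrite big_nil.
rewrite big_cons -IH -intLebD//; last exact: lipb_sum.
by congr intLeb; apply/funext => x; rewrite big_cons.
Qed.

Lemma intLeb_slice_lip n (f : 'rV[R]_n.+1 -> R) C : lipb f ->
  (forall x y, `|f x - f y| <= C * `|x - y|) -> 0 <= C ->
  forall t s, `|intLeb (slice f t) - intLeb (slice f s)| <= C * `|t - s|.
Proof.
move=> lf fL C0 t s; rewrite -intLebB; [|exact: lipb_slice|exact: lipb_slice].
apply: intLeb_le => [|y]; first by rewrite mulr_ge0.
apply: (le_trans (fL _ _)); apply: ler_wpM2l => //.
apply: (le_trans (row_mx_norm _ _ _ _)).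
by rewrite subrr normr0 ge_max normr_ge0 lexx.
Qed.

Lemma quotient_estimate (f f' : R -> R) (C t h : R) : 0 <= C ->
  (forall s : R, is_derive s 1 f (f' s)) ->
  (forall s u, `|f' s - f' u| <= C * `|s - u|) ->
  `|f (t + h) - f t - h * f' t| <= C * `|h| * `|h|.
Proof.
move=> C0 fd fL.
pose g s := f s - s * f' t.
have gd (s : R) : is_derive s 1 g (f' s - f' t).
  have fds := fd s.
  have -> : g = f - f' t \*: (id : R -> R) by apply/funext => u; rewrite /g mulrC.
  by apply: is_derive_eq; rewrite [_ *: _]mulr1.
have [h0|h0] := leP 0 h.
  have := @MVT_le _ g (fun s => f' s - f' t) t (t + h) (C * `|h|).
  have -> : t + h - t = `|h| by rewrite ger0_norm//; ring.
  rewrite /g => H.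
  have -> : f (t + h) - f t - h * f' t = f (t + h) - (t + h) * f' t - (f t - t * f' t) by ring.
  apply: H (fun s _ => gd s) _ _; last by rewrite lerDl.
  move=> s /andP[ts sth].
  apply: (le_trans (fL _ _)); apply: ler_wpM2l => //.
  rewrite !ger0_norm ?subr_ge0//; lra.
have := @MVT_le _ g (fun s => f' s - f' t) (t + h) t (C * `|h|).
have -> : t - (t + h) = `|h| by rewrite ltr0_norm//; ring.
rewrite /g => H.
have -> : f (t + h) - f t - h * f' t = - (f t - t * f' t - (f (t + h) - (t + h) * f' t)) by ring.
rewrite normrN; apply: H (fun s _ => gd s) _ _; last by lra.
move=> s /andP[ts sth].
apply: (le_trans (fL _ _)); apply: ler_wpM2l => //.
rewrite (ltr0_norm h0) ler0_norm ?subr_le0//; lra.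
Qed.

(** The derivatives in the parameter are Lipschitz uniformly in the integration
    variable, so that the difference quotients converge uniformly. *)
Lemma is_derive_intLeb n (F F' : R -> 'rV[R]_n -> R) (C : R) : 0 <= C ->
  (forall t, lipb (F t)) -> (forall t, lipb (F' t)) ->
  (forall (t : R) y, is_derive t 1 (F^~ y) (F' t y)) ->
  (forall t s y, `|F' t y - F' s y| <= C * `|t - s|) ->
  forall t : R, is_derive t 1 (fun s => intLeb (F s)) (intLeb (F' t)).
Proof.
move=> C0 lF lF' dF LF t.
have key h : `|intLeb (F (t + h)) - intLeb (F t) - h * intLeb (F' t)| <= C * `|h| * `|h|.
  have lB := lipbB (lF (t + h)) (lF t); have lZ := lipbZ h (lF' t).
  rewrite -intLebZ// -intLebB// -intLebB//.
  apply: intLeb_le => [|y]; first by rewrite !mulr_ge0.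
  exact: (@quotient_estimate (F^~ y) (F'^~ y) C t h C0 (dF^~ y) (fun s u => LF s u y)).
have H : (fun h : R => h^-1 *: (intLeb (F (h *: 1 + t)) - intLeb (F t))) @ 0^'
   --> intLeb (F' t).
  apply/cvgrPdist_le => e e0; near=> h.
  have h0 : h != 0 by near: h; exact: nbhs_dnbhs_neq.
  have -> : intLeb (F' t) - h^-1 *: (intLeb (F (h *: 1 + t)) - intLeb (F t)) =
     - (h^-1 * (intLeb (F (t + h)) - intLeb (F t) - h * intLeb (F' t))).
    rewrite [h *: 1]mulr1 [h + t]addrC (_ : forall a b : R, a *: b = a * b)//.
    by field.
  rewrite normrN normrM normfV ler_pdivrMl ?normr_gt0//.
  apply: (le_trans (key h)); rewrite mulrC ler_wpM2l//.
  apply: (@le_trans _ _ ((C + 1) * `|h|)); first by rewrite ler_wpM2r// lerDl.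
  rewrite -ler_pdivlMl ?ltr_wpDl//.
  near: h; apply: dnbhs0_le.
  by rewrite mulr_gt0// invr_gt0 ltr_wpDl.
by apply: DeriveDef; [apply/cvg_ex; exists (intLeb (F' t))|apply/cvg_lim].
Unshelve. all: by end_near. Qed.

Lemma Rint_derive (F f : R -> R) C :
  (forall t : R, is_derive t 1 F (f t)) -> (forall t s, `|f t - f s| <= C * `|t - s|) ->
  \int[mu]_(t in `[0, 1]) f t = F 1 - F 0.
Proof.
move=> dF fL.
have cF t : {for t, continuous F}.
  by apply: differentiable_continuous; apply/derivable1_diffP; case: (dF t).
rewrite /Rintegral (@continuous_FTC2 _ f F 0 1)//.
- apply: continuous_subspaceT => x; apply/cvgrPdist_le => /= e e0.
  near=> y; apply: (le_trans (fL _ _)).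
  apply: (@le_trans _ _ ((`|C| + 1) * `|x - y|)).
    by apply: ler_wpM2r => //; rewrite (le_trans (ler_norm _))// lerDl.
  rewrite -ler_pdivlMl ?ltr_wpDl//; near: y.
  by apply: cvgr_dist_le => //; rewrite mulr_gt0// invr_gt0 ltr_wpDl.
- split.
  + by move=> t _; case: (dF t).
  + by apply: cvg_at_right_filter; exact: cF.
  + by apply: cvg_at_left_filter; exact: cF.
- by move=> t _; rewrite derive1E derive_val.
Unshelve. all: by end_near. Qed.

Lemma vec_lshift n (k : 'I_1) : vec (lshift n k) = row_mx (1%:M : 'M[R]_1) (0 : 'rV[R]_n).
Proof.
apply/rowP => i; rewrite vecE; case: (split_ordP i) => l ->.
  by rewrite row_mxEl mxE !(ord1 k) !(ord1 l) !eqxx.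
by rewrite row_mxEr mxE eq_rlshift.
Qed.

Lemma vec_rshift n (k : 'I_n) : vec (rshift 1 k) = row_mx (0 : 'M[R]_1) (vec k : 'rV[R]_n).
Proof.
apply/rowP => i; rewrite vecE; case: (split_ordP i) => l ->.
  by rewrite row_mxEl mxE eq_lrshift.
by rewrite row_mxEr vecE eq_rshift.
Qed.

Lemma row_mx_vec0 n (t : R) (y : 'rV[R]_n) (k : 'I_1) :
  row_mx (t%:M : 'M[R]_1) y + vec (lshift n k) = row_mx ((t + 1)%:M : 'M[R]_1) y.
Proof. by rewrite vec_lshift add_row_mx addr0 raddfD. Qed.

Lemma row_mx_vec1 n (t : R) (y : 'rV[R]_n) (k : 'I_n) :
  row_mx (t%:M : 'M[R]_1) y + vec (rshift 1 k) = row_mx (t%:M : 'M[R]_1) (y + vec k).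
Proof. by rewrite vec_rshift add_row_mx addr0. Qed.

Lemma slice_path0 n (f : 'rV[R]_n.+1 -> R) (df : R) (y : 'rV[R]_n) t :
  is_derive (row_mx (t%:M : 'M[R]_1) y : 'rV[R]_(1 + n)) (vec (lshift n ord0)) f df ->
  is_derive t 1 (fun s => slice f s y) df.
Proof.
have E s : row_mx (s%:M : 'M[R]_1) y =
   row_mx (0 : 'M[R]_1) y + s *: vec (lshift n ord0) :> 'rV[R]_(1 + n).
  rewrite vec_lshift scale_row_mx add_row_mx scaler0 addr0 add0r; congr row_mx.
  by rewrite -mul_scalar_mx mulmx1.
rewrite E => /is_derive_path.
by rewrite (_ : (fun s => f _) = fun s => slice f s y)//; apply/funext => s; rewrite /slice E.
Qed.

Lemma slice_path1 n (f : 'rV[R]_n.+1 -> R) (df : R) (y : 'rV[R]_n) t k :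
  is_derive (row_mx (t%:M : 'M[R]_1) y : 'rV[R]_(1 + n)) (vec (rshift 1 k)) f df ->
  is_derive y (vec k) (slice f t) df.
Proof.
move=> [d e].
have E : (fun h : R => h^-1 *: (f (h *: vec (rshift 1 k) + row_mx t%:M y) - f (row_mx t%:M y))) =
  (fun h : R => h^-1 *: (slice f t (h *: vec k + y) - slice f t y)).
  apply/funext => h; rewrite /slice; congr (_ *: (f _ - _)).
  by rewrite vec_rshift scale_row_mx add_row_mx scaler0 add0r.
by apply: DeriveDef; [rewrite /derivable -E|rewrite /derive -E].
Qed.

(** In the outermost variable the derivative passes through the inner integral
    and the fundamental theorem of calculus applies to a periodic function; in
    another variable an inner integral already vanishes. *)
Lemma intLeb_derive n (i : 'I_n) (F F' : 'rV[R]_n -> R) :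
  lipb F -> lipb F' ->
  (forall x : 'rV[R]_n, F (x + vec i) = F x) ->
  (forall x : 'rV[R]_n, is_derive x (vec i) F (F' x)) -> intLeb F' = 0.
Proof.
elim: n i F F' => [[]//|n IH] i F F' lF lF' pF dF.
have [C C0 [_ F'L]] := lF'.
rewrite intLebE; case: (@split_ordP 1 n i) => k ki; rewrite {}ki in pF dF.
  have dG t : is_derive (t : R) 1 (fun t => intLeb (slice F t)) (intLeb (slice F' t)).
    apply: (@is_derive_intLeb _ (slice F) (slice F') C) => //.
    - by move=> s; exact: lipb_slice.
    - by move=> s; exact: lipb_slice.
    - by move=> s y; apply: slice_path0; rewrite (ord1 k) in dF; exact: dF.
    - move=> s u y; apply: (le_trans (F'L _ _)); apply: ler_wpM2l => //.
      apply: (le_trans (row_mx_norm _ _ _ _)).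
      by rewrite subrr normr0 ge_max normr_ge0 lexx.
  rewrite (Rint_derive dG (intLeb_slice_lip lF' F'L C0)).
  apply/eqP; rewrite subr_eq0; apply/eqP; congr intLeb; apply/funext => y.
  rewrite /slice -[RHS]pF; congr F.
  by have := row_mx_vec0 0 y k; rewrite add0r => <-.
have inner t : intLeb (slice F' t) = 0.
  have sF x : is_derive x (vec k) (slice F t) (slice F' t x) by apply: slice_path1.
  apply: (IH k _ _ _ _ _ sF); [exact: lipb_slice|exact: lipb_slice|].
  by move=> x; rewrite /slice -[RHS]pF; congr F; rewrite row_mx_vec1.
under eq_Rintegral do rewrite inner.
by rewrite Rintegral_cst// mul0r.
Qed.

End Integration.

(** * Fourier sums in one variable *)

Section Fourier1.
Context {R : realType}.
Notation mu := (@lebesgue_measure R).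

Definition int01 (g : R -> R) : R := \int[mu]_(t in `[0, 1]) g t.

Lemma lipb_integrable (g : R -> R) : lipb g -> mu.-integrable `[0, 1] (EFin \o g).
Proof. by move=> [C _ [_ gL]]; exact: lip_integrable gL. Qed.

Lemma int01D (f g : R -> R) : lipb f -> lipb g ->
  int01 (fun t => f t + g t) = int01 f + int01 g.
Proof. by move=> lf lg; rewrite /int01 RintegralD//; exact: lipb_integrable. Qed.

Lemma int01B (f g : R -> R) : lipb f -> lipb g ->
  int01 (fun t => f t - g t) = int01 f - int01 g.
Proof. by move=> lf lg; rewrite /int01 RintegralB//; exact: lipb_integrable. Qed.

Lemma int01Z (a : R) (f : R -> R) : lipb f -> int01 (fun t => a * f t) = a * int01 f.
Proof. by move=> lf; rewrite /int01 RintegralZl//; exact: lipb_integrable. Qed.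

Lemma int01_cst (a : R) : int01 (fun=> a) = a.
Proof. by rewrite /int01 Rintegral_cst//= lebesgue_itvcc ?ler01// subr0 mulr1. Qed.

Lemma int01_sum (I : Type) (s : seq I) (f : I -> R -> R) : (forall i, lipb (f i)) ->
  int01 (fun t => \sum_(i <- s) f i t) = \sum_(i <- s) int01 (f i).
Proof.
move=> lf; elim: s => [|i s IH].
  rewrite big_nil -[RHS](int01_cst 0); congr int01.
  by apply/funext => x; rewrite big_nil.
rewrite big_cons -IH -int01D//; last exact: lipb_sum.
by congr int01; apply/funext => x; rewrite big_cons.
Qed.

Lemma le_int01 (f g : R -> R) : lipb f -> lipb g -> (forall t, f t <= g t) ->
  int01 f <= int01 g.
Proof. by move=> lf lg fg; apply: le_Rintegral => //; exact: lipb_integrable. Qed.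

Lemma int01_bound (g : R -> R) K : 0 <= K -> (forall t, `|g t| <= K) -> `|int01 g| <= K.
Proof.
move=> K0 gK; rewrite -[K]mulr1.
apply: (@Rintegral_bound _ `[0, 1] `[0, 1]) => //.
  by rewrite lebesgue_itvcc ?ler01// subr0.
by move=> t tD; rewrite indicE mem_set// mulr1.
Qed.

Lemma lipb_derive (f f' : R -> R) C :
  (forall t : R, is_derive t 1 f (f' t)) -> (forall t, `|f t| <= C) ->
  (forall t, `|f' t| <= C) -> lipb f.
Proof.
move=> fd fC f'C; have C0 : 0 <= C by exact: le_trans (fC 0).
exists C => //; split=> // x y.
have [xy|/ltW xy] := leP x y.
  rewrite distrC; apply: le_trans (MVT_le (fun t _ => fd t) (fun t _ => f'C t) xy) _.
  by rewrite distrC ler_wpM2l// ler_norm.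
apply: le_trans (MVT_le (fun t _ => fd t) (fun t _ => f'C t) xy) _.
by rewrite ler_wpM2l// ler_norm.
Qed.

Lemma int01_derive (F f : R -> R) : lipb f -> (forall t : R, is_derive t 1 F (f t)) ->
  int01 f = F 1 - F 0.
Proof. by move=> [C _ [_ fL]] dF; exact: Rint_derive dF fL. Qed.

Section Wave.
Variables (w x : R).

Lemma is_derive_phase (t : R) : is_derive t 1 (fun t => w * (x - t)) (- w).
Proof.
rewrite (_ : (fun t => _) = cst (w * x) - w \*: (id : R -> R)).
  by apply: is_derive_eq; rewrite [_ *: _]mulr1 add0r.
by apply/funext => s; rewrite !fctE /= mulrBr.
Qed.

Lemma is_derive_cosw (t : R) :
  is_derive t 1 (fun t => cos (w * (x - t))) (w * sin (w * (x - t))).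
Proof.
have dp := is_derive_phase t.
by apply: is_derive_eq; rewrite mulrNN mulrC.
Qed.

Lemma is_derive_sinw (t : R) :
  is_derive t 1 (fun t => sin (w * (x - t))) (- w * cos (w * (x - t))).
Proof.
have dp := is_derive_phase t.
by apply: is_derive_eq; rewrite mulrC.
Qed.

Lemma lipb_cosw : lipb (fun t => cos (w * (x - t))).
Proof.
apply: (@lipb_derive _ (fun t => w * sin (w * (x - t))) (Num.max 1 `|w|)).
- exact: is_derive_cosw.
- by move=> t; rewrite le_max cos_max.
- move=> t; rewrite le_max normrM; apply/orP; right.
  by rewrite ler_piMr// sin_max.
Qed.

Lemma lipb_sinw : lipb (fun t => sin (w * (x - t))).
Proof.
apply: (@lipb_derive _ (fun t => - w * cos (w * (x - t))) (Num.max 1 `|w|)).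
- exact: is_derive_sinw.
- by move=> t; rewrite le_max sin_max.
- move=> t; rewrite le_max normrM normrN; apply/orP; right.
  by rewrite ler_piMr// cos_max.
Qed.

End Wave.

Lemma cos_nat (x : R) (k : nat) : cos (x + 2 * pi * k%:R) = cos x.
Proof.
have := periodicn (@cosD2pi R) k x; congr (cos (_ + _) = _).
by rewrite -mulrnA mulnC -[LHS]mulr_natr natrM; ring.
Qed.

Lemma sin_nat (x : R) (k : nat) : sin (x + 2 * pi * k%:R) = sin x.
Proof.
have := periodicn (@sinD2pi R) k x; congr (sin (_ + _) = _).
by rewrite -mulrnA mulnC -[LHS]mulr_natr natrM; ring.
Qed.

Definition angfreq (l : nat) : R := 2 * pi * l%:R.

Lemma cosw1 l x : cos (angfreq l * (x - 1)) = cos (angfreq l * (x - 0)).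
Proof. by rewrite -(cos_nat (angfreq l * (x - 1)) l); congr cos; rewrite /angfreq; ring. Qed.

Lemma sinw1 l x : sin (angfreq l * (x - 1)) = sin (angfreq l * (x - 0)).
Proof. by rewrite -(sin_nat (angfreq l * (x - 1)) l); congr sin; rewrite /angfreq; ring. Qed.

(** The Dirichlet kernel, the sum of the [N + N + 1] exponentials of frequency at
    most [N] in absolute value. *)
Definition dker (N : nat) (t : R) : R :=
  1 + 2 * \sum_(l < N) cos (angfreq l.+1 * t).

Lemma angfreq_gt0 l : 0 < angfreq l.+1.
Proof. by rewrite /angfreq !mulr_gt0// pi_gt0. Qed.

Lemma int01_cosw l x : int01 (fun t => cos (angfreq l.+1 * (x - t))) = 0.
Proof.
have w0 := angfreq_gt0 l.
have lc := lipb_cosw (angfreq l.+1) x.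
suff : - angfreq l.+1 * int01 (fun t => cos (angfreq l.+1 * (x - t))) = 0.
  by move/eqP; rewrite mulf_eq0 oppr_eq0 gt_eqF//= => /eqP.
rewrite -int01Z// (int01_derive (lipbZ _ lc) (is_derive_sinw _ x)).
by rewrite sinw1 subrr.
Qed.

Lemma lipb_dker N x : lipb (fun t => dker N (x - t)).
Proof.
apply: lipbD; first exact: lipb_cst.
by apply: lipbZ; apply: lipb_sum => l; exact: lipb_cosw.
Qed.

Lemma int01_dker N x : int01 (fun t => dker N (x - t)) = 1.
Proof.
have lS : lipb (fun t => \sum_(l < N) cos (angfreq l.+1 * (x - t))).
  by apply: lipb_sum => l; exact: lipb_cosw.
rewrite int01D; [|exact: lipb_cst|exact: lipbZ].
rewrite int01_cst int01Z// int01_sum; last by move=> l; exact: lipb_cosw.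
by rewrite big1 ?mulr0 ?addr0// => l _; exact: int01_cosw.
Qed.

Lemma cos2M (a b : R) : 2 * cos a * cos b = cos (a + b) + cos (a - b).
Proof. by rewrite cosD cosB; ring. Qed.

(** The factor [1 - cos] is the square of the usual denominator
    [sqrt 2 * sin (pi t)]; after multiplication by it the kernels telescope. *)
Lemma dker_tel N (t : R) : dker N t * (1 - cos (angfreq 1 * t)) =
  cos (angfreq N * t) - cos (angfreq N.+1 * t).
Proof.
elim: N => [|N IH]; first by rewrite /dker big_ord0 /angfreq !(mulr0, mul0r) addr0 mul1r cos0.
have -> : dker N.+1 t = dker N t + 2 * cos (angfreq N.+1 * t).
  by rewrite /dker big_ord_recr/=; ring.
rewrite mulrDl IH mulrBr mulr1 cos2M.
have -> : angfreq N.+1 * t + angfreq 1 * t = angfreq N.+2 * t by rewrite /angfreq -!natr1; ring.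
have -> : angfreq N.+1 * t - angfreq 1 * t = angfreq N * t by rewrite /angfreq -!natr1; ring.
ring.
Qed.

(** The Fejer kernel without its normalisation.  Unlike the Dirichlet kernels it
    is nonnegative. *)
Definition fker (M : nat) (t : R) : R := \sum_(j < M) dker j t.

Lemma fker_tel M (t : R) : fker M t * (1 - cos (angfreq 1 * t)) = 1 - cos (angfreq M * t).
Proof.
rewrite /fker mulr_suml; under eq_bigr do rewrite dker_tel.
rewrite -(big_mkord xpredT (fun j => cos (angfreq j * t) - cos (angfreq j.+1 * t))).
rewrite (eq_bigr (fun j => - cos (angfreq j.+1 * t) - - cos (angfreq j * t))); last first.
  by move=> j _; ring.
by rewrite telescope_sumr//= /angfreq mulr0 mul0r cos0; ring.
Qed.

Lemma fker_ge0 M t : 0 <= fker M t.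
Proof.
have : 0 <= 1 - cos (angfreq 1 * t) by rewrite subr_ge0 cos_le1.
rewrite le_eqVlt => /predU1P[/esym/eqP|c0]; last first.
  rewrite -(pmulr_lge0 _ c0) fker_tel subr_ge0; exact: cos_le1.
rewrite subr_eq0 => /eqP/esym c1.
have s0 : sin (angfreq 1 * t) = 0 by apply: cos1sin0; rewrite c1 normr1.
have cl l : cos (angfreq l * t) = 1.
  elim: l => [|l IH]; first by rewrite /angfreq mulr0 mul0r cos0.
  have -> : angfreq l.+1 * t = angfreq l * t + angfreq 1 * t by rewrite /angfreq -!natr1; ring.
  by rewrite cosD IH c1 s0; ring.
apply: sumr_ge0 => j _; rewrite /dker addr_ge0// mulr_ge0//.
by apply: sumr_ge0 => l _; rewrite cl.
Qed.

Lemma fker_le M t : fker M t * (1 - cos (angfreq 1 * t)) <= 2.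
Proof. by rewrite fker_tel; have := cos_geN1 (angfreq M * t); lra. Qed.

Lemma lipb_fker M x : lipb (fun t => fker M (x - t)).
Proof. by apply: lipb_sum => j; exact: lipb_dker. Qed.

Lemma int01_fker M x : int01 (fun t => fker M (x - t)) = M%:R.
Proof.
rewrite int01_sum; last by move=> l; exact: lipb_dker.
by under eq_bigr do rewrite int01_dker; rewrite sumr_const card_ord.
Qed.

(** A weak form of Jordan's inequality.  On the first half of the interval the
    derivative [pi * cos] is at least one; on the second half the sine is already
    at least [1 / 2]. *)
Lemma sin_ge (v : R) : 0 <= v <= 1 / 2 -> v <= sin (pi * v).
Proof.
move=> /andP[v0 v1]; have p0 := @pi_gt0 R; have p2 := @pi_ge2 R.
have cq : 1 / 2 <= cos (pi / 4) :> R.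
  have c0 : 0 <= cos (pi / 4) :> R by apply: cos_ge0_pihalf; lra.
  have : cos ((pi / 4) *+ 2) = 0 :> R by rewrite -[RHS]cos_pihalf; congr cos; field.
  by rewrite cos_mulr2n; nra.
have cge (y : R) : 0 <= y <= pi / 4 -> 1 / 2 <= cos y.
  move=> /andP[y0]; rewrite le_eqVlt => /predU1P[->//|yq].
  apply: (le_trans cq); apply: ltW; rewrite ltr_cos// ?in_itv/=; try (apply/andP; split); lra.
have sge (u : R) : 0 <= u <= 1 / 4 -> u <= sin (pi * u).
  move=> /andP[u0 u4].
  have dsin (t : R) : t \in `]0, pi * u[ -> is_derive t 1 sin (cos t).
    by move=> _; exact: is_derive_sin.
  have pu0 : 0 <= pi * u by rewrite mulr_ge0// ltW.
  have sc : {within `[0, pi * u], continuous (@sin R)}.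
    by apply: continuous_subspaceT => z; exact: continuous_sin.
  have [c /itvP cu] := MVT_segment pu0 dsin sc.
  rewrite sin0 !subr0 => ->.
  have c0 : 0 <= c by rewrite cu.
  have cpu : c <= pi * u by rewrite cu.
  have : 1 / 2 <= cos c by apply: cge; apply/andP; split => //; nra.
  nra.
have [v4|v4] := leP v (1 / 4); first by apply: sge; rewrite v0.
have : pi * (1 / 4) < pi * v by rewrite ltr_pM2l.
rewrite -ltr_sin ?in_itv/=; try (apply/andP; split); try nra.
have : 1 / 2 <= sin (pi * (1 / 4)) :> R.
  rewrite -cosBpihalf -cosN (_ : - _ = pi / 4)//; by field.
lra.
Qed.

Lemma one_sub_cos_ge (v : R) : `|v| <= 1 / 2 -> v ^+ 2 <= 1 - cos (angfreq 1 * v).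
Proof.
move=> v2; have := @sin_ge `|v|; rewrite normr_ge0 v2 => /(_ isT) H.
rewrite -cos_norm normrM (ger0_norm (ltW (angfreq_gt0 0))).
have -> : angfreq 1 * `|v| = (pi * `|v|) *+ 2 by rewrite /angfreq mulr1 -[RHS]mulr_natl mulrA.
rewrite cos_mulr2n cos2sin2 -(real_normK (num_real v)).
have := normr_ge0 v; nra.
Qed.

Lemma near_int (v : R) : exists k : int, `|v - k%:~R| <= 1 / 2.
Proof.
exists (Num.floor (v + 1 / 2)).
have /andP[] := @floor_itv R (v + 1 / 2).
set k := _%:~R; rewrite intrD -/k => a b.
by rewrite ler_norml; apply/andP; split; lra.
Qed.

Lemma periodic_int (Y : Type) (f : R -> Y) : (forall t, f (t + 1) = f t) ->
  forall (k : int) t, f (t + k%:~R) = f t.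
Proof.
move=> f1; have fn (k : nat) t : f (t + k%:R) = f t.
  elim: k t => [|k IH] t; first by rewrite addr0.
  by rewrite -natr1 addrA f1 IH.
case=> k t; first exact: fn.
by rewrite NegzE -(fn k.+1 (t + _)) mulrNz subrK.
Qed.

Section Chain.
Variable G : nat -> R -> R.
Hypothesis Gd : forall i (t : R), is_derive t 1 (G i) (G i.+1 t).
Hypothesis Gp : forall i t, G i (t + 1) = G i t.
Hypothesis Gb : forall i, exists C, forall t, `|G i t| <= C.

Lemma chain_lipb i : lipb (G i).
Proof.
have [C GC] := Gb i; have [C' GC'] := Gb i.+1.
apply: (lipb_derive (C := Num.max C C') (Gd i)).
  by move=> t; rewrite le_max GC.
by move=> t; rewrite le_max GC' orbT.
Qed.

(** Up to a factor 2, the contribution of the frequencies [l + 1] and [- (l + 1)]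
    to the Fourier series of [G i] at [x]. *)
Definition coef l i x := int01 (fun t => G i t * cos (angfreq l.+1 * (x - t))).

Lemma coef_lipb l i x : lipb (fun t => G i t * cos (angfreq l.+1 * (x - t))).
Proof. by apply: lipbM; [exact: chain_lipb|exact: lipb_cosw]. Qed.

(** Two integrations by parts at once, to avoid introducing sine coefficients. *)
Lemma coef_parts l i x : angfreq l.+1 ^+ 2 * coef l i x = - coef l i.+2 x.
Proof.
set w := angfreq l.+1.
pose F (t : R) := G i.+1 t * cos (w * (x - t)) - w * (G i t * sin (w * (x - t))).
pose f t := w ^+ 2 * (G i t * cos (w * (x - t))) + G i.+2 t * cos (w * (x - t)).
have dF (t : R) : is_derive t 1 F (f t).
  have g0 := Gd i t; have g1 := Gd i.+1 t.
  have dc := is_derive_cosw w x t; have ds := is_derive_sinw w x t.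
  have -> : F = G i.+1 * (fun t => cos (w * (x - t)))
     - w \*: (G i * (fun t => sin (w * (x - t)))) by [].
  apply: is_derive_eq.
  by rewrite !(_ : forall a b : R, a *: b = a * b)// /f; ring.
apply/eqP; rewrite -addr_eq0 /coef -int01Z; last exact: coef_lipb.
rewrite -int01D; [|by apply: lipbZ; exact: coef_lipb|exact: coef_lipb].
rewrite (int01_derive _ dF).
  have Gp0 k : G k 1 = G k 0 by rewrite -{1}[1]add0r Gp.
  by rewrite /F !Gp0 cosw1 sinw1 subrr.
by apply: lipbD; [apply: lipbZ|]; exact: coef_lipb.
Qed.

Lemma coef_iter l s x : angfreq l.+1 ^+ (2 * s) * `|coef l 0 x| = `|coef l (2 * s) x|.
Proof.
elim: s => [|s IH]; first by rewrite muln0 expr0 mul1r.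
rewrite (_ : (2 * s.+1)%N = (2 * s).+2); last by rewrite mulnS.
rewrite -[coef l (2 * s).+2 x]opprK -coef_parts normrN normrM -IH.
by rewrite ger0_norm ?sqr_ge0// mulrA -exprD.
Qed.

Lemma coef_le l s (x K : R) : (forall t, `|G (2 * s.+1) t| <= K) ->
  l.+1%:R ^+ (2 * s) * (l.+1%:R ^+ 2 * `|coef l 0 x|) <= K.
Proof.
move=> GK; have K0 : 0 <= K by exact: le_trans (GK 0).
have : `|coef l (2 * s.+1) x| <= K.
  apply: int01_bound => // t; rewrite normrM -[K]mulr1.
  by rewrite ler_pM// cos_max.
rewrite -coef_iter; apply: le_trans; rewrite mulrA -exprD.
have -> : (2 * s + 2 = 2 * s.+1)%N by rewrite mulnS addnC.
apply: ler_wpM2r => //; rewrite lerXn2r ?nnegrE ?ler0n//.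
  exact/ltW/angfreq_gt0.
by rewrite /angfreq ler_peMl// ?ler0n//; have := @pi_ge2 R; lra.
Qed.

Definition ferr N x := G 0 x - int01 (fun t => G 0 t * dker N (x - t)).

Lemma lipb_Gdker N x : lipb (fun t => G 0 t * dker N (x - t)).
Proof. by apply: lipbM; [exact: chain_lipb|exact: lipb_dker]. Qed.

Lemma ferrS N x : ferr N.+1 x = ferr N x - 2 * coef N 0 x.
Proof.
rewrite /ferr -addrA -opprD; congr (_ - _).
rewrite /coef -int01Z; last exact: coef_lipb.
rewrite -int01D; [|exact: lipb_Gdker|by apply: lipbZ; exact: coef_lipb].
by congr int01; apply/funext => t; rewrite /dker big_ord_recr/=; ring.
Qed.

(** The coefficients decay like [l ^ - (2 s + 2)]; the exponent 2 makes the tail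
    summable and the remaining [2 s] give the rate.  The factor
    [1 - 1 / (M + 1)] in the proof makes the induction telescope. *)
Lemma ferr_cauchy N M s (x K : R) : (forall t, `|G (2 * s.+1) t| <= K) -> (N <= M)%N ->
  `|ferr N x - ferr M x| <= 4 * K / N.+1%:R ^+ (2 * s).
Proof.
move=> GK NM; have K0 : 0 <= K by exact: le_trans (GK 0).
set P := _ ^+ _; have P0 : 0 < P by rewrite exprn_gt0.
suff : `|ferr N x - ferr M x| <= 4 * K / P * (1 - M.+1%:R^-1).
  move/le_trans; apply; apply: ler_piMr; last by rewrite lerBlDr lerDl invr_ge0.
  by rewrite mulr_ge0 ?invr_ge0 ?(ltW P0)// mulr_ge0.
rewrite -(subnKC NM); elim: (M - N)%N => [|k IH].
  rewrite addn0 subrr normr0 mulr_ge0//.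
    by rewrite mulr_ge0 ?invr_ge0 ?(ltW P0)// mulr_ge0.
  by rewrite subr_ge0 invf_le1// ler1n.
rewrite addnS ferrS; set m := (N + k)%N in IH *.
have -> : ferr N x - (ferr m x - 2 * coef m 0 x) =
   (ferr N x - ferr m x) + 2 * coef m 0 x by ring.
rewrite (le_trans (ler_normD _ _))// normrM (ger0_norm (ler0n _ 2)).
have cm : 2 * `|coef m 0 x| <= 4 * K / P * (m.+1%:R^-1 - m.+2%:R^-1).
  have := coef_le m x GK.
  have Pm : P <= m.+1%:R ^+ (2 * s).
    by rewrite lerXn2r ?nnegrE ?ler0n// ler_nat ltnS leq_addr.
  set c := `|coef m 0 x|; have c0 : 0 <= c by rewrite normr_ge0.
  rewrite -[m.+2%:R]natr1; set y : R := m.+1%:R; have y1 : 1 <= y by rewrite ler1n.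
  move=> H.
  have {}H : P * (y ^+ 2 * c) <= K.
    by apply: le_trans H; rewrite ler_wpM2r// mulr_ge0// sqr_ge0.
  have y0 : 0 < y by lra.
  have -> : 4 * K / P * (y^-1 - (y + 1)^-1) = 4 * K / (P * (y * (y + 1))).
    by field; rewrite !gt_eqF//; lra.
  rewrite ler_pdivlMr; last by rewrite !mulr_gt0//; lra.
  have -> : 2 * c * (P * (y * (y + 1))) = 2 * (P * (y ^+ 2 * c)) + 2 * (P * (y * c)) by ring.
  have : P * (y * c) <= P * (y ^+ 2 * c).
    rewrite ler_wpM2l ?(ltW P0)// ler_wpM2r// expr2; nra.
  lra.
apply: (le_trans (lerD IH cm)); rewrite -mulrDr le_eqVlt; apply/orP; left.
by apply/eqP; congr (_ * _); ring.
Qed.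

Lemma sum_ferr M x : \sum_(j < M) ferr j x =
  int01 (fun t => (G 0 x - G 0 t) * fker M (x - t)).
Proof.
have -> : (fun t => (G 0 x - G 0 t) * fker M (x - t)) =
   fun t => \sum_(j < M) (G 0 x * dker j (x - t) - G 0 t * dker j (x - t)).
  apply/funext => t; rewrite /fker mulr_sumr; apply: eq_bigr => j _; ring.
have lx j : lipb (fun t => G 0 x * dker j (x - t)) by apply: lipbZ; exact: lipb_dker.
have ly j := lipb_Gdker j x.
rewrite int01_sum; last by move=> j; apply: lipbB; [exact: lx|exact: ly].
apply: eq_bigr => j _; rewrite (int01B (lx j) (ly j)).
by rewrite int01Z; [rewrite int01_dker mulr1|exact: lipb_dker].
Qed.

(** Since the kernel [F] is nonnegative, the arithmetic-geometric inequality
    [|u| F <= lam / 2 * F + u ^ 2 * F / (2 * lam)] applies to the increment [u] of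
    [G 0].  The first term has integral [lam / 2 * M]; in the second,
    [u ^ 2] is at most a multiple of [1 - cos], which [F] turns into a bounded
    function. *)
Lemma sum_ferr_le x : exists2 C : R, 0 <= C & forall M lam, 0 < lam ->
  `|\sum_(j < M) ferr j x| <= lam / 2 * M%:R + C / lam.
Proof.
have [L L0 [_ GL]] := chain_lipb 0.
exists (L ^+ 2); first by rewrite sqr_ge0.
move=> M lam lam0; rewrite sum_ferr.
have phi t : (G 0 x - G 0 t) ^+ 2 <= L ^+ 2 * (1 - cos (angfreq 1 * (x - t))).
  have [k kv] := near_int (x - t).
  have -> : cos (angfreq 1 * (x - t)) = cos (angfreq 1 * (x - t - k%:~R)).
    rewrite -mulrNz.
    rewrite (@periodic_int _ (fun u => cos (angfreq 1 * u)))// => u.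
    by rewrite -[RHS](cos_nat _ 1); congr cos; rewrite /angfreq; ring.
  rewrite -(periodic_int (Gp 0) k t).
  apply: (@le_trans _ _ (L ^+ 2 * (x - t - k%:~R) ^+ 2)); last first.
    by rewrite ler_wpM2l ?sqr_ge0// one_sub_cos_ge.
  rewrite -exprMn -[leLHS]real_normK ?num_real// -[leRHS]real_normK ?num_real//.
  rewrite lerXn2r ?nnegrE// normrM (ger0_norm L0).
  by have := GL x (t + k%:~R); rewrite opprD addrA.
have lF := lipb_fker M x.
have lh : lipb (fun t => (G 0 x - G 0 t) * fker M (x - t)).
  by apply: lipbM => //; apply: lipbB; [exact: lipb_cst|exact: chain_lipb].
have lu : lipb (fun t => lam / 2 * fker M (x - t) + L ^+ 2 / lam).
  by apply: lipbD; [exact: lipbZ|exact: lipb_cst].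
have Iu : int01 (fun t => lam / 2 * fker M (x - t) + L ^+ 2 / lam) =
    lam / 2 * M%:R + L ^+ 2 / lam.
  rewrite int01D; [|exact: lipbZ|exact: lipb_cst].
  by rewrite (int01Z _ lF) int01_fker int01_cst.
have key a t : a ^+ 2 = 1 ->
    a * ((G 0 x - G 0 t) * fker M (x - t)) <= lam / 2 * fker M (x - t) + L ^+ 2 / lam.
  move=> a2; set p := G 0 x - G 0 t; set F := fker M (x - t).
  have F0 : 0 <= F by exact: fker_ge0.
  have pF : p ^+ 2 * F <= 2 * L ^+ 2.
    apply: (@le_trans _ _ (L ^+ 2 * (1 - cos (angfreq 1 * (x - t))) * F)).
      apply: ler_wpM2r => //; exact: phi.
    rewrite -mulrA [2 * _]mulrC ler_wpM2l ?sqr_ge0// mulrC; exact: fker_le.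
  have sq : 0 <= (lam - a * p) ^+ 2 * F by rewrite mulr_ge0// sqr_ge0.
  have e1 : (lam - a * p) ^+ 2 * F =
      lam ^+ 2 * F - 2 * lam * (a * (p * F)) + a ^+ 2 * (p ^+ 2 * F) by ring.
  rewrite {}e1 a2 mul1r in sq.
  rewrite -(ler_pM2l lam0) mulrDr (_ : lam * (L ^+ 2 / lam) = L ^+ 2);
    last by field; rewrite gt_eqF.
  have -> : lam * (lam / 2 * F) = lam ^+ 2 * F / 2 by field.
  lra.
rewrite ler_norml -Iu; apply/andP; split; last first.
  apply: le_int01 => // t; rewrite -[leLHS]mul1r; apply: key; exact: expr1n.
rewrite lerNl -[leLHS]mulN1r -int01Z//; apply: le_int01 => //; first exact: lipbZ.
by move=> t; apply: key; rewrite sqrrN expr1n.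
Qed.

(** A Cauchy sequence has the limit of its averages, here zero.  The first [N]
    terms of the average are bounded by the crude estimate [4 * K] and disappear
    when [M] tends to infinity. *)
Lemma ferr_le N s (x K : R) : (forall t, `|G (2 * s.+1) t| <= K) ->
  `|ferr N x| <= 4 * K / N.+1%:R ^+ (2 * s).
Proof.
move=> GK; have K0 : 0 <= K by exact: le_trans (GK 0).
set D := _ / _; apply/ler_addgt0Pr => e e0.
have D0 : 0 <= D by rewrite mulr_ge0 ?mulr_ge0// invr_ge0 exprn_ge0.
have [C C0 sumC] := sum_ferr_le x.
have [M M0 Mbig] : exists2 M : nat, 0 < M%:R :> R & C / e + 4 * K * N%:R <= e / 2 * M%:R.
  exists (Num.truncn ((C / e + 4 * K * N%:R) / (e / 2))).+1; first by rewrite ltr0n.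
  by rewrite [leRHS]mulrC -ler_pdivrMr ?divr_gt0//; apply/ltW/truncnS_gt.
rewrite -(ler_pM2l M0).
have -> : M%:R * `|ferr N x| = `|\sum_(j < M) ferr N x|.
  by rewrite sumr_const card_ord -[ferr N x *+ M]mulr_natl normrM normr_nat.
have -> : \sum_(j < M) ferr N x = \sum_(j < M) ferr j x + \sum_(j < M) (ferr N x - ferr j x).
  by rewrite -big_split/=; apply: eq_bigr => j _; rewrite addrC subrK.
have tail : `|\sum_(j < M) (ferr N x - ferr j x)| <= 4 * K * N%:R + D * M%:R.
  apply: (le_trans (ler_norm_sum _ _ _)).
  apply: (@le_trans _ _ (\sum_(j < M) ((4 * K) * (j < N)%N%:R + D))).
    apply: ler_sum => j _; have [jN|Nj] := ltnP j N; last first.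
      by rewrite mulr0 add0r; exact: ferr_cauchy.
    rewrite mulr1 distrC (le_trans (ferr_cauchy x GK (ltnW jN)))//.
    rewrite -[leLHS]addr0 lerD// ler_piMr ?mulr_ge0//.
    by rewrite invf_le1 ?exprn_gt0// exprn_ege1// ler1n.
  rewrite big_split/= -mulr_sumr sumr_const card_ord -[D *+ M]mulr_natr lerD2r.
  rewrite ler_wpM2l ?mulr_ge0// -natr_sum ler_nat.
  rewrite -(big_mkord xpredT (fun j => nat_of_bool (j < N)%N)).
  apply: (@leq_trans (minn M N)); last exact: geq_minr.
  elim: M {M0 Mbig} => [|m IH]; first by rewrite big_nil.
  rewrite big_nat_recr//=; case: (ltnP m N) => mN; last first.
    by rewrite addn0 (leq_trans IH)// leq_min geq_minr (leq_trans (geq_minl _ _)).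
  by move: IH; rewrite (minn_idPl mN) (minn_idPl (ltnW mN)) addn1.
rewrite (le_trans (ler_normD _ _))//.
apply: (le_trans (lerD (sumC M e e0) tail)).
lra.
Qed.

End Chain.
End Fourier1.

(** * Rate of convergence of Fourier sums on the torus *)

Section FourierN.
Context {R : realType}.
Notation mu := (@lebesgue_measure R).

Definition tprod n (g : 'I_n -> R -> R) (z : 'rV[R]_n) : R := \prod_j g j (z 0 j).

Lemma lipb_prod (V : normedModType R) (I : Type) (s : seq I) (f : I -> V -> R) :
  (forall i, lipb (f i)) -> lipb (fun x => \prod_(i <- s) f i x).
Proof.
move=> lf; elim: s => [|i s IH].
  rewrite (_ : (fun x => _) = fun=> 1); first exact: lipb_cst.
  by apply/funext => x; rewrite big_nil.
rewrite (_ : (fun x => _) = fun x => f i x * \prod_(i <- s) f i x).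
  exact: lipbM.
by apply/funext => x; rewrite big_cons.
Qed.

Lemma lipb_coord n (g : R -> R) (j : 'I_n) : lipb g -> lipb (fun z : 'rV[R]_n => g (z 0 j)).
Proof.
move=> [C C0 [gC gL]]; exists C => //; split=> [x|x y]; first exact: gC.
apply: (le_trans (gL _ _)); rewrite ler_wpM2l//.
by have := norm_coord (x - y) j; rewrite !mxE.
Qed.

Lemma lipb_tprod n (g : 'I_n -> R -> R) : (forall j, lipb (g j)) -> lipb (tprod g).
Proof. by move=> lg; apply: lipb_prod => j; exact: lipb_coord. Qed.

Lemma lipb_reflect (V : normedModType R) (f : V -> R) (x : V) : lipb f ->
  lipb (fun y => f (x - y)).
Proof.
move=> [C C0 [fC fL]]; exists C => //; split=> [y|y z]; first exact: fC.
have -> : `|y - z| = `|(x - y) - (x - z)|; last exact: fL.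
by rewrite [in RHS]opprB [in RHS]addrC subrKA distrC.
Qed.

Lemma is_derive_tprod n (g : 'I_n -> R -> R) (g' : R -> R) (i : 'I_n) (z : 'rV[R]_n) :
  is_derive (z 0 i) 1 (g i) (g' (z 0 i)) ->
  is_derive z (vec i) (tprod g) (tprod (fun j => if j == i then g' else g j) z).
Proof.
move=> dg.
set P := \prod_(j < n | j != i) g j (z 0 j).
have E (h : R) : tprod g (h *: vec i + z) = P * g i (h + z 0 i).
  rewrite /tprod (bigD1 i)//= mulrC; congr (_ * _).
    by apply: eq_bigr => j ji; rewrite !mxE (negbTE ji) andbF mulr0 add0r.
  by rewrite !mxE !eqxx mulr1.
have -> : tprod (fun j => if j == i then g' else g j) z = P * g' (z 0 i).
  rewrite /tprod (bigD1 i)//= eqxx mulrC; congr (_ * _).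
  by apply: eq_bigr => j /negbTE ->.
have dPg : is_derive (z 0 i) 1 (P \*: g i) (P * g' (z 0 i)) by apply: is_derive_eq.
have [dd de] := dPg.
have EE : (fun h : R => h^-1 *: (tprod g (h *: vec i + z) - tprod g z)) =
   (fun h : R => h^-1 *: ((P \*: g i) (h *: 1 + z 0 i) - (P \*: g i) (z 0 i))).
  apply/funext => h; congr (_ *: (_ - _)); first by rewrite E /= [h *: 1]mulr1.
  by have := E 0; rewrite scale0r !add0r.
by apply: DeriveDef; [rewrite /derivable EE|rewrite /derive EE].
Qed.

Definition pker n (N : nat) (z : 'rV[R]_n) : R := tprod (fun=> dker N) z.

Definition dker' (N : nat) (t : R) : R :=
  - 2 * \sum_(l < N) angfreq l.+1 * sin (angfreq l.+1 * t).

Lemma is_derive_dker N (t : R) : is_derive t 1 (dker N) (dker' N t).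
Proof.
elim: N => [|N IH].
  have -> : dker 0 = cst (1 : R).
    by apply/funext => u; rewrite /dker big_ord0 mulr0 addr0.
  by rewrite /dker' big_ord0 mulr0; exact: is_derive_cst.
set w : R := angfreq N.+1.
have -> : dker N.+1 = dker N + 2 \*: (fun u => cos (w * (0 - u))).
  apply/funext => u; rewrite /dker big_ord_recr/= !fctE mulrDr addrA; congr (_ + _).
  by rewrite [RHS]/( _ *: _) sub0r mulrN cosN.
have dc := is_derive_cosw w 0 t.
apply: is_derive_eq.
rewrite /dker' big_ord_recr/= [RHS]mulrDr; congr (_ + _).
by rewrite (_ : forall a b : R, a *: b = a * b)// sub0r mulrN sinN -/w; ring.
Qed.

Lemma lipb_dker0 N : lipb (dker N : R -> R).
Proof.
have := lipb_reflect 0 (lipb_dker N 0).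
by congr lipb; apply/funext => t; rewrite opprB addrC subrK.
Qed.

Lemma lipb_dker' N : lipb (dker' N : R -> R).
Proof.
apply: lipbZ; apply: lipb_sum => l; apply: lipbZ.
have := lipb_reflect 0 (lipb_sinw (angfreq l.+1) 0).
by congr lipb; apply/funext => t; rewrite opprB addrC subrK.
Qed.

Lemma lipb_pker N n : lipb (pker N : 'rV[R]_n -> R).
Proof. by apply: (@lipb_tprod n (fun=> dker N)) => j; exact: lipb_dker0. Qed.

Lemma dker_le N (t : R) : `|dker N t| <= (2 * N + 1)%:R.
Proof.
rewrite /dker (le_trans (ler_normD _ _))// normr1 natrD addrC lerD2r natrM normrM.
rewrite ger0_norm// ler_wpM2l//.
rewrite (le_trans (ler_norm_sum _ _ _))// (@le_trans _ _ (\sum_(l < N) 1))//.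
  by apply: ler_sum => l _; exact: cos_max.
by rewrite sumr_const card_ord.
Qed.

Lemma dker_per N (t : R) : dker N (t + 1) = dker N t.
Proof.
congr (1 + 2 * _); apply: eq_bigr => l _.
by rewrite -[RHS](cos_nat _ l.+1); congr cos; rewrite /angfreq; ring.
Qed.

Lemma pker_per N n : periodic (pker N : 'rV[R]_n -> R).
Proof.
move=> z k kZ; apply: eq_bigr => j _; rewrite mxE.
have /intrP[m ->] := kZ j.
by apply: periodic_int; exact: dker_per.
Qed.

(** By [fourier_projE] this is the Fourier projection; the real kernel makes
    complex functions unnecessary in the estimates. *)
Definition dproj n (N : nat) (f : 'rV[R]_n -> R) (x : 'rV[R]_n) : R :=
  intLeb (fun y => f y * pker N (x - y)).

Lemma lipb_dproj_int N n (f : 'rV[R]_n -> R) x : lipb f ->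
  lipb (fun y => f y * pker N (x - y)).
Proof. by move=> lf; apply: lipbM => //; apply: lipb_reflect; exact: lipb_pker. Qed.

Lemma pker_row_mx N n (t s : R) (x y : 'rV[R]_n) :
  pker N (row_mx (t%:M : 'M[R]_1) x - row_mx (s%:M : 'M[R]_1) y : 'rV[R]_(1 + n)) =
  dker N (t - s) * pker N (x - y).
Proof.
rewrite /pker /tprod big_split_ord/= big_ord1; congr (_ * _).
  by rewrite mxE [X in _ + X]mxE !row_mxEl !mxE eqxx !mulr1n.
by apply: eq_bigr => j _; rewrite mxE [X in _ + X]mxE !row_mxEr !mxE.
Qed.

Lemma dproj_slice N n (f : 'rV[R]_n.+1 -> R) (t s : R) (x : 'rV[R]_n) : lipb f ->
  intLeb (slice (fun y => f y * pker N ((row_mx (t%:M : 'M[R]_1) x : 'rV[R]_n.+1) - y)) s) =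
  dker N (t - s) * dproj N (slice f s) x.
Proof.
move=> lf; rewrite /dproj -intLebZ; last by apply: lipb_dproj_int; exact: lipb_slice.
congr intLeb; apply/funext => y; rewrite /slice.
by rewrite (pker_row_mx N t s x y); ring.
Qed.

(** One coordinate at a time: the error in the first coordinate is controlled by
    the one-dimensional estimate, and the projection in that coordinate enlarges
    the error made in the others by at most [2 N + 1]. *)
Lemma dproj_err N s n (f : 'rV[R]_n -> R) (H : 'I_n -> nat -> 'rV[R]_n -> R) (K : R) :
  0 <= K -> lipb f -> (forall j, H j 0 = f) ->
  (forall j i (x : 'rV[R]_n), is_derive x (vec j) (H j i) (H j i.+1 x)) ->
  (forall j i (x : 'rV[R]_n), H j i (x + vec j) = H j i x) ->
  (forall j i, exists C, forall x, `|H j i x| <= C) ->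
  (forall j x, `|H j (2 * s.+1) x| <= K) ->
  forall x, `|f x - dproj N f x| <=
    4 * K / N.+1%:R ^+ (2 * s) * \sum_(i < n) (2 * N + 1)%:R ^+ i.
Proof.
move=> K0; elim: n f H => [|n IH] f H lf H0 Hd Hp Hb HK x.
  have -> : dproj N f x = f 0.
    by rewrite /dproj /intLeb /= /pker /tprod big_ord0 mulr1.
  have -> : x = 0 by apply/rowP => -[].
  by rewrite subrr normr0 big_ord0 mulr0.
set D := 4 * K / _ in IH *.
have D0 : 0 <= D by rewrite mulr_ge0 ?mulr_ge0// invr_ge0 exprn_ge0.
pose t0 := x 0 ord0.
pose y : 'rV[R]_n := \row_j x 0 (rshift 1 j).
have xE : x = row_mx (t0%:M : 'M[R]_1) y.
  apply/(@rowP _ (1 + n)) => j; case: (@split_ordP 1 n j) => k ->.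
    by rewrite row_mxEl mxE (ord1 k) eqxx mulr1n; congr (x 0 _); exact: val_inj.
  by rewrite row_mxEr mxE.
pose G i t := H ord0 i (row_mx (t%:M : 'M[R]_1) y).
have o0 : ord0 = lshift n (ord0 : 'I_1) :> 'I_(1 + n) by exact: val_inj.
have Gd i (t : R) : is_derive t 1 (G i) (G i.+1 t).
  by apply: (@slice_path0 _ _ (H ord0 i)); rewrite -o0; exact: Hd.
have Gp i t : G i (t + 1) = G i t.
  rewrite /G -[RHS]Hp; congr (H _ _ _); rewrite [in RHS]o0.
  exact/esym/row_mx_vec0.
have Gb i : exists C, forall t, `|G i t| <= C.
  by have [C HC] := Hb ord0 i; exists C => t; exact: HC.
have GK t : `|G (2 * s.+1)%N t| <= K by exact: HK.
have first_err := ferr_le Gd Gp Gb N t0 GK.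
have G0E : G 0 = fun t => slice f t y by rewrite /G H0.
have lF := lipb_dproj_int N x lf.
have projE : dproj N f x = int01 (fun t => dker N (t0 - t) * dproj N (slice f t) y).
  rewrite /dproj intLebE; apply: eq_Rintegral => t _.
  by rewrite -(dproj_slice N t0 t y lf) -xE.
have lproj : lipb (fun t => dker N (t0 - t) * dproj N (slice f t) y).
  have [C C0 [_ FL]] := lF.
  have [C' C'0 [FC _]] := lF.
  exists (Num.max C C'); first by rewrite le_max C0.
  split=> [t|t u].
    rewrite -(dproj_slice N t0 t y lf) -xE.
    by rewrite intLeb_le// ?le_max ?C0// => z; rewrite le_max FC orbT.
  rewrite -!(dproj_slice N t0 _ y lf) -xE.
  by rewrite (le_trans (intLeb_slice_lip lF FL C0 t u))// ler_wpM2r// le_max lexx.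
have lsl : lipb (fun t => dker N (t0 - t) * slice f t y).
  apply: lipbM; first exact: lipb_dker.
  by have := chain_lipb Gd Gb 0; rewrite G0E.
rewrite projE.
have -> : f x - int01 (fun t => dker N (t0 - t) * dproj N (slice f t) y) =
    ferr G N t0 + int01 (fun t => dker N (t0 - t) * (slice f t y - dproj N (slice f t) y)).
  rewrite (_ : (fun t => dker N (t0 - t) * (_ - _)) =
    fun t => dker N (t0 - t) * slice f t y - dker N (t0 - t) * dproj N (slice f t) y).
    2: by apply/funext => t; rewrite mulrBr.
  rewrite (int01B lsl lproj) /ferr G0E.
  rewrite [in RHS](_ : (fun t => slice f t y * _) =
    fun t => dker N (t0 - t) * slice f t y); last first.
    by apply/funext => t; rewrite mulrC.
  rewrite (_ : slice f t0 y = f x); last by rewrite [in RHS]xE.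
  by ring.
rewrite (le_trans (ler_normD _ _))// big_ord_recl expr0 mulrDr mulr1 lerD//.
have S0 : 0 <= \sum_(i < n) (2 * N + 1)%:R ^+ i :> R.
  by apply: sumr_ge0 => i _; rewrite exprn_ge0.
apply: (@le_trans _ _ ((2 * N + 1)%:R * (D * \sum_(i < n) (2 * N + 1)%:R ^+ i))).
  apply: int01_bound => [|t]; first by rewrite !mulr_ge0.
  rewrite normrM ler_pM// ?dker_le//.
  apply: (IH (slice f t) (fun j i => slice (H (rshift 1 j) i) t)).
  - exact: lipb_slice.
  - by move=> j; rewrite H0.
  - by move=> j i z; apply: slice_path1; exact: Hd.
  - by move=> j i z; rewrite /slice -[RHS]Hp; congr (H _ _ _); rewrite row_mx_vec1.
  - by move=> j i; have [C HC] := Hb (rshift 1 j) i; exists C => z; exact: HC.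
  - by move=> j z; exact: HK.
rewrite mulrCA ler_wpM2l// mulr_sumr le_eqVlt; apply/orP; left; apply/eqP.
by apply: eq_bigr => i _; rewrite -exprS.
Qed.

(** The geometric sum of [dproj_err] grows like [N ^ (n - 1)], which the rate
    [N ^ - (2 n)] of the one-dimensional estimate outweighs. *)
Lemma dproj_err_rate N n (f : 'rV[R]_n -> R) (H : 'I_n -> nat -> 'rV[R]_n -> R) (K : R) :
  0 <= K -> lipb f -> (forall j, H j 0 = f) ->
  (forall j i (x : 'rV[R]_n), is_derive x (vec j) (H j i) (H j i.+1 x)) ->
  (forall j i (x : 'rV[R]_n), H j i (x + vec j) = H j i x) ->
  (forall j i, exists C, forall x, `|H j i x| <= C) ->
  (forall j x, `|H j (2 * n.+1) x| <= K) ->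
  forall x, `|f x - dproj N f x| <= 4 * n%:R * 2 ^+ n * K / N.+1%:R.
Proof.
move=> K0 lf H0 Hd Hp Hb HK x.
apply: (le_trans (dproj_err N (s := n) K0 lf H0 Hd Hp Hb HK x)).
set y : R := N.+1%:R; have y1 : 1 <= y by rewrite ler1n.
have y0 : 0 < y by lra.
case: n => [|n] in f H lf H0 Hd Hp Hb HK x *.
  by rewrite big_ord0 mulr0 mulr0 !mul0r.
have S : \sum_(i < n.+1) (2 * N + 1)%:R ^+ i <= n.+1%:R * 2 ^+ n.+1 * y ^+ n.+1 :> R.
  apply: (@le_trans _ _ (\sum_(i < n.+1) (2 * y) ^+ n.+1)); last first.
    by rewrite sumr_const card_ord exprMn -[leLHS]mulr_natl mulrA.
  apply: ler_sum => i _; have z1 : 1 <= 2 * y by lra.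
  apply: (@le_trans _ _ ((2 * y) ^+ i)); last first.
    by rewrite ler_weXn2l// ltnW.
  rewrite lerXn2r ?nnegrE ?ler0n//; first by lra.
  by rewrite /y natrD natrM -natr1; lra.
apply: (le_trans (ler_wpM2l _ S)).
  by rewrite mulr_ge0 ?mulr_ge0// invr_ge0 exprn_ge0// ltW.
have -> : y ^+ (2 * n.+1) = y ^+ n.+1 * y ^+ n * y.
  by rewrite mul2n -addnn exprD -mulrA -exprSr.
have Y0 : y ^+ n != 0 by rewrite expf_neq0// gt_eqF.
have Y1 : y ^+ n.+1 != 0 by rewrite expf_neq0// gt_eqF.
have -> : 4 * K / (y ^+ n.+1 * y ^+ n * y) * (n.+1%:R * 2 ^+ n.+1 * y ^+ n.+1) =
  4 * n.+1%:R * 2 ^+ n.+1 * K / y * (y ^+ n)^-1.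
  by field; rewrite Y0 Y1 gt_eqF.
rewrite ler_piMr// ?invf_le1 ?exprn_gt0 ?exprn_ege1//.
by rewrite mulr_ge0 ?invr_ge0 ?(ltW y0)// !mulr_ge0// exprn_ge0.
Qed.

End FourierN.

(** * Fourier sums and differentiation *)

Section Smooth.
Context {R : realType}.

Lemma iterD_cat (V W : normedModType R) (vs us : seq V) (f : V -> W) :
  iterD (vs ++ us) f = iterD vs (iterD us f).
Proof. by rewrite /iterD foldr_cat. Qed.

Lemma Cs_on_natP (V W : normedModType R) (k : nat) (O : set V) (f : V -> W) :
  Cs_on k%:R O f <->
  (forall vs x, O x -> (size vs <= k)%N -> {for x, continuous (iterD vs f)}) /\
  (forall vs v x, O x -> (size vs < k)%N -> derivable (iterD vs f) x v).
Proof.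
rewrite /Cs_on natrK; split=> [[fc fd _]//|[fc fd]].
by split=> //; rewrite ltxx.
Qed.

Lemma Cinf_onP (V W : normedModType R) (O : set V) (f : V -> W) :
  Cinf_on O f <->
  (forall vs x, O x -> {for x, continuous (iterD vs f)}) /\
  (forall vs v x, O x -> derivable (iterD vs f) x v).
Proof.
split=> [fi|[fc fd] k]; last first.
  by apply/Cs_on_natP; split=> [vs x Ox _|vs v x Ox _]; [exact: fc|exact: fd].
split=> [vs x Ox|vs v x Ox].
  by have /Cs_on_natP[fc _] := fi (size vs); exact: fc.
by have /Cs_on_natP[_ fd] := fi (size vs).+1; exact: fd.
Qed.

Lemma derive_translate (V W : normedModType R) (f : V -> W) (k x v : V) :
  (forall y, f (y + k) = f y) -> 'D_v f (x + k) = 'D_v f x.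
Proof.
move=> fk; rewrite /derive.
have -> : (fun h : R => h^-1 *: (f (h *: v + (x + k)) - f (x + k))) =
   (fun h : R => h^-1 *: (f (h *: v + x) - f x)); last by [].
by apply/funext => h; rewrite addrA !fk.
Qed.

Lemma iterD_lin (V : normedModType R) (O : set V) (f g : V -> R) (a : R) vs :
  open O ->
  (forall vs v x, O x -> derivable (iterD vs f) x v) ->
  (forall vs v x, O x -> derivable (iterD vs g) x v) ->
  forall x, O x ->
  iterD vs (fun x => a * f x + g x) x = a * iterD vs f x + iterD vs g x.
Proof.
move=> oO df dg; elim: vs => [//|v vs IH] x Ox /=.
transitivity ('D_v (a \*: iterD vs f + iterD vs g) x).
  apply: near_eq_derive; near=> y.
  by apply: IH; near: y; exact: (open_nbhs_nbhs (conj oO Ox)).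
rewrite deriveD; [|exact: derivableZ (df _ _ _ Ox)|exact: dg].
by rewrite deriveZ; [|exact: df].
Unshelve. all: by end_near. Qed.

Context {n : nat}.
Implicit Types f g : 'rV[R]_n -> R.

Definition smooth f := [/\ periodic f, Cinf_on setT f &
  forall vs, exists C, forall x, `|iterD vs f x| <= C].

Lemma smoothD f : smooth f -> forall vs v x, derivable (iterD vs f) x v.
Proof. by move=> [_ /Cinf_onP[_ fd] _] vs v x; exact: fd. Qed.

Arguments smoothD [f] _ vs v x.

Lemma smooth_iterD f us : smooth f -> smooth (iterD us f).
Proof.
move=> [fp /Cinf_onP[fc fd] fb]; split.
- elim: us => [//|u us IH] x k kZ /=; apply: derive_translate => y.
  exact: IH.
- by apply/Cinf_onP; split=> [vs|vs v] x _; rewrite -iterD_cat; [exact: fc|exact: fd].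
- by move=> vs; rewrite -iterD_cat.
Qed.

Lemma smooth_lin a f g : smooth f -> smooth g -> smooth (fun x => a * f x + g x).
Proof.
move=> sf sg; have [fp /Cinf_onP[fc fd] fb] := sf; have [gp /Cinf_onP[gc gd] gb] := sg.
have E vs : iterD vs (fun x => a * f x + g x) = fun x => a * iterD vs f x + iterD vs g x.
  by apply/funext => x; exact: (iterD_lin a vs openT fd gd).
split.
- by move=> x k kZ; rewrite fp// gp.
- apply/Cinf_onP; split=> [vs x _|vs v x _]; rewrite E.
    apply: (@cvgD _ _ _ (nbhs x)); [apply: (@cvgM _ _ (nbhs x))|]; first exact: cvg_cst.
      exact: fc.
    exact: gc.
  apply: (@derivableD _ _ _ (a \*: iterD vs f)); last exact: gd.
  exact: derivableZ (fd _ _ _ I).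
- move=> vs; have [C fC] := fb vs; have [C' gC] := gb vs.
  exists (`|a| * C + C') => x; rewrite E (le_trans (ler_normD _ _))// lerD//.
  by rewrite normrM ler_wpM2l.
Qed.

(** Uniform bounds on the partial derivatives give a global Lipschitz constant. *)
Lemma smooth_lipb f : smooth f -> lipb f.
Proof.
move=> sf; have [_ _ fb] := sf.
have [c cP] := choice (fun i : 'I_n => fb [:: vec i]).
have [C0 fC] := fb [::].
have S0 : 0 <= \sum_i `|c i| by apply: sumr_ge0.
have C00 : 0 <= C0 by apply: le_trans (fC 0).
exists (Num.max C0 (n%:R * \sum_i `|c i|)); first by rewrite le_max C00.
split=> [x|x y]; first by rewrite le_max fC.
apply: (@le_trans _ _ (n%:R * (\sum_i `|c i|) * `|x - y|)); last first.
  by rewrite ler_wpM2r// le_max lexx orbT.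
apply: (@coord_MVT _ _ f x (`|y - x| + 1)) => //.
- move=> z i _; split; first exact: (smoothD sf [::]).
  apply: (le_trans (cP i z)); rewrite (bigD1 i)//= (le_trans (ler_norm _))// lerDl.
  by apply: sumr_ge0.
- by rewrite subrr normr0 ltr_wpDl.
- by rewrite ltrDl.
Qed.

Lemma smooth_dir f v : smooth f ->
  'D_v f = fun x => \sum_i v 0 i * 'D_(vec i) f x.
Proof.
move=> sf; apply/funext => x.
have [_ /Cinf_onP[fc fd] _] := sf.
have [|i|_ ->//] := @C1_differentiable _ _ f x.
  by near=> y => i; exact: (fd [::]).
exact: (fc [:: vec i]).
Unshelve. all: by end_near. Qed.

Lemma vec_Zlat (i : 'I_n) : Zlat (vec i : 'rV[R]_n).
Proof. by move=> k; rewrite vecE; exact: natr_int. Qed.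

Definition pker' (N : nat) (i : 'I_n) : 'rV[R]_n -> R :=
  tprod (fun j => if j == i then dker' N else dker N).

Lemma lipb_pker' N i : lipb (pker' N i).
Proof.
apply: lipb_tprod => j; case: eqP => _; first exact: lipb_dker'.
exact: lipb_dker0.
Qed.

Lemma is_derive_pker N i (z : 'rV[R]_n) : is_derive z (vec i) (pker N) (pker' N i z).
Proof. by apply: (@is_derive_tprod _ _ (fun=> dker N)); exact: is_derive_dker. Qed.

Lemma is_derive_reflect (V : normedModType R) (g : V -> R) (x y v : V) dg :
  is_derive (x - y) v g dg -> is_derive y v (fun y => g (x - y)) (- dg).
Proof.
move=> H.
have {}H : is_derive (x - y) (-1 *: v) g (-1 *: dg).
  by have [d <-] := H; exact: derive_scale.
have [d e] := H.
have EE : (fun h : R => h^-1 *: (g (h *: (-1 *: v) + (x - y)) - g (x - y))) =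
   (fun h : R => h^-1 *: ((fun y => g (x - y)) (h *: v + y) - (fun y => g (x - y)) y)).
  apply/funext => h; congr (_ *: (g _ - _)).
  by rewrite scaleN1r scalerN opprD addrCA.
apply: DeriveDef; first by rewrite /derivable -EE.
by rewrite /derive -EE -[- dg]mulN1r.
Qed.

(** Integration by parts moves the derivative from the kernel to the function. *)
Lemma dproj_parts N i f x : smooth f ->
  intLeb (fun y => f y * pker' N i (x - y)) = dproj N ('D_(vec i) f) x.
Proof.
move=> sf; have lf := smooth_lipb sf.
have sf' := smooth_iterD [:: vec i] sf; have lf' := smooth_lipb sf'.
have [fp _ _] := sf.
have lk := lipb_reflect x (@lipb_pker R N n).
have lk' := lipb_reflect x (lipb_pker' N i).
apply/eqP; rewrite eq_sym -subr_eq0 /dproj -intLebB; [|exact: lipbM|exact: lipbM].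
apply/eqP; apply: (@intLeb_derive _ _ i (fun y => f y * pker N (x - y))).
- exact: lipbM.
- by apply: lipbB; exact: lipbM.
- move=> y; rewrite fp; last exact: vec_Zlat.
  rewrite opprD addrA -[in RHS](@pker_per _ N _ (x - y) (- vec i))// => k.
  by rewrite mxE rpredN; exact: vec_Zlat.
- move=> y.
  have d1 : is_derive y (vec i) f ('D_(vec i) f y) by apply: derivableP; exact: (smoothD sf [::]).
  have d2 := is_derive_reflect (is_derive_pker N i (x - y)).
  have -> : (fun y => f y * pker N (x - y)) = f * (fun y => pker N (x - y)) by [].
  apply: is_derive_eq.
  by rewrite !(_ : forall a b : R, a *: b = a * b)//; ring.
Qed.

Lemma is_derive_dproj N i f x : smooth f ->
  is_derive x (vec i) (dproj N f) (dproj N ('D_(vec i) f) x).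
Proof.
move=> sf; have lf := smooth_lipb sf; have [Cf Cf0 [fC _]] := lf.
have lk := @lipb_pker R N n.
have lk' := lipb_pker' N i; have [Ck Ck0 [_ kL]] := lk'.
rewrite -dproj_parts//.
have H : is_derive (0 : R) 1 (fun s : R => intLeb (fun y => f y * pker N (x + s *: vec i - y)))
    (intLeb (fun y => f y * pker' N i (x + (0 : R) *: vec i - y))).
  apply: (@is_derive_intLeb _ _ (fun (s : R) y => f y * pker N (x + s *: vec i - y))
    (fun (s : R) y => f y * pker' N i (x + s *: vec i - y)) (Cf * Ck)).
  - by rewrite mulr_ge0.
  - by move=> t; apply: lipbM => //; exact: lipb_reflect.
  - by move=> t; apply: lipbM => //; exact: lipb_reflect.
  - move=> t y.
    have : is_derive (x - y + t *: vec i) (vec i) (pker N) (pker' N i (x + t *: vec i - y)).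
      by rewrite addrAC; exact: is_derive_pker.
    move=> /is_derive_path d.
    rewrite (_ : (fun s => _) = f y \*: (fun s => pker N (x - y + s *: vec i))).
      exact: is_deriveZ.
    by apply/funext => s; rewrite [X in pker N X]addrAC.
  - move=> t s y; rewrite -mulrBr normrM -mulrA ler_pM//.
    apply: (le_trans (kL _ _)); rewrite ler_wpM2l//.
    have -> : x + t *: vec i - y - (x + s *: vec i - y) = (t - s) *: vec i.
      by rewrite opprB subrKA opprD addrACA subrr add0r scalerBl.
    rewrite normrZ ler_piMr//; apply: norm_coord_le => // k.
    by rewrite vecE; case: eqP => _; rewrite ?normr1 ?normr0.
move: H; rewrite scale0r addr0 => -[d e].
have EE : (fun h : R => h^-1 *: (dproj N f (h *: vec i + x) - dproj N f x)) =
   (fun h : R => h^-1 *: (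
     (fun s : R => intLeb (fun y => f y * pker N (x + s *: vec i - y))) (h *: 1 + 0)
     - (fun s : R => intLeb (fun y => f y * pker N (x + s *: vec i - y))) 0)).
  apply/funext => h; rewrite /dproj [h *: 1]mulr1 addr0 scale0r addr0.
  by rewrite [h *: vec i + x]addrC.
by apply: DeriveDef; [rewrite /derivable EE|rewrite /derive EE].
Qed.

Lemma lipb_dproj N f : lipb f -> lipb (dproj N f).
Proof.
move=> lf; have [Cf Cf0 [fC _]] := lf.
have [Ck Ck0 [kC kL]] := @lipb_pker R N n.
exists (Cf * Ck); first by rewrite mulr_ge0.
split=> [x|x x'].
  by apply: intLeb_le => [|y]; rewrite ?mulr_ge0// normrM ler_pM.
rewrite /dproj -intLebB; [|exact: lipb_dproj_int|exact: lipb_dproj_int].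
apply: intLeb_le => [|y]; first by rewrite !mulr_ge0.
rewrite -mulrBr normrM -mulrA ler_pM//.
by have := kL (x - y) (x' - y); rewrite opprB addrA subrK.
Qed.

Lemma lipb_continuous (V : normedModType R) (f : V -> R) : lipb f -> continuous f.
Proof.
move=> [C C0 [_ fL]] x; apply/cvgrPdist_le => e e0; near=> y.
apply: (le_trans (fL _ _)).
apply: (@le_trans _ _ ((C + 1) * `|x - y|)); first by rewrite ler_wpM2r// lerDl.
rewrite -ler_pdivlMl ?ltr_wpDl//; near: y.
by apply: cvgr_dist_le => //; rewrite mulr_gt0// invr_gt0 ltr_wpDl.
Unshelve. all: by end_near. Qed.

Lemma dproj_lin N a f g : lipb f -> lipb g ->
  dproj N (fun y => a * f y + g y) = fun x => a * dproj N f x + dproj N g x.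
Proof.
move=> lf lg; apply/funext => x; rewrite /dproj -intLeb_linear;
  [|exact: lipb_dproj_int|exact: lipb_dproj_int].
by congr intLeb; apply/funext => y; ring.
Qed.

Lemma dproj_sum N (I : Type) (s : seq I) (c : I -> R) (f : I -> 'rV[R]_n -> R) x :
  (forall i, lipb (f i)) ->
  dproj N (fun y => \sum_(i <- s) c i * f i y) x = \sum_(i <- s) c i * dproj N (f i) x.
Proof.
move=> lf; elim: s => [|i s IH].
  rewrite big_nil -[RHS](intLeb_cst n 0); congr intLeb; apply/funext => y.
  by rewrite big_nil mul0r.
rewrite big_cons -IH.
have -> : (fun y => \sum_(i <- i :: s) c i * f i y) =
    fun y => c i * f i y + \sum_(i <- s) c i * f i y.
  by apply/funext => y; rewrite big_cons.
by rewrite dproj_lin//; apply: lipb_sum => k; exact: lipbZ.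
Qed.

(** The partial derivatives are known by [is_derive_dproj] and continuous, so the
    projection is differentiable and every directional derivative follows by
    linearity. *)
Lemma dproj_deriveE N f x v : smooth f ->
  derivable (dproj N f) x v /\ 'D_v (dproj N f) x = dproj N ('D_v f) x.
Proof.
move=> sf.
have [|i|pd ->] := @C1_differentiable _ _ (dproj N f) x.
- by near=> y => i; have [] := is_derive_dproj N i y sf.
- have -> : 'D_(vec i) (dproj N f) = dproj N ('D_(vec i) f).
    by apply/funext => y; have [] := is_derive_dproj N i y sf.
  by apply: lipb_continuous; apply: lipb_dproj; apply: smooth_lipb;
    exact: (smooth_iterD [:: vec i] sf).
split; first exact: diff_derivable.
rewrite (smooth_dir v sf) dproj_sum; last first.
  by move=> i; apply: smooth_lipb; exact: (smooth_iterD [:: vec i] sf).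
by apply: eq_bigr => i _; congr (_ * _); have [] := is_derive_dproj N i x sf.
Unshelve. all: by end_near. Qed.

Lemma iterD_dproj N f vs : smooth f -> iterD vs (dproj N f) = dproj N (iterD vs f).
Proof.
move=> sf; elim: vs => [//|v vs IH] /=; rewrite IH.
apply/funext => x; exact: (dproj_deriveE N x v (smooth_iterD vs sf)).2.
Qed.

Lemma smooth_dproj N f : smooth f -> smooth (dproj N f).
Proof.
move=> sf; split.
- move=> x k kZ; congr intLeb; apply/funext => y.
  by rewrite [X in pker N X]addrAC; congr (_ * _); exact: pker_per.
- apply/Cinf_onP; split=> [vs|vs v] x _; rewrite iterD_dproj//.
    by apply: lipb_continuous; apply: lipb_dproj; apply: smooth_lipb; exact: smooth_iterD.
  by have [] := dproj_deriveE N x v (smooth_iterD vs sf).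
- move=> vs; rewrite iterD_dproj//.
  have [C _ [pC _]] := lipb_dproj N (smooth_lipb (smooth_iterD vs sf)).
  by exists C.
Qed.

Lemma enorm_vec (i : 'I_n) : enorm (vec i : 'rV[R]_n) = 1.
Proof.
rewrite /enorm (bigD1 i)//= big1 => [|j ji]; last by rewrite vecE (negbTE ji) expr0n.
by rewrite addr0 vecE eqxx expr1n sqrtr1.
Qed.

(** [m] derivatives commute with the projection, and the [2 (n + 1)] further ones
    are those required by [dproj_err_rate]. *)
Lemma smooth_dproj_err N f (us : seq 'I_n) (m : nat) K : 0 <= K -> smooth f ->
  Cs_norm_leR (m + 2 * n.+1)%:R setT f K -> (size us <= m)%N ->
  forall x, `|iterD (map (@vec R n) us) f x - iterD (map (@vec R n) us) (dproj N f) x|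
    <= 4 * n%:R * 2 ^+ n * K / N.+1%:R.
Proof.
move=> K0 sf [fK _] um x; rewrite iterD_dproj//.
set g := iterD _ f; have sg : smooth g by exact: smooth_iterD.
have gs j i : smooth (iterD (nseq i (vec j)) g) by exact: smooth_iterD.
apply: (@dproj_err_rate _ N n g (fun j i => iterD (nseq i (vec j)) g) K) => //.
- exact: smooth_lipb.
- by move=> j i y; apply: derivableP; exact: (smoothD (gs j i) [::]).
- by move=> j i y; have [+ _ _] := gs j i; apply; exact: vec_Zlat.
- by move=> j i; have [_ _ /(_ [::])] := gs j i.
- move=> j y; rewrite -iterD_cat; apply: fK => //.
    by rewrite natrK leq0n size_cat size_nseq size_map [leqRHS]addnC leq_add2l.
  move=> v; rewrite mem_cat mem_nseq => /orP[/andP[_ /eqP->]|/mapP[i _ ->]];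
    by rewrite enorm_vec.
Qed.

(** Scaling a direction scales the derivative, so bounds on derivatives along
    short directions bound all the others. *)
Lemma iterD_bound f : (forall vs v x, derivable (iterD vs f) x v) ->
  (forall k : nat, exists K, Cs_norm_leR k%:R setT f K) ->
  forall vs, exists C, forall x, `|iterD vs f x| <= C.
Proof.
move=> fd fK vs.
have [K [fK' _]] := fK (size vs).
have [a a0 Ea] : exists2 us, all (fun v => enorm v <= 1) us /\ size us = size vs &
    exists c, forall x, iterD vs f x = c * iterD us f x.
  elim: vs {fK' K} => [|v vs [us [us1 sz] [c cE]]].
    by exists [::] => //; exists 1 => x; rewrite mul1r.
  have [v0|v0] := eqVneq (enorm v) 0.
    exists (v :: us); first by rewrite /= v0 ler01 us1 sz.
    exists c => x /=.
    transitivity ('D_v (c \*: iterD us f) x); last exact: deriveZ.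
    by congr ('D_v _ x); apply/funext => y; exact: cE.
  have vp : 0 < enorm v by rewrite lt_neqAle eq_sym v0 sqrtr_ge0.
  exists ((enorm v)^-1 *: v :: us).
    rewrite /= us1 sz; split=> //; rewrite andbT.
    have -> : enorm ((enorm v)^-1 *: v) = 1; last by [].
    rewrite {1}/enorm; under eq_bigr do rewrite mxE exprMn.
    rewrite -mulr_sumr sqrtrM ?sqr_ge0// sqrtr_sqr -/(enorm v).
    by rewrite ger0_norm ?invr_ge0 ?ltW// mulVf.
  exists (c * enorm v) => x /=.
  have [_ ->] := derive_scale (enorm v)^-1 (fd us v x).
  rewrite (_ : forall a b : R, a *: b = a * b)// mulrA mulfK//.
  transitivity ('D_v (c \*: iterD us f) x); last exact: deriveZ.
  by congr ('D_v _ x); apply/funext => y; exact: cE.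
have [c cE] := Ea; exists (`|c| * K) => x; rewrite cE normrM ler_wpM2l//.
apply: fK' => //; first by rewrite natrK (proj2 a0) leqnn.
by case: a0 => /allP.
Qed.

Lemma CinfX_smooth f : CinfX f -> (forall k : nat, exists K, Cs_norm_leR k%:R setT f K) ->
  smooth f.
Proof.
move=> [fp fi] fK; split=> //; apply: iterD_bound => // vs v x.
by have /Cinf_onP[_ fd] := fi; exact: fd.
Qed.

(** The Hoelder condition follows from the Lipschitz one, the exponent being at
    most one. *)
Lemma smooth_CsX r f : smooth f -> CsX r f.
Proof.
move=> sf; have [fp /Cinf_onP[fc fd] _] := sf; split=> //; split.
- by move=> vs x _ _; exact: fc.
- by move=> vs v x _ _; exact: fd.
- move=> rt vs x _ _.
  have [C C0 [_ fL]] := smooth_lipb (smooth_iterD vs sf).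
  exists C.
  exists (ball x 2^-1, ball x 2^-1) => /=; first by split; exact: nbhsx_ballx.
  move=> [y z] [/=]; rewrite -ball_normE /= => xy xz.
  apply: (le_trans (fL _ _)); rewrite ler_wpM2l//.
  have yz1 : `|y - z| <= 1.
    have -> : y - z = (x - z) - (x - y) by rewrite [in RHS]opprB [in RHS]addrC subrKA.
    by rewrite (le_trans (ler_normB _ _))//; lra.
  have [->|yz0] := eqVneq y z; first by rewrite subrr normr0 powR_ge0.
  have p0 : 0 < `|y - z| by rewrite normr_gt0 subr_eq0.
  set s := r - _.
  have s0 : 0 < s by rewrite subr_gt0.
  have s1 : s <= 1 by rewrite lerBlDr addrC natr1 ltW// truncnS_gt.
  by apply: ger1_powR => //; rewrite p0.
Qed.

End Smooth.

(** * Complex exponentials and the Dirichlet kernel *)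

Section FourierProjection.
Context {R : realType}.

Lemma lipb_comp (V : normedModType R) (g : R -> R) (phi : V -> R) L : 0 <= L ->
  lipb g -> (forall x y, `|phi x - phi y| <= L * `|x - y|) -> lipb (fun x => g (phi x)).
Proof.
move=> L0 [C C0 [gC gL]] pL; exists (C + C * L); first by rewrite addr_ge0 ?mulr_ge0.
split=> [x|x y]; first by rewrite (le_trans (gC _))// lerDl mulr_ge0.
apply: (le_trans (gL _ _)); apply: (@le_trans _ _ (C * (L * `|x - y|))).
  by rewrite ler_wpM2l.
by rewrite mulrDl mulrA lerDr mulr_ge0.
Qed.

Lemma lipb_cos : lipb (@cos R).
Proof.
apply: (lipb_derive (C := 1) (@is_derive_cos R)); first exact: cos_max.
by move=> t; rewrite normrN sin_max.
Qed.

Lemma lipb_sin : lipb (@sin R).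
Proof.
apply: (lipb_derive (C := 1) (@is_derive_sin R)); first exact: sin_max.
exact: cos_max.
Qed.

Lemma edotE n (x y : 'rV[R]_n) : edot x y = \sum_j x 0 j * y 0 j.
Proof. by rewrite /edot mxE; apply: eq_bigr => j _; rewrite mxE. Qed.

Lemma edotBl n (x y k : 'rV[R]_n) : edot (x - y) k = edot x k - edot y k.
Proof. by rewrite /edot mulmxBl !mxE. Qed.

Lemma phase_lip n (k : 'rV[R]_n) : exists2 L, 0 <= L &
  forall x y, `|2 * pi * - edot x k - 2 * pi * - edot y k| <= L * `|x - y|.
Proof.
have pi0 : 0 <= 2 * pi :> R by rewrite mulr_ge0// pi_ge0.
exists (2 * pi * \sum_j `|k 0 j|); first by rewrite mulr_ge0// sumr_ge0.
move=> x y; rewrite -mulrBr -opprD -edotBl normrM normrN (ger0_norm pi0) -[leRHS]mulrA.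
apply: ler_wpM2l => //; rewrite edotE (le_trans (ler_norm_sum _ _ _))// mulr_suml.
by apply: ler_sum => j _; rewrite normrM mulrC ler_wpM2l// norm_coord.
Qed.

Lemma expi2piD (s t : R) : expi2pi (s + t) = expi2pi s * expi2pi t.
Proof.
rewrite /expi2pi mulrDr cosD sinD.
by congr (_ +i* _)%C; rewrite addrC.
Qed.

Lemma expi2pi_sum (I : Type) (s : seq I) (f : I -> R) :
  expi2pi (\sum_(i <- s) f i) = \prod_(i <- s) expi2pi (f i).
Proof.
elim: s => [|i s IH]; last by rewrite !big_cons expi2piD IH.
by rewrite !big_nil /expi2pi mulr0 cos0 sin0.
Qed.

(** The indices [b < 2 N + 1] represent the frequencies [b - N], grouped here in
    opposite pairs. *)
Lemma sum_sym (V : zmodType) (F : R -> V) N :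
  \sum_(b < (2 * N).+1) F (b%:R - N%:R) =
  F 0 + \sum_(l < N) (F l.+1%:R + F (- l.+1%:R)).
Proof.
elim: N => [|N IH]; first by rewrite muln0 big_ord1 big_ord0 subrr addr0.
rewrite (_ : (2 * N.+1).+1 = (2 * N).+3); last by rewrite mulnS.
rewrite big_ord_recl big_ord_recr/= [in RHS]big_ord_recr/= [RHS]addrA -IH.
rewrite sub0r [LHS]addrC -addrA; congr (_ + _).
  apply: eq_bigr => b _; congr F; rewrite /bump leq0n add1n -!natr1; ring.
congr (F _ + _); rewrite /bump leq0n add1n -!natr1 mul2n -addnn natrD; ring.
Qed.

Lemma sum_expi2pi N (t : R) :
  \sum_(b < (2 * N).+1) expi2pi (t * (b%:R - N%:R)) = (dker N t +i* 0)%C.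
Proof.
rewrite (sum_sym (fun s => expi2pi (t * s))) mulr0 /dker.
elim: N => [|N IH]; first by rewrite !big_ord0 !addr0 mulr0 addr0 /expi2pi mulr0 cos0 sin0.
rewrite !big_ord_recr/= addrA IH mulrDr addrA.
rewrite /expi2pi mulrN mulrN cosN sinN.
apply/eqP; rewrite eq_complex /=; apply/andP; split; apply/eqP; last by ring.
rewrite (_ : angfreq N.+1 * t = 2 * pi * (t * N.+1%:R)); last by rewrite /angfreq; ring.
ring.
Qed.

(** The frequencies form a cube, so the sum factorises over the coordinates; each
    factor is real because its frequencies come in opposite pairs. *)
Lemma sum_freq n N (z : 'rV[R]_n) :
  \sum_(a : {ffun 'I_n -> 'I_(2 * N).+1}) expi2pi (edot z (freq a)) = (pker N z +i* 0)%C.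
Proof.
transitivity (\sum_(a : {ffun 'I_n -> 'I_(2 * N).+1})
   \prod_j expi2pi (z 0 j * ((a j)%:R - N%:R))).
  apply: eq_bigr => a _; rewrite edotE expi2pi_sum; apply: eq_bigr => j _.
  by rewrite /freq mxE.
rewrite -(bigA_distr_bigA (fun j (b : 'I_(2 * N).+1) => expi2pi (z 0 j * (b%:R - N%:R)))).
under eq_bigr do rewrite sum_expi2pi.
rewrite /pker /tprod; elim/big_ind2: _ => // a b c d -> ->.
by apply/eqP; rewrite eq_complex /= !mulr0 !mul0r subr0 addr0 !eqxx.
Qed.

(** The imaginary part of the kernel vanishes, so the projection acts separately
    on the real and imaginary parts. *)
Lemma fourier_projE n N (f1 f2 : 'rV[R]_n -> R) : lipb f1 -> lipb f2 ->
  fourier_proj N (fun x => (f1 x +i* f2 x)%C) =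
  fun x => (dproj N f1 x +i* dproj N f2 x)%C.
Proof.
move=> l1 l2; apply/funext => x; rewrite /fourier_proj.
pose c (a : {ffun 'I_n -> 'I_(2 * N).+1}) (y : 'rV[R]_n) := cos (2 * pi * edot (x - y) (freq a)).
pose s (a : {ffun 'I_n -> 'I_(2 * N).+1}) (y : 'rV[R]_n) := sin (2 * pi * edot (x - y) (freq a)).
have term a : fourier_coef (fun x => (f1 x +i* f2 x)%C) (freq a) * expi2pi (edot x (freq a)) =
  (intLeb (fun y => f1 y * c a y - f2 y * s a y) +i*
   intLeb (fun y => f1 y * s a y + f2 y * c a y))%C.
  rewrite /fourier_coef; set k := freq a.
  have zE y : 2 * pi * edot (x - y) k = 2 * pi * edot x k + 2 * pi * - edot y k.
    by rewrite edotBl; ring.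
  have [L L0 pL] := phase_lip k.
  have lc : lipb (fun y => cos (2 * pi * - edot y k)) := lipb_comp L0 lipb_cos pL.
  have ls : lipb (fun y => sin (2 * pi * - edot y k)) := lipb_comp L0 lipb_sin pL.
  rewrite (_ : (fun y => complex.Re _) = fun y => f1 y * cos (2 * pi * - edot y k)
      - f2 y * sin (2 * pi * - edot y k))//.
  rewrite (_ : (fun y => complex.Im _) = fun y => f1 y * sin (2 * pi * - edot y k)
      + f2 y * cos (2 * pi * - edot y k))//.
  set p := fun y => _ - _; set p' := fun y => _ + _.
  have lp : lipb p by apply: lipbB; exact: lipbM.
  have lp' : lipb p' by apply: lipbD; exact: lipbM.
  rewrite /expi2pi; set C := cos (2 * pi * _); set S := sin (2 * pi * edot x k).
  apply/eqP; rewrite eq_complex /=; apply/andP; split; apply/eqP.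
    rewrite mulrC [X in _ - X]mulrC -!intLebZ// -intLebB; [|exact: lipbZ|exact: lipbZ].
    congr intLeb; apply/funext => y; rewrite /c /s /p /p' -/k.
    by rewrite zE cosD sinD -/C -/S; ring.
  rewrite mulrC [X in _ + X]mulrC -!intLebZ// -intLebD; [|exact: lipbZ|exact: lipbZ].
  congr intLeb; apply/funext => y; rewrite /c /s /p /p' -/k.
  by rewrite zE cosD sinD -/C -/S; ring.
under eq_bigr do rewrite term.
have sumC (I : Type) (r : seq I) (u v : I -> R) :
    \sum_(i <- r) (u i +i* v i)%C = ((\sum_(i <- r) u i) +i* (\sum_(i <- r) v i))%C.
  elim: r => [|i r IH]; first by rewrite !big_nil.
  by rewrite !big_cons IH.
have lcs (g : R -> R) a : lipb g -> lipb (fun y : 'rV[R]_n => g (2 * pi * edot (x - y) (freq a))).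
  move=> lg; have [L L0 pL] := phase_lip (freq a : 'rV[R]_n).
  apply: (lipb_comp L0 lg) => y z; apply: le_trans (pL y z).
  rewrite le_eqVlt; apply/orP; left; apply/eqP; congr `|_|.
  by rewrite !edotBl; ring.
have lcc a : lipb (c a) by exact: lcs lipb_cos.
have lss a : lipb (s a) by exact: lcs lipb_sin.
rewrite sumC; congr (_ +i* _)%C.
  rewrite -intLeb_sum; last by move=> a; apply: lipbB; exact: lipbM.
  congr intLeb; apply/funext => y.
  have := sum_freq N (x - y); rewrite /expi2pi sumC => -[Ec Es].
  by rewrite sumrB -!mulr_sumr Ec Es mulr0 subr0.
rewrite -intLeb_sum; last by move=> a; apply: lipbD; exact: lipbM.
congr intLeb; apply/funext => y.
have := sum_freq N (x - y); rewrite /expi2pi sumC => -[Ec Es].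
by rewrite big_split/= -!mulr_sumr Ec Es mulr0 add0r.
Qed.

End FourierProjection.

(** * Derivatives along vector fields *)

Section BoundedDerivatives.
Context {R : realType} {n : nat}.
Implicit Types (f g : 'rV[R]_n -> R) (O : set 'rV[R]_n).

(** Continuity is part of the recursion because [C1_differentiable] expresses
    a derivative along a variable direction through the partial ones. *)
Fixpoint bounded_deriv O (j : nat) (M : R) f : Prop :=
  (forall x, O x -> {for x, continuous f} /\ `|f x| <= M) /\
  (if j is j'.+1 then
     forall i, (forall x, O x -> derivable f x (vec i)) /\ bounded_deriv O j' M ('D_(vec i) f)
   else True).

Lemma near_eq_continuous f g x : (\near x, f x = g x) ->
  {for x, continuous f} -> {for x, continuous g}.
Proof.
move=> nfg fc; have fgx := nbhs_singleton nfg; rewrite /= in fgx.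
have : f @ x --> g x by rewrite -fgx; exact: fc.
by apply: (cvg_trans (near_eq_cvg (F := nbhs x) nfg)).
Qed.

Lemma bd_ext O j M f g : open O -> (forall x, O x -> f x = g x) ->
  bounded_deriv O j M f -> bounded_deriv O j M g.
Proof.
move=> oO; elim: j f g => [|j IH] f g fg [f0 fj].
  split=> // x Ox; have [fc fM] := f0 x Ox; split; last by rewrite -fg.
  have nfg : \near x, f x = g x by exact: (filterS fg (open_nbhs_nbhs (conj oO Ox))).
  exact: near_eq_continuous nfg fc.
have nfg x : O x -> \near x, f x = g x.
  by move=> Ox; exact: (filterS fg (open_nbhs_nbhs (conj oO Ox))).
split=> [x Ox|i].
  have [fc fM] := f0 x Ox; split; last by rewrite -fg.
  exact: near_eq_continuous (nfg x Ox) fc.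
have [fd fb] := fj i; split=> [x Ox|].
  by apply: near_eq_derivable (fd x Ox); exact: nfg.
by apply: IH fb => x Ox; apply: near_eq_derive; exact: nfg.
Qed.

Lemma bd_pt O j M f : bounded_deriv O j M f ->
  forall x, O x -> {for x, continuous f} /\ `|f x| <= M.
Proof. by case: j => [|j] []. Qed.

Lemma bdW O j M f : bounded_deriv O j.+1 M f -> bounded_deriv O j M f.
Proof.
elim: j f => [|j IH] f [f0 fj]; first by split.
split=> // i; have [fd fb] := fj i; split=> //; exact: IH.
Qed.

Lemma bd_le O j k M N f : (k <= j)%N -> M <= N -> bounded_deriv O j M f -> bounded_deriv O k N f.
Proof.
move=> kj MN fb; have {fb} : bounded_deriv O k M f.
  by move: fb; rewrite -(subnKC kj); elim: (j - k)%N => [|m IH]; rewrite ?addn0 ?addnS// => /bdW.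
elim: k f {kj} => [|k IH] f [f0 fj].
  by split=> // x Ox; have [fc fM] := f0 x Ox; split=> //; exact: le_trans MN.
split=> [x Ox|i]; first by have [fc fM] := f0 x Ox; split=> //; exact: le_trans MN.
by have [fd fb] := fj i; split=> //; exact: IH.
Qed.

Lemma bdD O j M N f g : open O -> bounded_deriv O j M f -> bounded_deriv O j N g ->
  bounded_deriv O j (M + N) (fun x => f x + g x).
Proof.
move=> oO; elim: j f g => [|j IH] f g [f0 fj] [g0 gj].
  split=> // x Ox; have [fc fM] := f0 x Ox; have [gc gM] := g0 x Ox; split.
    exact: (cvgD fc gc).
  by rewrite (le_trans (ler_normD _ _))// lerD.
split=> [x Ox|i].
  have [fc fM] := f0 x Ox; have [gc gM] := g0 x Ox; split; first exact: (cvgD fc gc).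
  by rewrite (le_trans (ler_normD _ _))// lerD.
have [fd fb] := fj i; have [gd gb] := gj i; split=> [x Ox|].
  by apply: derivableD; [exact: fd|exact: gd].
apply: (bd_ext oO _ (IH _ _ fb gb)) => x Ox.
by rewrite deriveD; [|exact: fd|exact: gd].
Qed.

Lemma bdM O j M N f g : open O -> 0 <= M -> 0 <= N ->
  bounded_deriv O j M f -> bounded_deriv O j N g ->
  bounded_deriv O j (2 ^+ j * (M * N)) (fun x => f x * g x).
Proof.
move=> oO M0 N0; elim: j f g => [|j IH] f g fb gb.
  have [f0 _] := fb; have [g0 _] := gb.
  split=> // x Ox; have [fc fM] := f0 x Ox; have [gc gM] := g0 x Ox; split.
    exact: (cvgM fc gc).
  by rewrite expr0 mul1r normrM ler_pM.
have fb' := bdW fb; have gb' := bdW gb.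
case: fb => f0 fj; case: gb => g0 gj.
split=> [x Ox|i].
  have [fc fM] := f0 x Ox; have [gc gM] := g0 x Ox; split; first exact: (cvgM fc gc).
  rewrite normrM; apply: (@le_trans _ _ (M * N)); first by rewrite ler_pM.
  by apply: ler_peMl; [rewrite mulr_ge0|rewrite exprn_ege1// ler1n].
have [fd fb] := fj i; have [gd gb] := gj i; split=> [x Ox|].
  by apply: derivableM; [exact: fd|exact: gd].
have -> : 2 ^+ j.+1 * (M * N) = 2 ^+ j * (M * N) + 2 ^+ j * (M * N) by rewrite exprS; ring.
apply: (bd_ext oO _ (bdD oO (IH _ _ fb' gb) (IH _ _ fb gb'))) => x Ox.
rewrite deriveM; [|exact: fd|exact: gd].
by rewrite !(_ : forall a b : R, a *: b = a * b)// [X in _ + X]mulrC.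
Qed.

Lemma bd_cst O j (c : R) : open O -> bounded_deriv O j `|c| (fun=> c).
Proof.
move=> oO; elim: j c => [|j IH] c.
  by split=> // x _; split=> //; exact: cst_continuous.
split=> [x _|i]; first by split=> //; exact: cst_continuous.
split=> [x _|]; first exact: derivable_cst.
apply: (@bd_ext _ _ _ (fun=> 0)) => //; first by move=> x _; rewrite derive_cst.
by apply: bd_le (IH 0) => //; rewrite normr0.
Qed.

Lemma bd_sum O j M (I : Type) (s : seq I) (f : I -> 'rV[R]_n -> R) : open O ->
  (forall i, bounded_deriv O j M (f i)) ->
  bounded_deriv O j ((size s)%:R * M) (fun x => \sum_(i <- s) f i x).
Proof.
move=> oO fb; elim: s => [|i s IH] /=.
  have := bd_cst j 0 oO; rewrite normr0 mul0r.
  by apply: (bd_ext oO) => x _; rewrite big_nil.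
rewrite -natr1 mulrDl mul1r addrC.
by apply: (bd_ext oO _ (bdD oO (fb i) IH)) => x _; rewrite big_cons.
Qed.

Lemma bd_dir O j M f (v : 'rV[R]_n -> 'rV[R]_n) : open O -> 0 <= M ->
  bounded_deriv O j.+1 M f -> (forall i, bounded_deriv O j 1 (fun x => v x 0 i)) ->
  bounded_deriv O j (n%:R * 2 ^+ j * M) (fun x => 'D_(v x) f x).
Proof.
move=> oO M0 [f0 fj] vb.
have H i : bounded_deriv O j (2 ^+ j * (1 * M)) (fun x => v x 0 i * 'D_(vec i) f x).
  by apply: bdM => //; have [_] := fj i.
have := bd_sum (index_enum 'I_n) oO H.
rewrite mul1r mulrA [size _](_ : _ = n); last by rewrite -sum1_size sum1_card card_ord.
apply: bd_ext => // x Ox.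
have [||_ ->//] := @C1_differentiable _ _ f x.
- apply: (filterS _ (open_nbhs_nbhs (conj oO Ox))) => y Oy i.
  by have [fd _] := fj i; exact: fd.
- by move=> i; have [_ /bd_pt /(_ x Ox) []] := fj i.
Qed.

Lemma bd_smooth O (p : nat) M h : smooth h ->
  (forall us x, (size us <= p)%N -> `|iterD (map (@vec R n) us) h x| <= M) ->
  forall j us, (size us + j <= p)%N -> bounded_deriv O j M (iterD (map (@vec R n) us) h).
Proof.
move=> sh hM; have [_ /Cinf_onP[hc hd] _] := sh.
elim=> [|j IH] us uj.
  split=> // x _; split; first exact: hc.
  by apply: hM; rewrite (leq_trans _ uj)// leq_addr.
split=> [x _|i].
  split; first exact: hc.
  by apply: hM; rewrite (leq_trans _ uj)// leq_addr.
split=> [x _|]; first exact: hd.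
by apply: (IH (i :: us)); rewrite /= addSn -addnS.
Qed.

Lemma enorm_coord (x : 'rV[R]_n) i : `|x 0 i| <= enorm x.
Proof.
rewrite /enorm -sqrtr_sqr ler_wsqrtr// (bigD1 i)//= lerDl.
by apply: sumr_ge0 => k _; exact: sqr_ge0.
Qed.

Lemma bd_field (r : R) O (v : 'rV[R]_n -> 'rV[R]_n) : open O ->
  Cs_on r O v -> Cs_norm_le r O v 1 ->
  forall j i, (j <= Num.truncn r)%N -> bounded_deriv O j 1 (fun x => v x 0 i).
Proof.
move=> oO [vc vd _] [vn _] j i jr.
suff H us : (size us + j <= Num.truncn r)%N ->
    bounded_deriv O j 1 (fun x => iterD (map (@vec R n) us) v x 0 i) by exact: (H [::]).
have cont vs x : O x -> (size vs <= Num.truncn r)%N ->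
    {for x, continuous (fun x => iterD (map (@vec R n) vs) v x 0 i)} /\
    `|iterD (map (@vec R n) vs) v x 0 i| <= 1.
  move=> Ox vs_r; split.
    apply: (@continuous_comp _ _ _ (iterD (map (@vec R n) vs) v) (fun w : 'rV[R]_n => w 0 i)).
      by apply: vc => //; rewrite size_map.
    exact: coord_continuous.
  apply: (le_trans (enorm_coord _ _)); apply: vn => //; first by rewrite size_map.
  by move=> _ /mapP[k _ ->]; rewrite enorm_vec.
elim: j {jr} us => [|j IH] us us_r.
  by split=> // x Ox; apply: cont => //; rewrite (leq_trans _ us_r)// leq_addr.
split=> [x Ox|k]; first by apply: cont => //; rewrite (leq_trans _ us_r)// leq_addr.
have vd' x : O x -> derivable (iterD (map (@vec R n) us) v) x (vec k).
  by move=> Ox; apply: vd => //; rewrite size_map (leq_trans _ us_r)// addnS ltnS leq_addr.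
split=> [x Ox|]; first by have /derivable_mxP := vd' x Ox; exact.
apply: (bd_ext oO _ (IH (k :: us) _)); last by rewrite /= addSn -addnS.
by move=> x Ox /=; rewrite derive_mx ?mxE//; exact: vd'.
Qed.

Definition fields_op (ws : seq ('rV[R]_n -> 'rV[R]_n)) (h : 'rV[R]_n -> R) :=
  foldr (fun w f x => 'D_(w x) f x) h ws.

(** Each vector field costs one derivative and a factor [n * 2 ^ p], from the sum
    over the coordinates and from the product rule. The fields are defined near
    [x] on different open sets, whose intersection is used. *)
Lemma fields_bound (r : R) (p : nat) (ws : seq ('rV[R]_n -> 'rV[R]_n))
  (h : 'rV[R]_n -> R) (M : R) (W : set 'rV[R]_n) :
  0 <= M -> (p <= Num.truncn r)%N -> (size ws <= p)%N ->
  (forall k, (k < size ws)%N -> exists O, [/\ open O, W `<=` O,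
     Cs_on r O (nth id ws k) & Cs_norm_le r O (nth id ws k) 1]) -> smooth h ->
  (forall us x, (size us <= p)%N -> `|iterD (map (@vec R n) us) h x| <= M) ->
  forall x, W x -> `|fields_op ws h x| <= (n * 2 ^ p + 1)%:R ^+ p * M.
Proof.
move=> M0 pr sp wf sh hM x Wx.
set A : R := (n * 2 ^ p + 1)%:R.
have A1 : 1 <= A by rewrite ler1n addn1.
have [Y [oO Ox Ov]] : exists Y, [/\ open Y, Y x & forall k, (k < size ws)%N ->
    forall j i, (j <= Num.truncn r)%N -> bounded_deriv Y j 1 (fun x => nth id ws k x 0 i)].
  elim: ws wf {sp} => [|w ws IH] wf; first by exists setT; split=> //; exact: openT.
  have [|Y [oO Ox Ov]] := IH; first by move=> k ks; exact: (wf k.+1).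
  have [U [oU WU Uc Un]] := wf 0 (ltn0Sn _).
  exists (Y `&` U); split; [exact: openI|by split=> //; exact: WU|].
  have sub (T T' : set 'rV[R]_n) j f : T' `<=` T -> bounded_deriv T j 1 f -> bounded_deriv T' j 1 f.
    move=> T'T; elim: j f => [|j IHj] f [f0 fj].
      by split=> // y /T'T; exact: f0.
    split=> [y /T'T|i]; first exact: f0.
    have [fd fb] := fj i; split=> [y /T'T|]; first exact: fd.
    exact: IHj.
  case=> [|k] ks j i jr.
    by apply: (sub U) => [y []//|]; exact: (bd_field oU Uc Un).
  by apply: (sub Y) => [y []//|]; exact: Ov.
have key : bounded_deriv Y (p - size ws) (A ^+ size ws * M) (fields_op ws h).
  elim: ws sp Ov {wf} => [|w ws IH] sp Ov.
    by rewrite subn0 expr0 mul1r; exact: (@bd_smooth Y p M h sh hM p [::] (leqnn p)).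
  have {}IH := IH (ltnW sp) (fun k ks => Ov k.+1 ks).
  rewrite /= in sp.
  have pE : (p - size ws = (p - (size ws).+1).+1)%N by rewrite subnSK.
  rewrite pE in IH.
  have B0 : 0 <= A ^+ size ws * M by rewrite mulr_ge0// exprn_ge0// (le_trans ler01).
  have vb i : bounded_deriv Y (p - (size ws).+1) 1 (fun x => w x 0 i).
    by apply: (Ov 0 (ltn0Sn _)); rewrite (leq_trans _ pr)// leq_subr.
  apply: bd_le (bd_dir oO B0 IH vb) => //.
  rewrite /= exprS -[leRHS]mulrA; apply: ler_wpM2r => //.
  rewrite -natrX -natrM ler_nat (leq_trans _ (leq_addr 1 _))// leq_mul2l leq_exp2l//.
  by rewrite leq_subr orbT.
have [_ /le_trans] := bd_pt key Ox; apply; apply: ler_wpM2r => //.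
by rewrite ler_weXn2l.
Qed.

End BoundedDerivatives.

(** * Leaf norms and supremum norms *)

Section ChainRule.
Context {R : realType}.

Lemma is_derive_chain (U V : normedModType R) (c : U -> V) (phi : V -> R) (y v : U) (w : V) :
  differentiable phi (c y) -> is_derive y v c w ->
  is_derive y v (phi \o c) ('D_w phi (c y)).
Proof.
move=> dphi [dc ec].
pose g (h : R) := c (h *: v + y).
have g0 : g 0 = c y by rewrite /g scale0r add0r.
have dg : derivable g 0 1 by exact: (derivable1P c y v).1.
have eg : 'D_1 g 0 = w.
  rewrite -ec /derive.
  have -> : (fun h : R => h^-1 *: (g (h *: 1 + 0) - g 0)) =
    (fun h => h^-1 *: (c (h *: v + y) - c y)); last by [].
  by apply/funext => h; rewrite /g addr0 scale0r add0r [h *: 1]mulr1.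
have dg' : differentiable g 0 by exact/derivable1_diffP.
have dphi' : differentiable phi (g 0) by rewrite g0.
have dpg : differentiable (phi \o g) 0 by exact: differentiable_comp.
have E : (fun h : R => (phi \o c) (h *: v + y)) = phi \o g by [].
apply: DeriveDef.
  by apply: (derivable1P (phi \o c) y v).2; rewrite E; exact/derivable1_diffP.
transitivity ('D_1 (phi \o g) 0).
  rewrite /derive.
  have -> : (fun h : R => h^-1 *: ((phi \o g) (h *: 1 + 0) - (phi \o g) 0)) =
    (fun h => h^-1 *: ((phi \o c) (h *: v + y) - (phi \o c) y)); last by [].
  by apply/funext => h; rewrite /= /g addr0 scale0r add0r [h *: 1]mulr1.
by rewrite deriveE// diff_comp//= -(deriveE _ dg') eg -(deriveE _ dphi') g0.
Qed.

Lemma cube_open n (rho : R) : open (cube rho : set 'rV[R]_n).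
Proof.
rewrite openE => x /= xr; rewrite /interior.
case: n x xr => [|n] x xr; first by near=> y; case.
have r0 : 0 < rho by apply: le_lt_trans (xr ord0).
have xl : `|x| < rho.
  rewrite [ltLHS]/Num.Def.normr/= mx_normrE; apply: bigmax_lt => //= -[i j] _.
  by rewrite (ord1 i); exact: xr.
apply/nbhs_ballP; exists (rho - `|x|) => /=; first by rewrite subr_gt0.
move=> y; rewrite -ball_normE /= => xy j.
apply: (le_lt_trans (norm_coord y j)).
have -> : y = x - (x - y) by rewrite subKr.
by rewrite (le_lt_trans (ler_normB _ _))// -ltrBrDl.
Unshelve. all: by end_near. Qed.

Lemma Cs_differentiable n m (s : R) (O : set 'rV[R]_n) (f : 'rV[R]_n -> 'rV[R]_m) :
  open O -> (1 <= Num.truncn s)%N -> Cs_on s O f ->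
  forall x, O x -> forall k, differentiable (fun x => f x 0 k) x.
Proof.
move=> oO s1 [fc fd _] x Ox k.
have fd' y v : O y -> derivable f y v by move=> Oy; exact: (fd [::]).
have [||//] := @C1_differentiable _ _ (fun x => f x 0 k) x.
  apply: (filterS _ (open_nbhs_nbhs (conj oO Ox))) => y Oy i.
  by have /derivable_mxP := fd' y (vec i) Oy; exact.
move=> i; apply: (@near_eq_continuous _ _ (fun y => 'D_(vec i) f y 0 k)).
  apply: (filterS _ (open_nbhs_nbhs (conj oO Ox))) => y Oy.
  by rewrite derive_mx ?mxE//; exact: fd'.
apply: (@continuous_comp _ _ _ ('D_(vec i) f) (fun w : 'rV[R]_m => w 0 k)).
  exact: (fc [:: vec i]).
exact: coord_continuous.
Qed.

Lemma derive_rV_linear n m (f : 'rV[R]_n -> 'rV[R]_m) x :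
  (forall k, differentiable (fun x => f x 0 k) x) ->
  forall v, derivable f x v /\
    'D_v f x = \row_k 'd (fun x => f x 0 k) x v.
Proof.
move=> fd v.
have dv : derivable f x v.
  by apply/derivable_mxP => i k; rewrite (ord1 i); exact: diff_derivable.
split=> //; rewrite derive_mx//; apply/rowP => k; rewrite !mxE.
by rewrite deriveE.
Qed.

Lemma gdotDl n (G : 'M[R]_n) u v w : gdot G (u + v) w = gdot G u w + gdot G v w.
Proof. by rewrite /gdot !mulmxDl mxE. Qed.

Lemma gdotDr n (G : 'M[R]_n) u v w : gdot G w (u + v) = gdot G w u + gdot G w v.
Proof. by rewrite /gdot linearD/= mulmxDr mxE. Qed.

Lemma gdotZl n (G : 'M[R]_n) a u w : gdot G (a *: u) w = a * gdot G u w.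
Proof. by rewrite /gdot -!scalemxAl mxE. Qed.

Lemma gdotZr n (G : 'M[R]_n) a u w : gdot G w (a *: u) = a * gdot G w u.
Proof. by rewrite /gdot linearZ/= -scalemxAr mxE. Qed.

Lemma gdotC n (G : 'M[R]_n) u v : G^T = G -> gdot G u v = gdot G v u.
Proof.
move=> GT; rewrite /gdot -[in LHS](trmxK (u *m G *m v^T)) mxE !trmx_mul trmxK GT.
by rewrite mulmxA.
Qed.

Lemma gnormZ n (G : 'M[R]_n) a u : 0 <= a -> gnorm G (a *: u) = a * gnorm G u.
Proof.
move=> a0; rewrite /gnorm gdotZl gdotZr mulrA -expr2 sqrtrM ?sqr_ge0//.
by rewrite sqrtr_sqr ger0_norm.
Qed.

(** By polarisation, [4 * gdot G u v] is the difference of the squares of the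
    norms of [u + v] and [u - v]. *)
Lemma gdot_bound n (G : 'M[R]_n) u v K : G^T = G ->
  (forall w, w != 0 -> 0 < gdot G w w) ->
  gnorm G (u + v) <= K -> gnorm G (u - v) <= K -> `|gdot G u v| <= K ^+ 2.
Proof.
move=> GT Gp uK vK.
have Gnn w : 0 <= gdot G w w.
  have [->|w0] := eqVneq w 0; last exact/ltW/Gp.
  by rewrite /gdot !mul0mx mxE.
have sq w : gnorm G w <= K -> 0 <= gdot G w w <= K ^+ 2.
  move=> wK; rewrite Gnn /= -[leLHS]sqr_sqrtr// lerXn2r ?nnegrE ?sqrtr_ge0//.
  exact: le_trans (sqrtr_ge0 _) wK.
have {uK} := sq _ uK; have {vK} := sq _ vK.
have -> : - v = -1 *: v by rewrite scaleN1r.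
rewrite !(gdotDl, gdotDr, gdotZl, gdotZr) (gdotC v u GT).
rewrite ler_norml => /andP[a b] /andP[c d].
by apply/andP; split; lra.
Qed.

Lemma det_bound n (A : 'M[R]_n) K : 0 <= K -> (forall i j, `|A i j| <= K) ->
  `|\det A| <= n`!%:R * K ^+ n.
Proof.
move=> K0 AK; rewrite /determinant (le_trans (ler_norm_sum _ _ _))//.
apply: (@le_trans _ _ (\sum_(s : 'S_n) K ^+ n)).
  apply: ler_sum => s _; rewrite normrM normrX normrN1 expr1n mul1r normr_prod.
  rewrite -[n in K ^+ n]card_ord -prodr_const; apply: ler_prod => i _.
  by rewrite normr_ge0 AK.
by rewrite sumr_const -[leLHS]mulr_natl card_Sn.
Qed.

Lemma enorm_le n (v : 'rV[R]_n) K : 0 <= K -> \sum_i v 0 i ^+ 2 <= K ^+ 2 -> enorm v <= K.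
Proof.
by move=> K0 vK; rewrite /enorm -(ger0_norm K0) -sqrtr_sqr ler_wsqrtr.
Qed.

Lemma enorm_sq n (v : 'rV[R]_n) : enorm v ^+ 2 = \sum_i v 0 i ^+ 2.
Proof. by rewrite sqr_sqrtr//; apply: sumr_ge0 => i _; exact: sqr_ge0. Qed.

Lemma enorm_row_mx n m (u : 'rV[R]_n) (v : 'rV[R]_m) :
  enorm (row_mx u v) ^+ 2 = enorm u ^+ 2 + enorm v ^+ 2.
Proof.
rewrite !enorm_sq big_split_ord/=; congr (_ + _); apply: eq_bigr => i _.
  by rewrite row_mxEl.
by rewrite row_mxEr.
Qed.

Lemma enorm_addsub n (u v : 'rV[R]_n) K : 0 <= K -> enorm u <= K -> enorm v <= K ->
  enorm (u + v) <= 2 * K /\ enorm (u - v) <= 2 * K.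
Proof.
move=> K0 uK vK.
have sq (w : 'rV[R]_n) : enorm w <= K -> \sum_i w 0 i ^+ 2 <= K ^+ 2.
  by move=> wK; rewrite -enorm_sq lerXn2r ?nnegrE// sqrtr_ge0.
have {uK}u2 := sq _ uK; have {vK}v2 := sq _ vK.
have H (w : 'rV[R]_n) : (forall i, w 0 i ^+ 2 <= 2 * u 0 i ^+ 2 + 2 * v 0 i ^+ 2) ->
    enorm w <= 2 * K.
  move=> wuv; apply: enorm_le; first by rewrite mulr_ge0.
  apply: (@le_trans _ _ (\sum_i (2 * u 0 i ^+ 2 + 2 * v 0 i ^+ 2))).
    by apply: ler_sum => i _; exact: wuv.
  rewrite big_split/= -!mulr_sumr exprMn; lra.
split; apply: H => i; rewrite !mxE.
  by have := sqr_ge0 (u 0 i - v 0 i); lra.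
by have := sqr_ge0 (u 0 i + v 0 i); lra.
Qed.

End ChainRule.

Section Leaves.
Context {R : realType} {ds du : nat}.
Variables (r : R) (D : @dynamics R ds du) (P : @leaf_data R ds du).
Hypothesis (r1 : 1 < r) (hD : anosov r D) (hP : leaf_setting r D P).

Lemma kappa_gt0 : 0 < kappa P.
Proof. by have [[+ _] _ _ _ _] := hP. Qed.

Lemma smoothness_ge1 : (1 <= Num.truncn (r + 1))%N.
Proof.
have r0 : 0 <= r by rewrite (le_trans ler01)// ltW.
by rewrite truncn_ge_nat ?addr_ge0// lerDr.
Qed.

Lemma metric_sym x : (dg D x)^T = dg D x.
Proof. by have [_ _ _ _ [[_ _ + _] _ _ _ _]] := hD. Qed.

Lemma metric_pos x v : v != 0 -> 0 < gdot (dg D x) v v.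
Proof. by have [_ _ _ _ [[_ _ _ +] _ _ _ _]] := hD; exact. Qed.

Definition graph_pt (chi : 'rV[R]_ds -> 'rV[R]_du) (y : 'rV[R]_ds) : 'rV[R]_(ds + du) :=
  row_mx y (chi y).

Lemma is_derive_graph_pt chi y v : derivable chi y v ->
  is_derive y v (graph_pt chi) (row_mx v ('D_v chi y)).
Proof.
move=> dchi.
have did : derivable (@id 'rV[R]_ds) y v by exact: derivable_id.
have cE k : (fun z => graph_pt chi z 0 (lshift du k)) = fun z => z 0 k.
  by apply/funext => z; rewrite /graph_pt row_mxEl.
have cE' k : (fun z => graph_pt chi z 0 (rshift ds k)) = fun z => chi z 0 k.
  by apply/funext => z; rewrite /graph_pt row_mxEr.
have dc : derivable (graph_pt chi) y v.
  apply/derivable_mxP => i k; rewrite (ord1 i); case: (split_ordP k) => l ->.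
    by rewrite cE; have /derivable_mxP := did; exact.
  by rewrite cE'; have /derivable_mxP := dchi; exact.
apply: DeriveDef => //; rewrite derive_mx//; apply/rowP => k; rewrite mxE.
case: (split_ordP k) => l ->.
  rewrite row_mxEl cE; have := derive_mx did; rewrite derive_id => /rowP/(_ l).
  by rewrite mxE => ->.
by rewrite row_mxEr cE' (derive_mx dchi) mxE.
Qed.

Lemma admissible_dom (i : 'I_(nchart P)) x chi y : admissible r i x chi ->
  ceball x (AA P * delta P) y -> cube (rad i) (graph_pt chi y).
Proof.
move=> [Ur chir _] Uy.
have [_ /(_ i)[[[rad0 _ _ _ _] _] _ _ _ _] _ _ _] := hP.
have lt23 : 2 * rad i / 3 < rad i by lra.
move=> k; case: (split_ordP k) => l ->.
  by rewrite row_mxEl (lt_trans (Ur y Uy l)).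
by rewrite row_mxEr (lt_trans (chir y Uy l)).
Qed.

Lemma leaf_tangent (i : 'I_(nchart P)) x chi y a : admissible r i x chi ->
  ceball x (AA P * delta P) y ->
  'D_(vec a) (leaf_param i chi) y =
    'D_(row_mx (vec a) ('D_(vec a) chi y)) (psi i) (graph_pt chi y).
Proof.
move=> adm Uy.
have dom := admissible_dom adm Uy.
have [_ _ [_ _ [W [oW UW chiC]] _ _]] := adm.
have [_ /(_ i)[[[_ psiC _ _ _] _] _ _ _ _] _ _ _] := hP.
have s1 := smoothness_ge1.
have dchi : derivable chi y (vec a).
  by have [_ chid _] := chiC; apply: (chid [::]) => //; exact: UW.
have dpsi k : differentiable (fun z => psi i z 0 k) (graph_pt chi y).
  apply: (@Cs_differentiable _ _ _ 1 (cube (rad i))) => //; last exact: (psiC 1%N).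
    exact: cube_open.
  by rewrite truncn1.
have dg := is_derive_graph_pt dchi.
have dlp k : is_derive y (vec a) (fun z => leaf_param i chi z 0 k)
   ('D_(row_mx (vec a) ('D_(vec a) chi y)) (fun z => psi i z 0 k) (graph_pt chi y)).
  exact: (is_derive_chain (phi := fun z => psi i z 0 k) (dpsi k) dg).
rewrite derive_mx; last by apply/derivable_mxP => i0 k; rewrite (ord1 i0); case: (dlp k).
rewrite (derive_rV_linear dpsi _).2; apply/rowP => k; rewrite !mxE.
by have [_ ->] := dlp k; rewrite deriveE.
Qed.

Definition dens_bound : R :=
  Num.sqrt (ds`!%:R * ((2 * (1 + 2 * kappa P) * (1 + kappa P)) ^+ 2) ^+ ds).

(** The tangent vectors of a leaf are the images under the derivative of the chart
    of vectors of norm at most [1 + 2 * kappa P], since the slope of the graph is at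
    most [2 * kappa P]; the derivative of the chart is bounded by [1 + kappa P]. *)
Lemma leaf_density_bound (i : 'I_(nchart P)) x chi y : admissible r i x chi ->
  ceball x (AA P * delta P) y -> 0 <= leaf_density D i chi y <= dens_bound.
Proof.
move=> adm Uy; rewrite sqrtr_ge0 /=; apply: ler_wsqrtr.
have k0 := kappa_gt0.
have dom := admissible_dom adm Uy.
have [_ _ [_ _ _ _ [chiD _]]] := adm.
have [_ /(_ i)[[[_ psiC _ _ _] _] _ [psiN _] /andP[_ cck] _] _ _ _] := hP.
have dpsi k : differentiable (fun z => psi i z 0 k) (graph_pt chi y).
  apply: (@Cs_differentiable _ _ _ 1 (cube (rad i))) => //; last exact: (psiC 1%N).
    exact: cube_open.
  by rewrite truncn1.
have lin := derive_rV_linear dpsi.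
set m := 1 + 2 * kappa P; have m0 : 0 < m by rewrite /m; lra.
have gnb w : enorm w <= 2 * m ->
    gn D (psi i (graph_pt chi y)) ('D_w (psi i) (graph_pt chi y)) <= 2 * m * (1 + kappa P).
  move=> wm; have m20 : 0 < 2 * m by rewrite mulr_gt0.
  have -> : 'D_w (psi i) (graph_pt chi y) =
      (2 * m) *: 'D_((2 * m)^-1 *: w) (psi i) (graph_pt chi y).
    rewrite !(lin _).2; apply/rowP => k; rewrite !mxE linearZ/=.
    by rewrite (_ : forall a b : R, a *: b = a * b)// mulrA divff ?mul1r// gt_eqF.
  rewrite /gn gnormZ ?(ltW m20)// ler_pM2l//.
  have [nb _] := psiN.
  apply: (nb [:: (2 * m)^-1 *: w]) => //; first by rewrite /= smoothness_ge1.
  move=> v; rewrite inE => /eqP ->.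
  rewrite /enorm; under eq_bigr do rewrite mxE exprMn.
  rewrite -mulr_sumr sqrtrM ?sqr_ge0// sqrtr_sqr -/(enorm w).
  by rewrite ger0_norm ?invr_ge0 ?(ltW m20)// ler_pdivrMl// mulr1.
pose w a : 'rV[R]_(ds + du) := row_mx (vec a) ('D_(vec a) chi y).
have wm a : enorm (w a) <= m.
  have : enorm (w a) ^+ 2 <= m ^+ 2.
    rewrite enorm_row_mx enorm_vec expr1n /m.
    have := chiD y (vec a) Uy; rewrite enorm_vec mulr1.
    have := sqrtr_ge0 (\sum_k ('D_(vec a) chi y) 0 k ^+ 2); rewrite -/(enorm _).
    set e := enorm _; nra.
  by rewrite ler_pXn2r ?nnegrE ?sqrtr_ge0 ?(ltW m0).
apply: (le_trans (ler_norm _)); apply: det_bound; first exact: sqr_ge0.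
move=> a b; rewrite mxE -/(vec a) -/(vec b) !(leaf_tangent _ adm Uy) -/(w a) -/(w b).
have [wp wn] := enorm_addsub (ltW m0) (wm a) (wm b).
apply: gdot_bound.
- exact: metric_sym.
- exact: metric_pos.
- have -> : 'D_(w a) (psi i) (graph_pt chi y) + 'D_(w b) (psi i) (graph_pt chi y) =
     'D_(w a + w b) (psi i) (graph_pt chi y).
    by rewrite !(lin _).2; apply/rowP => k; rewrite !mxE linearD.
  exact: gnb wp.
- have -> : 'D_(w a) (psi i) (graph_pt chi y) - 'D_(w b) (psi i) (graph_pt chi y) =
     'D_(w a - w b) (psi i) (graph_pt chi y).
    by rewrite !(lin _).2; apply/rowP => k; rewrite !mxE linearB.
  exact: gnb wn.
Qed.

(** The density, the test function and the vector fields are bounded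
    independently of the leaf, and in its chart the leaf lies over a cube
    of the size of the chart, so that the integrals defining the norm are taken over
    sets of bounded volume. *)
Lemma pqnorm_bound (p : nat) (q : R) : (p <= Num.truncn r)%N ->
  exists2 C : R, 0 <= C & forall h M, smooth h -> 0 <= M ->
    (forall us x, (size us <= p)%N -> `|iterD (map (@vec R (ds + du)) us) h x| <= M) ->
    pqnorm r D P p q h <= C * M.
Proof.
move=> pr.
set A : R := ((ds + du) * 2 ^ p + 1)%:R.
have A0 : 0 <= A by [].
pose V : R := \sum_(i < nchart P) (2 * rad i) ^+ ds.
have rad0 (i : 'I_(nchart P)) : 0 < rad i by have [_ /(_ i)[[[+ _ _ _ _] _] _ _ _ _] _ _ _] := hP.
have V0 : 0 <= V.
  by apply: sumr_ge0 => i _; rewrite exprn_ge0// mulr_ge0// ltW.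
have d0 : 0 <= dens_bound by exact: sqrtr_ge0.
exists (A ^+ p * dens_bound * V); first by rewrite !mulr_ge0// exprn_ge0.
move=> h M sh M0 hM.
have B0 : 0 <= A ^+ p * dens_bound * V * M by rewrite !mulr_ge0// exprn_ge0.
apply: bigmax_le => // k _.
rewrite /norm_minus; set S := [set t | _].
have SB : ubound S (A ^+ p * dens_bound * V * M).
  move=> _ [i [x [chi [v [phi [adm vf [phiC [phiN _] [eta ed eta0]] ->]]]]]].
  apply: (le_trans (ler_norm _)).
  have [_ _ _ _ [AA1 _ del0 _]] := hP.
  have [Ucube _ _] := adm.
  have inball y : phi y != 0 -> ceball x (delta P) y.
    move=> py; rewrite /ceball /=; rewrite leNgt; apply/negP => dy.
    by move/negP: py; apply; apply/eqP/eta0; rewrite ltW// (lt_trans ed).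
  have inU y : ceball x (delta P) y -> ceball x (AA P * delta P) y.
    by rewrite /ceball /= => /le_trans; apply; rewrite ler_peMl// ltW.
  have -> : A ^+ p * dens_bound * V * M = A ^+ p * M * dens_bound * V by ring.
  apply: (@le_trans _ _ (A ^+ p * M * dens_bound * (2 * rad i) ^+ ds)); last first.
    apply: ler_wpM2l; first by rewrite !mulr_ge0// exprn_ge0.
    rewrite /V (bigD1 i)//= lerDl; apply: sumr_ge0 => j _.
    by rewrite exprn_ge0// mulr_ge0// ltW.
  apply: (@iterint_bound _ _ `[- rad i, rad i]) => //.
  - have -> : 2 * rad i = rad i - - rad i by ring.
    by rewrite lebesgue_itvcc//; have := rad0 i; lra.
  - by rewrite !mulr_ge0// exprn_ge0.
  move=> y _.
  have [py|/inball by_] := eqVneq (phi y) 0.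
    rewrite py mulr0 mul0r normr0 mulr_ge0//; first by rewrite !mulr_ge0// exprn_ge0.
    by apply: prodr_ge0 => j _; rewrite indicE.
  have Uy := inU _ by_.
  have -> : \prod_j \1_(`[- rad i, rad i]%classic) (y 0 j) = 1 :> R.
    rewrite big1// => j _; rewrite indicE mem_set//=.
    have := Ucube _ Uy j; have := rad0 i.
    rewrite in_itv /= => ri; rewrite ltr_norml => /andP[y1 y2].
    by apply/andP; split; lra.
  rewrite mulr1 normrM normrM.
  have /andP[dn0 dnb] := leaf_density_bound adm Uy.
  rewrite (ger0_norm dn0) ler_pM// -[leRHS]mulr1 ler_pM//; last first.
    by have := phiN [::] y I isT; apply.
  pose ws := [seq v a | a <- enum 'I_k].
  have sws : size ws = k by rewrite size_map size_enum_ord.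
  have kp : (k <= p)%N by rewrite -ltnS.
  apply: (@fields_bound _ _ r p ws h M (leaf i x chi)) => //.
  - by rewrite sws.
  - move=> l; rewrite sws => lk.
    by rewrite (nth_map (Ordinal lk)) ?size_enum_ord//; exact: vf.
  - by exists y.
have [->|S0] := eqVneq S set0; first by rewrite sup0.
by apply: ge_sup => //; apply/set0P.
Qed.

End Leaves.

(** * Stability of the Keller-Liverani conditions *)

Section Perturbation.
Context {R : realType} (E : lmodType R[i]) (N w : E -> R) (c e2 e3 : R).
Variables A A' : R -> E -> E.
Hypothesis N_ge0 : forall f, 0 <= N f.
Hypothesis w_ge0 : forall f, 0 <= w f.
Hypothesis N_triangle : forall f g, N (f + g) <= N f + N g.
Hypothesis w_triangle : forall f g, w (f + g) <= w f + w g.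
Hypothesis wN : forall f, w f <= c * N f.
Hypothesis c0 : 0 <= c.
Hypothesis e30 : 0 < e3.
Hypothesis e32 : e3 <= e2.
Hypothesis A'_lin : forall eps, 0 <= eps < e3 ->
  forall (z : R[i]) f g, A' eps (z *: f + g) = z *: A' eps f + A' eps g.
Hypothesis A'_0 : forall f, A' 0 f = A 0 f.
Hypothesis A'_close : forall eps, 0 <= eps < e3 ->
  forall f, N (A' eps f - A eps f) <= eps * w f.
Hypothesis A_KL : KL N w `[0, e2[ A.

Let dom eps : 0 <= eps < e3 -> `[0, e2[%classic eps.
Proof.
by move=> /andP[e0 e]; rewrite /= in_itv /= e0 (lt_le_trans e e32).
Qed.

Let dom' eps : `[0, e3[%classic eps -> 0 <= eps < e3.
Proof. by rewrite /= in_itv. Qed.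

Let diff_le eps f : 0 <= eps < e3 -> N (A' eps f - A eps f) <= e3 * w f.
Proof.
move=> he; apply: (le_trans (A'_close he f)); apply: ler_wpM2r => //.
by apply: ltW; have /andP[] := he.
Qed.

Lemma perturb_bounded eps : 0 <= eps < e3 -> bounded_operator N (A' eps).
Proof.
move=> he; split; first exact: A'_lin.
have [/(_ eps (dom he)) [_ [C AC]] _ _ _] := A_KL.
exists (e3 * c + C) => f.
rewrite -[X in N X](subrK (A eps f)) (le_trans (N_triangle _ _))//.
rewrite mulrDl lerD// (le_trans (diff_le f he))// -mulrA ler_wpM2l//.
exact: ltW.
Qed.

Lemma perturb_KL1 : KL1 N w `[0, e3[ A'.
Proof.
have [_ [tau [t0 [tm tu] tp tA tc]] _ _] := A_KL.
have cc : 0 <= c * c by rewrite mulr_ge0.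
exists (fun x => tau x + c * c * x); split.
- by move=> x x0; rewrite addr_ge0 ?t0// mulr_ge0.
- split=> [x y x0 xy|x a x0 xa].
    by rewrite lerD ?tm// ler_wpM2l.
  pose d := a - (tau x + c * c * x).
  have d0 : 0 < d by rewrite subr_gt0.
  have xd : tau x < tau x + d / 2 by rewrite ltrDl divr_gt0.
  have e0 : 0 < d / 2 / (c * c + 1) by rewrite !divr_gt0// ltr_wpDl.
  have := tu x _ x0 xd; move=> H.
  near=> y => y0.
  have h1 : tau y < tau x + d / 2 by move: y0; near: y.
  have h2 : `|x - y| <= d / 2 / (c * c + 1) by near: y; exact: cvgr_dist_le.
  have h3 : c * c * y <= c * c * x + d / 2.
    have h4 : y - x <= d / 2 / (c * c + 1) by rewrite (le_trans _ h2)// distrC ler_norm.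
    have h5 : c * c * (y - x) <= d / 2.
      apply: (@le_trans _ _ (c * c * (d / 2 / (c * c + 1)))); first by rewrite ler_wpM2l.
      by rewrite mulrA ler_pdivrMr ?ltr_wpDl//; lra.
    lra.
  by rewrite /d in h1 h3; lra.
- by move=> x x0; rewrite ltr_wpDr ?tp// mulr_ge0// ltW.
- move=> eps /dom' he f Nf.
  have -> : A' eps f - A' 0 f = (A' eps f - A eps f) + (A eps f - A 0 f).
    by rewrite A'_0 addrA subrK.
  rewrite (le_trans (w_triangle _ _))// [leRHS]addrC lerD//; last by apply: tA => //; exact: dom.
  apply: (le_trans (wN _)); rewrite -mulrA ler_wpM2l//.
  apply: (le_trans (A'_close he f)); rewrite mulrC ler_wpM2r//; first by case/andP: he.
  by have := wN f; rewrite Nf mulr1.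
- have h : c * c * x @[x --> 0^'+] --> c * c * 0.
    by apply: cvgM; [exact: cvg_cst|exact: cvg_at_right_filter].
  have H := cvgD tc h; rewrite mulr0 addr0 in H; exact: H.
Unshelve. all: by end_near. Qed.

Let w_step : exists2 K, 1 <= K & forall eps f, 0 <= eps < e3 -> w (A' eps f) <= K * w f.
Proof.
have [_ _ [C1 [K1 [C10 K10 AK]]] _] := A_KL.
exists (1 + C1 * K1 + c * e3).
  by rewrite -addrA lerDl addr_ge0// mulr_ge0// ltW.
move=> eps f he; rewrite -[X in w X](subrK (A eps f)) (le_trans (w_triangle _ _))//.
have h1 : w (A eps f) <= C1 * K1 * w f by have := AK eps 1%N f (dom he); rewrite expr1.
have h2 : w (A' eps f - A eps f) <= c * e3 * w f.
  by apply: (le_trans (wN _)); rewrite -mulrA ler_wpM2l// diff_le.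
by have := w_ge0 f; rewrite !mulrDl; lra.
Qed.

Let w_iter K : 1 <= K -> (forall eps f, 0 <= eps < e3 -> w (A' eps f) <= K * w f) ->
  forall eps m f, 0 <= eps < e3 -> w (iter m (A' eps) f) <= K ^+ m * w f.
Proof.
move=> K1 AK eps m f he; elim: m => [|m IH]; first by rewrite expr0 mul1r.
rewrite iterS (le_trans (AK _ _ he))// exprS -mulrA ler_wpM2l//.
exact: le_trans ler01 K1.
Qed.

Lemma perturb_KL2 : KL2 w `[0, e3[ A'.
Proof.
have [K K1 AK] := w_step; exists 1, K; split => //; first exact: lt_le_trans ltr01 K1.
by move=> eps m f /dom' he; rewrite mul1r; exact: w_iter.
Qed.

(** Each step replaces one unperturbed factor and adds a term whose strong norm is
    bounded by the weak norm of an iterate, which grows at most exponentially;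
    hence the leading coefficient [al] is unchanged. *)
Lemma perturb_KL3 : KL3 N w `[0, e3[ A'.
Proof.
have [Abnd _ _ [C2 [C3 [K2 [al [C20 C30 K20 /andP[al0 al1] AL]]]]]] := A_KL.
have [K K1 AK] := w_step.
have wi := w_iter K1 AK.
pose M := Num.max K K2.
have MK : K <= M by rewrite le_max lexx.
have MK2 : K2 <= M by rewrite le_max lexx orbT.
have M1 : 1 <= M by exact: le_trans MK.
have M0 : 0 < M by exact: lt_le_trans ltr01 M1.
have K0 : 0 <= K by exact: le_trans ler01 K1.
pose B := (C2 + C3 * c) * e3.
have B0 : 0 <= B by rewrite mulr_ge0 ?addr_ge0 ?mulr_ge0// ltW.
have claim eps f : 0 <= eps < e3 -> forall m j,
    N (iter j (A eps) (iter m (A' eps) f)) <=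
      C2 * al ^+ (j + m) * N f + (C3 + m%:R * B) * M ^+ (j + m) * w f.
  move=> he; have Aeps := dom he.
  have [Alin _] := Abnd eps Aeps.
  have Aadd g h : A eps (g + h) = A eps g + A eps h.
    by have := Alin 1 g h; rewrite !scale1r.
  have Aiter j g h : iter j (A eps) (g + h) = iter j (A eps) g + iter j (A eps) h.
    by elim: j => // j IH; rewrite !iterS IH Aadd.
  elim=> [|m IH] j.
    rewrite addn0 mul0r addr0 /=; apply: (le_trans (AL eps j f Aeps)).
    rewrite lerD2l ler_wpM2r// ler_wpM2l ?(ltW C30)//.
    by rewrite lerXn2r ?nnegrE ?(ltW K20) ?(ltW M0).
  set x := iter m (A' eps) f.
  have -> : iter m.+1 (A' eps) f = A eps x + (A' eps x - A eps x).
    by rewrite iterS addrC subrK.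
  rewrite Aiter (le_trans (N_triangle _ _))// -iterSr.
  apply: (le_trans (lerD (IH j.+1) (AL eps j _ Aeps))).
  set y := A' eps x - A eps x.
  have xw : w x <= M ^+ m * w f.
    apply: (le_trans (wi eps m f he)); apply: ler_wpM2r => //.
    by rewrite lerXn2r ?nnegrE ?(ltW M0).
  have Ny : N y <= e3 * (M ^+ m * w f).
    by apply: (le_trans (diff_le x he)); rewrite ler_wpM2l// ltW.
  have small : C2 * al ^+ j * N y + C3 * K2 ^+ j * w y <= B * M ^+ (j + m.+1) * w f.
    apply: (@le_trans _ _ ((C2 + C3 * c) * M ^+ j * N y)).
      rewrite !mulrDl lerD//.
        rewrite ler_wpM2r// ler_wpM2l ?(ltW C20)//.
        apply: (@le_trans _ _ 1); first by rewrite exprn_ile1 ?ltW.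
        by rewrite exprn_ege1.
      rewrite -[leRHS]mulrA [C3 * c * _]mulrC.
      apply: (@le_trans _ _ (C3 * M ^+ j * (c * N y))).
        rewrite ler_pM// ?mulr_ge0// ?(ltW C30) ?exprn_ge0 ?(ltW K20)//.
        rewrite ler_wpM2l ?(ltW C30)// lerXn2r ?nnegrE ?(ltW K20) ?(ltW M0)//.
      by rewrite le_eqVlt; apply/orP; left; apply/eqP; ring.
    apply: (@le_trans _ _ ((C2 + C3 * c) * M ^+ j * (e3 * (M ^+ m * w f)))).
      apply: ler_wpM2l Ny.
      by rewrite mulr_ge0 ?exprn_ge0 ?(ltW M0)// addr_ge0 ?mulr_ge0// ltW.
    have -> : (C2 + C3 * c) * M ^+ j * (e3 * (M ^+ m * w f)) = B * M ^+ (j + m) * w f.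
      by rewrite /B exprD; ring.
    rewrite addnS exprS ler_wpM2r// ler_wpM2l// ler_peMl// exprn_ge0//.
    exact: ltW.
  rewrite addSnnS -natr1 -addrA lerD2l.
  have -> : (C3 + (m%:R + 1) * B) * M ^+ (j + m.+1) * w f =
    (C3 + m%:R * B) * M ^+ (j + m.+1) * w f + B * M ^+ (j + m.+1) * w f by ring.
  by rewrite lerD2l.
(* the factor 2 absorbs the number [m] of perturbation terms *)
exists C2, (C3 + B), (2 * M), al; split=> //.
- by rewrite ltr_wpDr.
- by rewrite mulr_gt0.
- by rewrite al0.
move=> eps m f /dom' he; apply: (le_trans (claim eps f he m 0)).
rewrite add0n lerD2l; apply: ler_wpM2r => //.
rewrite exprMn [leRHS]mulrA; apply: ler_wpM2r; first by rewrite exprn_ge0// ltW.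
have m2 : m%:R <= 2 ^+ m :> R by rewrite -natrX ler_nat ltnW// ltn_expl.
have m1 : 1 <= 2 ^+ m :> R by rewrite exprn_ege1// ler1n.
by rewrite mulrDl lerD// ?ler_peMr// ?(ltW C30)// mulrC ler_wpM2l.
Qed.

Lemma KL_perturb : KL N w `[0, e3[ A'.
Proof.
split; [|exact: perturb_KL1|exact: perturb_KL2|exact: perturb_KL3].
by move=> eps /dom' he; exact: perturb_bounded.
Qed.

End Perturbation.

(** * Truncated operators *)

Section Complexified.
Context {R : realType} (B : completeNormedModType R).

Lemma cplx_norm_ge0 (nu : B -> R) b : (forall x, 0 <= nu x) -> 0 <= cplx_norm nu b.
Proof. by move=> nu0; rewrite le_max nu0. Qed.

Lemma cplx_normD (nu : B -> R) (b c : cplx B) : (forall x y, nu (x + y) <= nu x + nu y) ->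
  cplx_norm nu (b + c) <= cplx_norm nu b + cplx_norm nu c.
Proof.
move=> nuD; rewrite /cplx_norm ge_max.
by apply/andP; split; apply: (le_trans (nuD _ _)); apply: lerD; rewrite le_max lexx ?orbT.
Qed.

Lemma cplx_norm_le (nu nu' : B -> R) c (b b' : cplx B) : 0 <= c ->
  nu b.1 <= c * nu' b'.1 -> nu b.2 <= c * nu' b'.2 ->
  cplx_norm nu b <= c * cplx_norm nu' b'.
Proof.
move=> c0 h1 h2; rewrite /cplx_norm ge_max; apply/andP; split.
  by apply: (le_trans h1); rewrite ler_wpM2l// le_max lexx.
by apply: (le_trans h2); rewrite ler_wpM2l// le_max lexx orbT.
Qed.

Lemma opC_linear (S : B -> B) : (forall (a : R) x y, S (a *: x + y) = a *: S x + S y) ->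
  forall (z : R[i]) (f g : cplx B), opC S (z *: f + g) = z *: opC S f + opC S g.
Proof.
move=> SL z [f1 f2] [g1 g2].
have SD x y : S (x + y) = S x + S y by rewrite -[x in LHS]scale1r SL scale1r.
have S0 : S 0 = 0 by have := SD 0 0; rewrite addr0 =>
  /(congr1 (fun u => u - S 0)); rewrite subrr addrK.
have SZ a x : S (a *: x) = a *: S x by have := SL a x 0; rewrite !addr0 S0 addr0.
have SB x y : S (x - y) = S x - S y by rewrite -scaleN1r SD SZ scaleN1r.
by congr (_, _); rewrite /= SD ?SB ?SD !SZ.
Qed.

End Complexified.

Section Assembly.
Context {R : realType} {n : nat}.

Lemma continuous_linear_le (B B' : completeNormedModType R) (j : {linear B -> B'}) :
  continuous j -> exists2 c : R, 0 <= c & forall b, `|j b| <= c * `|b|.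
Proof.
move=> jc.
have [c [_ cP]] : \forall r \near +oo_R, forall x, `|j x| <= r * `|x|.
  by apply/linear_boundedP; apply: continuous_linear_bounded; exact: jc.
exists (`|c| + 1); first by rewrite addr_ge0.
move=> b; apply: cP; rewrite (le_lt_trans (ler_norm _))// ltrDl.
by [].
Qed.

Lemma smoothing_smooth r (B : completeNormedModType R) iota (q : 'rV[R]_n -> R) Q :
  @smoothing_extension R n r B iota q Q -> forall b, smooth (Q b).
Proof.
move=> [Qi _ Qb _] b; apply: CinfX_smooth; first exact: Qi.
by move=> k; have [C QC] := Qb k; exists (C * `|b|).
Qed.

(** Both sides are continuous and agree on the dense image of [C^r]. *)
Lemma smoothing_factor r (B B' : completeNormedModType R) nrm iota iota'
    (j : {linear B -> B'}) (q : 'rV[R]_n -> R) Q Q' :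
  is_completion r nrm iota -> bounded_extension r iota iota' id j ->
  smoothing_extension r iota q Q -> smoothing_extension r iota' q Q' ->
  forall b, Q b = Q' (j b).
Proof.
move=> [_ _ dense] [jc jE] [_ QL Qb QE] [_ Q'L Q'b Q'E] b; apply/funext => x.
have [C QC] := Qb 0; have [C' Q'C] := Q'b 0.
have [c c0 jb] := continuous_linear_le jc.
have Qle b' : `|Q b' x| <= C * `|b'| by have [H _] := QC b'; exact: (H [::]).
have Q'le b' : `|Q' b' x| <= C' * `|b'| by have [H _] := Q'C b'; exact: (H [::]).
pose phi b' := Q b' x - Q' (j b') x.
have phiL b1 b2 : phi (b1 - b2) = phi b1 - phi b2.
  rewrite /phi [b1 - b2]addrC -scaleN1r QL linearP Q'L; ring.
have phile b' : `|phi b'| <= (`|C| + `|C'| * c) * `|b'|.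
  rewrite (le_trans (ler_normB _ _))// mulrDl lerD//.
    by rewrite (le_trans (Qle _))// ler_wpM2r// ler_norm.
  rewrite (le_trans (Q'le _))// (le_trans (ler_wpM2r (normr_ge0 _) (ler_norm C')))//.
  by rewrite -mulrA ler_wpM2l.
set M := _ + _ in phile; have M0 : 0 <= M by rewrite addr_ge0// mulr_ge0.
suff : `|phi b| <= 0 by rewrite normr_le0 subr_eq0 => /eqP.
apply/ler_addgt0Pr => e e0; rewrite add0r.
have : closure (iota @` [set h | CsX r h]) b by rewrite dense.
have e1 : 0 < e / (M + 1) by rewrite divr_gt0// ltr_wpDl.
move=> /(_ _ (nbhsx_ballx b _ e1)) [_ [[h hr <-]]].
rewrite -ball_normE /= => bh.
have phih : phi (iota h) = 0 by rewrite /phi jE// QE// Q'E// subrr.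
have -> : phi b = phi (b - iota h) by rewrite phiL phih subr0.
apply: (le_trans (phile _)).
apply: (@le_trans _ _ ((M + 1) * (e / (M + 1)))).
  by apply: ler_pM => //; [rewrite lerDl|exact: ltW].
by rewrite mulrC divfK// gt_eqF// ltr_wpDl.
Qed.

End Assembly.

(** The smoothing operator is bounded from the weak completion to [C^k], where
    [k] exceeds [p] by the number of derivatives spent on the rate. *)
Lemma fourier_smoothing_error (R : realType) (ds du : nat) (r : R)
  (hr : 1 < r) (D : @dynamics R ds du) (hD : anosov r D)
  (P : @leaf_data R ds du) (hP : leaf_setting r D P)
  (p : nat) (q : R) (hpr : p%:R <= r)
  (B B' : completeNormedModType R)
  (iota : ('rV[R]_(ds + du) -> R) -> B) (iota' : ('rV[R]_(ds + du) -> R) -> B')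
  (hB : is_completion r (pqnorm r D P p q) iota)
  (qe : 'rV[R]_(ds + du) -> R) (Q' : B' -> 'rV[R]_(ds + du) -> R)
  (hQ' : smoothing_extension r iota' qe Q') (e : R) :
  0 < e -> exists n0 : nat, forall n, (n0 <= n)%N -> forall b',
    `|iota (dproj n (Q' b')) - iota (Q' b')| <= e * `|b'|.
Proof.
move=> e0.
have r0 : 0 <= r by rewrite (le_trans ler01)// ltW.
have pr : (p <= Num.truncn r)%N by rewrite truncn_ge_nat.
have [C C0 HC] := pqnorm_bound hr hD hP q pr.
have [iL iN _] := hB; have [_ _ Qb _] := hQ'.
pose d := (ds + du)%N.
have [C' QC] := Qb (p + 2 * d.+1)%N.
have c40 : 0 <= 4 * d%:R * 2 ^+ d :> R by rewrite mulr_ge0// exprn_ge0.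
pose G : R := C * (4 * d%:R * 2 ^+ d * `|C'|).
have G0 : 0 <= G by apply: mulr_ge0 => //; exact: mulr_ge0.
exists (Num.truncn (G / e)) => N N0 b'.
set g := Q' b'.
have sg : smooth g by exact: smoothing_smooth hQ' b'.
have sd := smooth_dproj N sg.
pose h := fun x => -1 * g x + dproj N g x.
have sh : smooth h by exact: smooth_lin.
have -> : iota (dproj N g) - iota g = iota h.
  by rewrite (iL (-1) g)//; [rewrite scaleN1r addrC|exact: smooth_CsX|exact: smooth_CsX].
rewrite iN; last exact: smooth_CsX.
have K0 : 0 <= C' * `|b'|.
  by have [H _] := QC b'; apply: le_trans (H [::] 0 I _ _).
set K := C' * `|b'| in K0.
have Np : 0 < N.+1%:R :> R by rewrite ltr0n.
have M0 : 0 <= 4 * d%:R * 2 ^+ d * K / N.+1%:R.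
  by apply: divr_ge0; [exact: mulr_ge0|exact: ltW].
apply: (le_trans (HC h _ sh M0 _)).
  move=> us x up; rewrite (@iterD_lin _ _ setT)//; [|exact: openT| |]; last 2 first.
  - by move=> vs v y _; exact: smoothD.
  - by move=> vs v y _; exact: smoothD.
  rewrite mulN1r addrC distrC; exact: (smooth_dproj_err N K0 sg (QC b') up).
have GN : G / N.+1%:R <= e.
  rewrite ler_pdivrMr// mulrC -ler_pdivrMr//; apply: ltW.
  by apply: (lt_le_trans (truncnS_gt _)); rewrite ler_nat ltnS.
apply: (@le_trans _ _ (G / N.+1%:R * `|b'|)); last exact: ler_wpM2r.
rewrite /G /K.
have -> : C * (4 * d%:R * 2 ^+ d * (C' * `|b'|) / N.+1%:R) =
  C * (4 * d%:R * 2 ^+ d) / N.+1%:R * `|b'| * C' by ring.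
have -> : C * (4 * d%:R * 2 ^+ d * `|C'|) / N.+1%:R * `|b'| =
  C * (4 * d%:R * 2 ^+ d) / N.+1%:R * `|b'| * `|C'| by ring.
apply: ler_wpM2l; last exact: ler_norm.
by apply: mulr_ge0 => //; apply: divr_ge0; [exact: mulr_ge0|exact: ltW].
Qed.

Theorem proposition5p3 (R : realType) (ds du : nat) (r : R)
  (hd : (1 < ds + du)%N) (hr : 1 < r)
  (D : @dynamics R ds du) (hD : anosov r D)
  (P : @leaf_data R ds du) (hP : leaf_setting r D P)
  (p : nat) (q : R) (hp : (0 < p)%N) (hq : 0 < q) (hpq : p%:R + q < r)
  (* B = B^{p,q}, B' = B^{p-1,q+1} and the canonical map j : B -> B' *)
  (B B' : completeNormedModType R)
  (iota : ('rV[R]_(ds + du) -> R) -> B)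
  (iota' : ('rV[R]_(ds + du) -> R) -> B')
  (hB : is_completion r (pqnorm r D P p q) iota)
  (hB' : is_completion r (pqnorm r D P p.-1 (q + 1)) iota')
  (j : {linear B -> B'}) (hj : bounded_extension r iota iota' id j)
  (* the transfer operator and its extension to B *)
  (L0 : ('rV[R]_(ds + du) -> R) -> 'rV[R]_(ds + du) -> R)
  (hL0 : transfer_operator r D L0)
  (L : {linear B -> B}) (hL : bounded_extension r iota iota L0 L)
  (* the kernels and the extensions of Q_eps *)
  (eps1 : R) (heps1 : 0 < eps1)
  (qk : R -> 'rV[R]_(ds + du) -> R)
  (hqk : forall eps, 0 < eps < eps1 -> CinfX (qk eps) /\ kernelS eps (qk eps))
  (Q : R -> B -> 'rV[R]_(ds + du) -> R)
  (hQ : forall eps, 0 < eps < eps1 ->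
     smoothing_extension r iota (qk eps) (Q eps))
  (Q' : R -> B' -> 'rV[R]_(ds + du) -> R)
  (hQ' : forall eps, 0 < eps < eps1 ->
     smoothing_extension r iota' (qk eps) (Q' eps))
  (eps2 : R) (heps2 : 0 < eps2 < eps1)
  (hKL : KL (cplx_norm (fun b : B => `|b|)) (cplx_norm (fun b : B => `|j b|))
            `[0, eps2[ (Leps iota L Q)) :
  exists2 eps3 : R, 0 < eps3 < eps2 &
  exists N : R -> option nat,
    (forall eps, 0 <= eps < eps3 -> (N eps = None <-> eps = 0)) /\
    forall m : R -> option nat,
      (forall eps, 0 <= eps < eps3 -> le_oo (N eps) (m eps)) ->
      KL (cplx_norm (fun b : B => `|b|)) (cplx_norm (fun b : B => `|j b|))
         `[0, eps3[ (fun eps => Lepsn iota L Q eps (m eps)).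
Proof.
have [jc _] := hj.
have [c c0 jle] := continuous_linear_le jc.
have [eps20 eps21] := andP heps2.
have [iL _ _] := hB.
have hpr : p%:R <= r by rewrite ltW// (lt_trans _ hpq)// ltrDl.
have [_ _ [C1 [K1 [C10 K10 hw]]] _] := hKL.
(* the weak bound on a single iterate of the unsmoothed operator *)
have Lw b : `|j (L b)| <= C1 * K1 * `|j b|.
  have dom0 : `[0, eps2[%classic (0 : R) by rewrite /= in_itv /= lexx.
  have := hw 0 1%N (b, 0 : B) dom0.
  rewrite /= /Leps eqxx expr1 /cplx_norm /opC /= !linear0 !normr0 !(max_l (normr_ge0 _)).
  by [].
have truncation eps : exists n0, 0 < eps < eps2 -> forall n, (n0 <= n)%N ->
    forall b, `|iota (dproj n (Q eps (L b))) - iota (Q eps (L b))| <= eps * `|j b|.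
  case: (boolP (0 < eps < eps2)) => [|_]; last by exists 0.
  move=> /andP[e0 e2]; have e1 : 0 < eps < eps1 by rewrite e0 (lt_trans e2).
  have k0 : 0 < C1 * K1 by rewrite mulr_gt0.
  have [m0 m0P] := fourier_smoothing_error hr hD hP hpr hB (hQ' eps e1) (divr_gt0 e0 k0).
  exists m0 => _ n mn b.
  rewrite (smoothing_factor hB hj (hQ eps e1) (hQ' eps e1)).
  apply: (le_trans (m0P n mn _)); apply: (@le_trans _ _ (eps / (C1 * K1) * (C1 * K1 * `|j b|))).
    by rewrite ler_wpM2l// ltW// divr_gt0.
  by rewrite mulrA divfK// gt_eqF.
have [n0 n0P] := choice truncation.
exists (eps2 / 2); first by apply/andP; split; lra.
exists (fun eps => if eps == 0 then None else Some (n0 eps)); split.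
  by move=> eps _; case: eqP.
move=> m mN.
have e32 : eps2 / 2 < eps2 by lra.
have Qsm eps b : 0 < eps < eps2 -> smooth (Q eps b).
  by move=> /andP[e0 e2]; apply: (smoothing_smooth (hQ eps _)); rewrite e0 (lt_trans e2).
have LepsnE eps k (b : cplx B) : 0 < eps < eps2 ->
    Lepsn iota L Q eps (Some k) b = opC (fun b => iota (dproj k (Q eps (L b)))) b.
  move=> he; rewrite /Lepsn /smoothC fourier_projE//; exact/smooth_lipb/Qsm.
have LepsE eps (b : cplx B) : 0 < eps < eps2 ->
    Leps iota L Q eps b = opC (fun b => iota (Q eps (L b))) b.
  by move=> /andP[e0 _]; rewrite /Leps gt_eqF.
have QL eps b b' (a : R) : 0 < eps < eps2 ->
    Q eps (L (a *: b + b')) = fun x => a * Q eps (L b) x + Q eps (L b') x.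
  move=> /andP[e0 e2]; apply/funext => x; rewrite linearP.
  by have [|_ -> _ _] := hQ eps; first by rewrite e0 (lt_trans e2).
have m0 : m 0 = None.
  have := mN 0; rewrite lexx divr_gt0// eqxx => /(_ isT).
  by case: (m 0).
apply: (@KL_perturb R (cplx B) _ _ c eps2 (eps2 / 2) (Leps iota L Q)) => //.
- by move=> f; apply: cplx_norm_ge0.
- by move=> f; apply: cplx_norm_ge0.
- by move=> f g; apply: cplx_normD => x y; exact: ler_normD.
- by move=> f g; apply: cplx_normD => x y; rewrite linearD ler_normD.
- by move=> f; apply: cplx_norm_le.
- by rewrite divr_gt0.
- exact: ltW.
- move=> eps /andP[]; rewrite le_eqVlt => /predU1P[<- _|e0 e3] z f g.
    rewrite m0 /= /Leps eqxx; apply: opC_linear => a x y; exact: linearP.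
  have he : 0 < eps < eps2 by rewrite e0 (lt_trans e3).
  case: (m eps) => [k|].
    rewrite !LepsnE//; apply: opC_linear => a x y.
    rewrite QL// dproj_lin; [|exact/smooth_lipb/Qsm|exact/smooth_lipb/Qsm].
    by apply: iL; apply: smooth_CsX; apply: smooth_dproj; exact: Qsm.
  rewrite /= !LepsE//; apply: opC_linear => a x y.
  by rewrite QL//; apply: iL; apply: smooth_CsX; exact: Qsm.
- by move=> f; rewrite m0.
- move=> eps /[dup] he3 /andP[]; rewrite le_eqVlt => /predU1P[<- _|e0 e3] f.
    by rewrite m0 /= subrr mul0r /cplx_norm !normr0 maxxx.
  have he : 0 < eps < eps2 by rewrite e0 (lt_trans e3).
  have := mN eps he3; rewrite gt_eqF//.
  case: (m eps) => [k kn|_]; last first.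
    by rewrite /= subrr /cplx_norm /= !normr0 maxxx mulr_ge0 ?(ltW e0)// le_max normr_ge0.
  rewrite LepsnE// LepsE//.
  by apply: cplx_norm_le; [exact: ltW|exact: n0P|exact: n0P].
Qed.
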